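(* Let $K$ be a field of characteristic $p>0$. Then: 1. The map $\mathrm{Max}(P_n)\to\widehat{\mathcal D(P_n)}(\text{fin. pres.})$, $\mathfrak m\mapsto[U(\mathfrak m):=\mathcal D(P_n)\otimes_{A(\mathfrak m)}V(\mathfrak m)]$, is a bijection with inverse $[M]\mapsto\mathrm{ass}_{P_n}(M)$ (the set of associated primes of the $P_n$-module $M$). In particular, $\mathrm{ass}_{P_n}(U(\mathfrak m))=\{\mathfrak m\}$. 2. Each simple finitely presented $\mathcal D(P_n)$-module is holonomic. 3. (An analogue of Quillen's Lemma) $\mathrm{End}_{\mathcal D(P_n)}(U(\mathfrak m))\simeq(P_n/\mathfrak m)^{sep}$. 4. On the simple $\mathcal D(P_n)$-module $U(\mathfrak m)=\Lambda(\mathfrak m)\otimes V(\mathfrak m)$ consider the filtration $\{U(\mathfrak m)_i:=F_i(1\otimes V(\mathfrak m))=\bigoplus_{i_1p^{k_1}+\cdots+i_np^{k_n}\le i}\partial_1^{[i_1p^{k_1}]}\cdots\partial_n^{[i_np^{k_n}]}\otimes V(\mathfrak m)\}$. Then (a) the Poincaré series $P_{U(\mathfrak m)}(\omega):=\sum_{i\ge0}\dim_K(U(\mathfrak m)_i)\omega^i=\dfrac{p^k[(P_n/\mathfrak m)^{sep}:K]}{(1-\omega)\prod_{i=1}^n(1-\omega^{p^{k_i}})}$, where $k:=k_1+\cdots+k_n$; (b) the multiplicity $e(U(\mathfrak m))=[(P_n/\mathfrak m)^{sep}:K]=\dim_K(\mathrm{End}_{\mathcal D(P_n)}(U(\mathfrak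 m)))$ is a natural number; (c) $\dim_K(U(\mathfrak m)_i)=\frac{[(P_n/\mathfrak m)^{sep}:K]}{n!}i^n+\cdots$, $i\gg0$, is an almost polynomial with period $p^{\max\{k_1,\dots,k_n\}}$.
   Context: $P_n=K[x_1,\dots,x_n]$, $n\ge1$; $\mathcal D(P_n)$ is the ring of $K$-linear differential operators on $P_n$; modules are left modules; $\otimes=\otimes_K$ unless indicated. For $j\ge0$ let $\partial_i^{[j]}=\frac{\partial_i^j}{j!}$ be the operator $x^\alpha\mapsto\binom{\alpha_i}{j}x^{\alpha-je_i}$ (zero if $j>\alpha_i$), $\partial^{[\beta]}=\prod_i\partial_i^{[\beta_i]}$. Then $\mathcal D(P_n)=\bigoplus_{\alpha,\beta}Kx^\alpha\partial^{[\beta]}=\bigotimes_i\mathcal D(K[x_i])$. Canonical filtration: $F_i=\bigoplus_{|\alpha|+|\beta|\le i}Kx^\alpha\partial^{[\beta]}$. $\mathrm{Max}(P_n)$ is the set of maximal ideals, $\widehat{\mathcal D(P_n)}(\text{fin. pres.})$ the set of isomorphism classes $[M]$ of simple finitely presented $\mathcal D(P_n)$-modules. For an algebraic field extension $L/K$, $L^{sep}$ is the maximal separable subextension. Let $\mathfrak m\in\mathrm{Max}(P_n)$. For each $i$ let $g_i\in K[x_i]$ be the monic irreducible polynomial generating $K[x_i]\cap\mathfrak m$; write uniquely $g_i(x_i)=f_i(x_i^{p^{k_i}})$ with $f_i(t)\in K[t]$ monic irreducible separable, $k_i\ge0$. Let $L_i:=K[x_i]/(g_i)$, $L_i':=K[x_i^{p^{k_i}}]/(g_i)=L_i^{sep}$.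 Then $\bigotimes_iL_i'\simeq\prod_{\nu=1}^\mu\Gamma_\nu$ with $\Gamma_\nu$ finite separable field extensions of $K$. Let $A(\mathfrak m)_i:=\bigoplus_{0\le j<p^{k_i}}\partial_i^{[j]}K[x_i]$ (a subalgebra of $\mathcal D(K[x_i])$ in which $g_i$ is central), $A(\mathfrak m):=\bigotimes_iA(\mathfrak m)_i$, and $\bar A(\mathfrak m):=\bigotimes_iA(\mathfrak m)_i/A(\mathfrak m)_ig_i\simeq M_{p^k}(\bigotimes_iL_i')\simeq\prod_{\nu}M_{p^k}(\Gamma_\nu)$, $k=k_1+\cdots+k_n$. There is a unique $\nu$ for which the composite $\prod_\nu\Gamma_\nu\simeq\bigotimes_iL_i'\to\bigotimes_iL_i\to P_n/\mathfrak m$ is nonzero on $\Gamma_\nu$; put $\Gamma(\mathfrak m):=\Gamma_\nu$ (it equals $(P_n/\mathfrak m)^{sep}$). $V(\mathfrak m)$ is the unique (up to isomorphism) simple $\bar A(\mathfrak m)$-module on which the factor $M_{p^k}(\Gamma(\mathfrak m))$ acts nontrivially, viewed as an $A(\mathfrak m)$-module. $\Lambda(\mathfrak m):=\bigotimes_i\bigoplus_{j\ge0}K\partial_i^{[jp^{k_i}]}$, and $\mathcal D(P_n)=\Lambda(\mathfrak m)\otimes A(\mathfrak m)$. A nonzero finitely generated module $M=\mathcal D(P_n)M_0$ ($\dim_KM_0<\infty$) is holonomic if there is a polynomial $q\in\mathbb Q[t]$ of degree $n$ with $\dim_K(F_iM_0)\le q(i)$ for $i\gg0$ (independent of $M_0$).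 If $\dim_K(F_iM_0)=\frac{e}{n!}i^n+o(i^n)$, then $e=e(M)$ is the multiplicity. An almost polynomial of period $m$ is a function $f:\mathbb N\to\mathbb N$ for which there are polynomials $p_s\in\mathbb Q[t]$, $s\in\mathbb Z/m\mathbb Z$, all of the same degree and leading coefficient, with $f(i)=p_{i\bmod m}(i)$ for $i\gg0$. Three dots denote terms of smaller order. *)

(* Defs.v *)
From HB Require Import structures.
From mathcomp Require Import all_boot all_order all_algebra all_field.
From mathcomp Require Import ring_quotient ring.
From mathcomp Require Import boolp classical_sets functions.
From mathcomp Require ssrcomplements.
From mathcomp Require Import monalg.
From mathcomp Require Import mpoly.

Set Implicit Arguments.
Unset Strict Implicit.
Unset Printing Implicit Defensive.

Import Order.TTheory GRing.Theory Num.Theory.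

Local Open Scope ring_scope.

Section Modules.
Variable R : nzRingType.

Definition isom_mod (M N : lmodType R) : Prop :=
  exists f : {linear M -> N}, bijective f.

Definition simple_mod (M : lmodType R) : Prop :=
  (exists v : M, v != 0) /\
  (forall S : {pred M}, GRing.submod_closed S ->
     (forall v, v \in S -> v = 0) \/ (forall v, v \in S)).

(* Finite presentation: an exact sequence [R^r -> R^s -> M -> 0]. *)
Definition finitely_presented (M : lmodType R) : Prop :=
  exists (r s : nat) (g : {linear 'rV[R]_r -> 'rV[R]_s})
         (f : {linear 'rV[R]_s -> M}),
    (forall v, exists x, f x = v) /\
    (forall x, f x = 0 <-> exists y, x = g y).

End Modules.

Definition span (R : pzRingType) (M : lmodType R) (S : set M) : set M :=
  fun v => forall W : {pred M}, GRing.submod_closed W ->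
    (forall w, S w -> w \in W) -> v \in W.

Section SpanTheory.
Variables (R : pzRingType) (M : lmodType R).

Lemma span_incl (S : set M) v : S v -> span S v.
Proof. by move=> Sv W _; apply. Qed.

Lemma span_ind (S T : set M) : GRing.submod_closed (fun v => `[< T v >]) ->
  (forall v, S v -> T v) -> forall v, span S v -> T v.
Proof.
move=> clT ST v /(_ (fun v => `[< T v >]) clT) h; apply/asboolP.
by apply: h => w /ST Tw; apply/asboolP.
Qed.

Lemma span_closed (S : set M) : GRing.submod_closed (fun v => `[< span S v >]).
Proof.
split; first by apply/asboolP => W [W0 _].
move=> a u v /asboolP Su /asboolP Sv; apply/asboolP => W cW SW.
by case: (cW) => _; apply; [apply: Su | apply: Sv].
Qed.

End SpanTheory.

Definition has_dim (K : fieldType) (V : lmodType K) (W : set V) (d : nat) :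
    Prop :=
  exists b : 'I_d -> V,
    (forall v, W v <-> exists c : 'I_d -> K, v = \sum_i c i *: b i) /\
    (forall c : 'I_d -> K, \sum_i c i *: b i = 0 -> forall i, c i = 0).

Definition restrict (R S : pzRingType) (f : {rmorphism R -> S})
  (M : lmodType S) : Type := M.

Section Restriction.
Variables (R S : pzRingType) (f : {rmorphism R -> S}) (M : lmodType S).

HB.instance Definition _ := GRing.Zmodule.on (restrict f M).

Definition restrict_scale (a : R) (v : restrict f M) : restrict f M :=
  f a *: (v : M).

Fact restrict_scaleA a b v :
  restrict_scale a (restrict_scale b v) = restrict_scale (a * b) v.
Proof. by rewrite /restrict_scale rmorphM scalerA. Qed.

Fact restrict_scale1 : left_id 1 restrict_scale.
Proof. by move=> v; rewrite /restrict_scale rmorph1 scale1r. Qed.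

Fact restrict_scaleDr : right_distributive restrict_scale +%R.
Proof. by move=> a u v; rewrite /restrict_scale; exact: scalerDr. Qed.

Fact restrict_scaleDl (v : restrict f M) : {morph restrict_scale^~ v : a b / a + b}.
Proof. by move=> a b; rewrite /restrict_scale rmorphD; exact: scalerDl. Qed.

HB.instance Definition _ := GRing.Zmodule_isLmodule.Build R (restrict f M)
  restrict_scaleA restrict_scale1 restrict_scaleDr restrict_scaleDl.

End Restriction.

Section QuotientModule.
Variables (R : pzRingType) (M : lmodType R) (S : set M).

Definition span_pred : {pred M} := fun v => `[< span S v >].

HB.instance Definition _ :=
  GRing.isSubmodClosed.Build R M span_pred (span_closed S).

Definition quotmod : Type := Quotient.quot span_pred.

HB.instance Definition _ := GRing.Zmodule.on quotmod.

Definition quotmod_proj (v : M) : quotmod := \pi_(Quotient.quot span_pred)%qT v.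

Definition quotmod_scale (a : R) (x : quotmod) : quotmod :=
  quotmod_proj (a *: repr (x : Quotient.quot span_pred)).

Lemma quotmod_projD : {morph quotmod_proj : u v / u + v}.
Proof. by move=> u v; apply: (@Quotient.pi_add _ span_pred). Qed.

Lemma quotmod_projZ a v : quotmod_proj (a *: v) = quotmod_scale a (quotmod_proj v).
Proof.
rewrite /quotmod_scale /quotmod_proj; apply/eqP.
rewrite -Quotient.idealrBE -scalerBr rpredZ //.
by rewrite Quotient.idealrBE reprK.
Qed.

Lemma quotmod_surj (x : quotmod) : exists v, x = quotmod_proj v.
Proof. by exists (repr (x : Quotient.quot span_pred)); rewrite /quotmod_proj reprK. Qed.

Fact quotmod_scaleA a b x :
  quotmod_scale a (quotmod_scale b x) = quotmod_scale (a * b) x.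
Proof.
by have [v ->] := quotmod_surj x; rewrite -!quotmod_projZ scalerA.
Qed.

Fact quotmod_scale1 : left_id 1 quotmod_scale.
Proof. by move=> x; have [v ->] := quotmod_surj x; rewrite -quotmod_projZ scale1r. Qed.

Fact quotmod_scaleDr : right_distributive quotmod_scale +%R.
Proof.
move=> a x y; have [u ->] := quotmod_surj x; have [v ->] := quotmod_surj y.
by rewrite -quotmod_projD -!quotmod_projZ -quotmod_projD scalerDr.
Qed.

Fact quotmod_scaleDl x : {morph quotmod_scale^~ x : a b / a + b}.
Proof.
move=> a b; have [u ->] := quotmod_surj x.
by rewrite -!quotmod_projZ -quotmod_projD scalerDl.
Qed.

HB.instance Definition _ := GRing.Zmodule_isLmodule.Build R quotmod
  quotmod_scaleA quotmod_scale1 quotmod_scaleDr quotmod_scaleDl.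

End QuotientModule.

(* [S (x)_R V] along [f : R -> S], as the left [S]-module generated by the
   symbols [1 (x) v] subject to additivity in [v] and
   [1 (x) (a *: v) = f a *: (1 (x) v)]. *)
Section ExtensionOfScalars.
Variables (R : pzRingType) (S : nzRingType) (f : {rmorphism R -> S}).
Variable V : lmodType R.

Let gen (v : V) : {malg S[V]} := << v >>.

Definition tensor_relations : set ({malg S[V]}) := fun x =>
  (exists u v, x = gen (u + v) - gen u - gen v) \/
  (exists a v, x = gen (a *: v) - f a *: gen v).

Definition tensor : lmodType S := quotmod tensor_relations.

Definition one_tensor (v : V) : tensor :=
  quotmod_proj tensor_relations (gen v).

End ExtensionOfScalars.

Section DiffOps.
Variables (K : fieldType) (n : nat).
Local Notation P := {mpoly K[n]}.
Implicit Types (f g : P -> P) (r q : P).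

Definition comm_poly f r : P -> P := fun q => f (r * q) - r * f q.

(* Grothendieck's order filtration, shifted: [order_lt i.+1] is order at
   most [i], and [order_lt 0] consists of the zero operator. *)
Fixpoint order_lt i f : Prop :=
  if i is j.+1 then forall r, order_lt j (comm_poly f r)
  else forall q, f q = 0.

Definition is_diffop f : bool :=
  `[< linear f /\ exists i, order_lt i f >].

Record diffop : predArgType := DiffOp {
  diffop_fun :> P -> P;
  _ : is_diffop diffop_fun
}.

HB.instance Definition _ := [isSub for diffop_fun].
HB.instance Definition _ := [Choice of diffop by <:].

Lemma eq_order_lt i f g : f =1 g -> order_lt i f -> order_lt i g.
Proof. by move=> /funext ->. Qed.

Lemma order_ltS i f : order_lt i f -> order_lt i.+1 f.
Proof.
elim: i f => [|i IH] f /= Hf; last by move=> r; apply: IH; apply: Hf.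
by move=> r q; rewrite /comm_poly !Hf mulr0 subr0.
Qed.

Lemma order_lt_leq i j f : (i <= j)%N -> order_lt i f -> order_lt j f.
Proof.
move=> /subnK <-; elim: (j - i)%N => // d IH Hf.
by rewrite addSn; apply: order_ltS; apply: IH.
Qed.

Lemma order_lt0 i : order_lt i (fun=> 0).
Proof.
by elim: i => [|i IH] //= r; apply: eq_order_lt IH => q; rewrite /comm_poly mulr0 subr0.
Qed.

Lemma order_ltD i f g :
  order_lt i f -> order_lt i g -> order_lt i (fun q => f q + g q).
Proof.
elim: i f g => [|i IH] f g Hf Hg /=; first by move=> q; rewrite Hf Hg addr0.
move=> r; apply: eq_order_lt (IH _ _ (Hf r) (Hg r)) => q.
by rewrite /comm_poly mulrDr opprD addrACA.
Qed.

Lemma order_ltMl i s f : order_lt i f -> order_lt i (fun q => s * f q).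
Proof.
elim: i f => [|i IH] f Hf /=; first by move=> q; rewrite Hf mulr0.
move=> r; apply: eq_order_lt (IH _ (Hf r)) => q.
by rewrite /comm_poly mulrBr mulrCA.
Qed.

Lemma order_ltMr i s f : order_lt i f -> order_lt i (fun q => f (s * q)).
Proof.
elim: i f => [|i IH] f Hf /=; first by move=> q; rewrite Hf.
move=> r; apply: eq_order_lt (IH _ (Hf r)) => q.
by rewrite /comm_poly mulrCA.
Qed.

Lemma order_lt_comp i j f g : linear f ->
  order_lt i f -> order_lt j g -> order_lt (i + j) (f \o g).
Proof.
have [k] := ubnP (i + j); elim: k i j f g => // k IH [|i] [|j] f g.
- by move=> _ _ Hf _ q; rewrite /= Hf.
- by move=> _ _ Hf _; apply: eq_order_lt (order_lt0 _) => q; rewrite /= Hf.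
- move=> _ linf _ Hg; apply: eq_order_lt (order_lt0 _) => q; rewrite /= Hg.
  by have /eqP := linf 1 0 0; rewrite !scale1r addr0 -subr_eq subrr eq_sym => /eqP.
rewrite addSn addnS !ltnS => lek linf Hf Hg r.
have subf u v : f (u - v) = f u - f v.
  by rewrite -scaleN1r addrC linf scaleN1r addrC.
have H1 : order_lt (i + j).+1 (f \o comm_poly g r).
  by rewrite -addSn; apply: IH => //; rewrite addSn.
have H2 : order_lt (i + j).+1 (comm_poly f r \o g).
  rewrite -addnS; apply: IH => //; first by rewrite addnS.
  move=> a u v; rewrite /comm_poly mulrDr -scalerAr !linf mulrDr -scalerAr.
  by rewrite scalerBr opprD addrACA.
apply: eq_order_lt (order_ltD H1 H2) => q /=.
by rewrite /comm_poly subf addrA subrK.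
Qed.

Lemma diffop_linear (f : diffop) : linear f.
Proof. by case: f => f Hf; case/asboolP: (Hf). Qed.

HB.instance Definition _ (f : diffop) :=
  GRing.isLinear.Build K P P *:%R f (@diffop_linear f).

Lemma diffop_order (f : diffop) : exists i, order_lt i f.
Proof. by case: f => f Hf; case/asboolP: (Hf). Qed.

Fact is_diffop_submod : GRing.submod_closed (is_diffop : {pred P -> P}).
Proof.
split; first by apply/asboolP; split;
  [by move=> a u v; rewrite scaler0 addr0 | by exists 0%N].
move=> a f g /asboolP[linf [i Hf]] /asboolP[ling [j Hg]]; apply/asboolP; split.
  move=> b u v; rewrite !fctE linf ling !scalerDr !scalerA (mulrC a) -!addrA.
  by congr (_ + _); rewrite addrCA.
exists (maxn i j).
have H1 := order_lt_leq (leq_maxl i j) (order_ltMl a%:MP Hf).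
have H2 := order_lt_leq (leq_maxr i j) Hg.
by apply: eq_order_lt (order_ltD H1 H2) => q; rewrite mul_mpolyC.
Qed.

HB.instance Definition _ :=
  GRing.SubChoice_isSubLmodule.Build K (P -> P) is_diffop diffop is_diffop_submod.

Lemma diffopP (f g : diffop) : (forall q, f q = g q) -> f = g.
Proof. by move=> fg; apply/val_inj/funext. Qed.

Fact mulop_subproof r : is_diffop (fun q => r * q).
Proof.
apply/asboolP; split; first by move=> a u v; rewrite mulrDr -scalerAr.
by exists 1%N => s q; rewrite /comm_poly mulrCA subrr.
Qed.
Definition mulop r : diffop := DiffOp (mulop_subproof r).

Fact diffop_mul_subproof (f g : diffop) : is_diffop (f \o g).
Proof.
apply/asboolP; split; first by move=> a u v; rewrite /= !linearP.
have [i Hf] := diffop_order f; have [j Hg] := diffop_order g.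
by exists (i + j)%N; apply: order_lt_comp => //; exact: diffop_linear.
Qed.
Definition diffop_mul (f g : diffop) : diffop := DiffOp (diffop_mul_subproof f g).

Fact diffop_mulA : associative diffop_mul.
Proof. by move=> f g h; apply: diffopP. Qed.
Fact diffop_mul1 : left_id (mulop 1) diffop_mul.
Proof. by move=> f; apply: diffopP => q; rewrite /= mul1r. Qed.
Fact diffop_mulr1 : right_id (mulop 1) diffop_mul.
Proof. by move=> f; apply: diffopP => q; rewrite /= mul1r. Qed.
Fact diffop_mulDl : left_distributive diffop_mul +%R.
Proof. by move=> f g h; apply: diffopP. Qed.
Fact diffop_mulDr : right_distributive diffop_mul +%R.
Proof. by move=> f g h; apply: diffopP => q; rewrite /= !fctE linearD. Qed.
Fact diffop_oner_neq0 : mulop 1 != 0.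
Proof.
apply/eqP => /(congr1 (fun f : diffop => f 1)) /eqP.
by rewrite /= mulr1 oner_eq0.
Qed.

(* The product of [diffop] is composition. *)
HB.instance Definition _ := GRing.Zmodule_isNzRing.Build diffop
  diffop_mulA diffop_mul1 diffop_mulr1 diffop_mulDl diffop_mulDr
  diffop_oner_neq0.

Fact diffop_scaleAl (a : K) (f g : diffop) : a *: (f * g) = a *: f * g.
Proof. by apply: diffopP. Qed.
HB.instance Definition _ := GRing.Lmodule_isLalgebra.Build K diffop diffop_scaleAl.
Fact diffop_scaleAr (a : K) (f g : diffop) : a *: (f * g) = f * (a *: g).
Proof. by apply: diffopP => q; rewrite /= !fctE linearZ. Qed.
HB.instance Definition _ := GRing.Lalgebra_isAlgebra.Build K diffop diffop_scaleAr.

Lemma mulopM r s : mulop (r * s) = mulop r * mulop s.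
Proof. by apply: diffopP => q; rewrite /= mulrA. Qed.

Definition mbin (a b : 'X_{1..n}) : nat := (\prod_(i < n) 'C(a i, b i))%N.

(* [x^a |-> binom(a, b) x^(a - b)]; the truncated difference [a - b] is
   harmless as the coefficient vanishes unless [b <= a]. *)
Definition divderiv_fun (b : 'X_{1..n}) r : P :=
  \sum_(a <- msupp r) (r@_a * (mbin a b)%:R) *: 'X_[a - b].

Lemma divderivwE b r k : (msize r <= k)%N ->
  divderiv_fun b r =
    \sum_(a : 'X_{1..n < k}) (r@_a * (mbin a b)%:R) *: 'X_[a - b].
Proof.
pose I : subFinType _ := 'X_{1..n < k}.
move=> le_pk; rewrite /divderiv_fun (ssrcomplements.big_mksub I) /=; first last.
  by move=> x /msize_mdeg_lt/leq_trans/(_ le_pk).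
  by rewrite msupp_uniq.
rewrite big_rmcond //= => j /memN_msupp_eq0 ->.
by rewrite mul0r scale0r.
Qed.

Lemma divderiv_is_linear b : linear (divderiv_fun b).
Proof.
move=> c r q; pose k := maxn (msize (c *: r + q)) (maxn (msize r) (msize q)).
rewrite !(@divderivwE b _ k) ?leq_max ?leqnn ?orbT //.
rewrite scaler_sumr -big_split /=; apply/eq_bigr=> a _.
by rewrite scalerA -scalerDl mcoeffD mcoeffZ mulrDl mulrA.
Qed.

HB.instance Definition _ b := GRing.isLinear.Build K P P *:%R
  (divderiv_fun b) (divderiv_is_linear b).

Lemma divderivX b a : divderiv_fun b 'X_[a] = (mbin a b)%:R *: 'X_[a - b].
Proof. by rewrite /divderiv_fun msuppX big_seq1 mcoeffX eqxx mul1r. Qed.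

Lemma linear_ext (f g : {linear P -> P}) :
  (forall a, f 'X_[a] = g 'X_[a]) -> f =1 g.
Proof.
move=> fg r; rewrite [r]mpolyE !linear_sum; apply: eq_bigr => a _.
by rewrite !linearZ /= fg.
Qed.

Lemma divderivMX b (i : 'I_n) r : divderiv_fun b ('X_i * r) =
  'X_i * divderiv_fun b r +
    (if b i == 0%N then 0 else divderiv_fun (b - U_(i)) r).
Proof.
rewrite [r]mpolyE mulr_sumr !linear_sum mulr_sumr.
have -> : (if b i == 0%N then 0 else
     \sum_(a <- msupp r) divderiv_fun (b - U_(i)) (r@_a *: 'X_[a])) =
   \sum_(a <- msupp r) (if b i == 0%N then 0 else
     divderiv_fun (b - U_(i)) (r@_a *: 'X_[a])).
  by case: ifP => // _; rewrite big1.
rewrite -big_split; apply: eq_bigr => a _ /=.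
have -> c : (if b i == 0%N then 0 else divderiv_fun (b - U_(i)) (c *: 'X_[a]))
   = c *: (if b i == 0%N then 0 else divderiv_fun (b - U_(i)) 'X_[a]).
  by case: ifP => _; rewrite ?scaler0 // linearZ.
rewrite -scalerAr !linearZ /= -scalerAr -scalerDr; congr (_ *: _).
have mbinE (c d : 'X_{1..n}) :
    mbin c d = ('C(c i, d i) * \prod_(j < n | j != i) 'C(c j, d j))%N.
  by rewrite /mbin (bigD1 i).
rewrite -mpolyXD !divderivX -scalerAr -mpolyXD !mbinE mnmDE mnm1E eqxx.
have eqR (c : 'X_{1..n}) (u : 'X_{1..n}) :
    (forall j, j != i -> c j = a j) -> (forall j, j != i -> u j = b j) ->
    (\prod_(j < n | j != i) 'C(c j, u j) = \prod_(j < n | j != i) 'C(a j, b j))%N.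
  by move=> h1 h2; apply: eq_bigr => j ji; rewrite h1 // h2.
rewrite (eqR (U_(i) + a)%MM b) //; last first.
  by move=> j ji; rewrite mnmDE mnm1E eq_sym (negPf ji).
set Q := (\prod_(j < n | _) _)%N.
case: (posnP (b i)) => [bi0|].
  rewrite bi0 !bin0 addr0; congr (_ *: 'X_[_]).
  apply/mnmP => j; rewrite !(mnmDE, mnmBE, mnm1E).
  by case: eqP => [<-|_] /=; rewrite ?bi0 ?subn0.
case Ebi: (b i) => [//|c] _; rewrite add1n binS mulnDl natrD scalerDl.
rewrite mnmBE mnm1E eqxx Ebi subn1 /=.
rewrite (eqR a (b - U_(i))%MM) //; last first.
  by move=> j ji; rewrite mnmBE mnm1E eq_sym (negPf ji) subn0.
congr (_ + _ *: 'X_[_]); last first.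
  apply/mnmP => j; rewrite !(mnmDE, mnmBE, mnm1E).
  by case: eqP => [<-|_] /=; rewrite ?Ebi ?subn0 // add1n subn1 subSS.
have [ltac|geac] := ltnP (a i) c.+1; first by rewrite bin_small // mul0n !scale0r.
congr (_ *: 'X_[_]); apply/mnmP => j; rewrite !(mnmDE, mnmBE, mnm1E).
by case: eqP => [<-|_] //=; rewrite Ebi addnBA.
Qed.

Lemma order_lt_comm i (f : {linear P -> P}) :
  (forall k : 'I_n, order_lt i (comm_poly f 'X_k)) -> order_lt i.+1 f.
Proof.
move=> Hf.
have HM r s : order_lt i (comm_poly f r) -> order_lt i (comm_poly f s) ->
    order_lt i (comm_poly f (r * s)).
  move=> Hr Hs; apply: eq_order_lt (order_ltD (order_ltMr s Hr) (order_ltMl r Hs)).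
  by move=> q; rewrite /comm_poly mulrBr !mulrA subrKA.
have HC c : order_lt i (comm_poly f c%:MP).
  apply: eq_order_lt (order_lt0 _) => q.
  by rewrite /comm_poly !mul_mpolyC linearZ subrr.
have H1 : order_lt i (comm_poly f 1) by rewrite -mpolyC1.
move=> r; elim/mpolyind: r => [|c a r _ _ IH].
  by rewrite -mpolyC0; apply: HC.
have H2 : order_lt i (comm_poly f (c *: 'X_[a])).
  rewrite -mul_mpolyC; apply: (HM) => //; rewrite mpolyXE_id.
  elim: (index_enum _) => [|k s IHs]; first by rewrite big_nil.
  rewrite big_cons; apply: (HM) => //.
  by elim: (a k) => // d IHd; rewrite exprS; apply: (HM).
apply: eq_order_lt (order_ltD H2 IH) => q.
by rewrite /comm_poly !mulrDl linearD opprD addrACA.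
Qed.

Lemma divderiv_order b : order_lt (mdeg b).+1 (divderiv_fun b).
Proof.
have [k] := ubnP (mdeg b); elim: k b => // k IH b; rewrite ltnS => lebk.
apply: order_lt_comm => i.
have HE : comm_poly (divderiv_fun b) 'X_i =1
    if b i == 0%N then (fun=> 0) else divderiv_fun (b - U_(i)).
  move=> q; rewrite /comm_poly divderivMX addrAC subrr add0r.
  by case: ifP.
apply: (@eq_order_lt _ _ _ (fsym HE)); case: eqP => [_|/eqP bi]; first exact: order_lt0.
have degE : mdeg b = (mdeg (b - U_(i))).+1.
  rewrite -{1}(@submK _ U_(i) b) ?mdegD ?mdeg1 ?addn1 //.
  by apply/mnm_lepP => j; rewrite mnm1E; case: eqP => // <-; rewrite lt0n.
by rewrite degE; apply: IH; rewrite -degE.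
Qed.

Fact divderiv_subproof b : is_diffop (divderiv_fun b).
Proof.
apply/asboolP; split; first exact: divderiv_is_linear.
by exists (mdeg b).+1; apply: divderiv_order.
Qed.
Definition divderiv b : diffop := DiffOp (divderiv_subproof b).

Lemma divderiv_comm b (i : 'I_n) : mulop 'X_i * divderiv b =
  divderiv b * mulop 'X_i - (if b i == 0%N then 0 else divderiv (b - U_(i))).
Proof.
apply: (canRL (addrK _)); apply: diffopP => q.
by rewrite [RHS]/= divderivMX; case: ifP.
Qed.

Lemma bin_chain a b c :
  ('C(a, c) * 'C(a - c, b) = 'C(b + c, b) * 'C(a, b + c))%N.
Proof.
have [lt|le] := ltnP a (b + c).
  rewrite [X in _ = (_ * X)%N]bin_small // muln0.
  have [lt'|le'] := ltnP a c; first by rewrite bin_small.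
  by rewrite [X in (_ * X)%N]bin_small ?muln0 // ltn_subLR // addnC.
have lec : (c <= a)%N by rewrite (leq_trans _ le) ?leq_addl.
have leb : (b <= a - c)%N by rewrite leq_subRL // addnC.
have F : (0 < b`! * c`! * (a - c - b)`!)%N by rewrite !muln_gt0 !fact_gt0.
apply/eqP; rewrite -(eqn_pmul2r F); apply/eqP.
have h1 := bin_fact lec; have h2 := bin_fact leb.
have h3 := bin_fact (leq_addr c b); have h4 := bin_fact le.
rewrite addKn in h3; rewrite [X in (a - X)%N]addnC subnDA in h4.
transitivity (a`!); last first.
  by rewrite -h4 -h3; ring.
by rewrite -h1 -h2; ring.
Qed.

Lemma divderivM b c :
  divderiv b * divderiv c = (mbin (b + c) b)%:R *: divderiv (b + c).
Proof.
apply: diffopP => q.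
pose f : {linear P -> P} := (divderiv b * divderiv c : diffop).
pose g : {linear P -> P} := ((mbin (b + c) b)%:R *: divderiv (b + c) : diffop).
apply: (@linear_ext f g) => a.
have -> : f 'X_[a] = divderiv_fun b (divderiv_fun c 'X_[a]) by [].
have -> : g 'X_[a] = (mbin (b + c) b)%:R *: divderiv_fun (b + c) 'X_[a] by [].
rewrite !divderivX linearZ /= divderivX !scalerA -!natrM.
have -> : (a - c - b)%MM = (a - (b + c))%MM.
  by apply/mnmP => i; rewrite !(mnmBE, mnmDE) -subnDA addnC.
congr (_%:R *: _); rewrite /mbin -!big_split /=; apply: eq_bigr => i _.
by rewrite mnmBE mnmDE bin_chain.
Qed.

Lemma divderiv0 : divderiv 0 = 1.
Proof.
apply: diffopP => q.
pose f : {linear P -> P} := divderiv 0.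
pose g : {linear P -> P} := (1 : diffop).
apply: (@linear_ext f g) => a; rewrite /f /g /= divderivX mul1r.
rewrite /mbin big1 => [|i _]; last by rewrite mnm0E bin0.
by rewrite scale1r; congr ('X_[_]); apply/mnmP => i; rewrite mnmBE mnm0E subn0.
Qed.

Definition canonical_filtration (i : nat) : set diffop :=
  span (fun f : diffop => exists a b : 'X_{1..n},
    (mdeg a + mdeg b <= i)%N /\ f = mulop 'X_[a] * divderiv b).

End DiffOps.

Arguments divderiv {K n} b.
Arguments canonical_filtration {K n} i.

Lemma bin_pchar (K : fieldType) p (hp : p \in [pchar K]) k i j :
  (i < p ^ k)%N -> (j < p ^ k)%N -> (p ^ k <= i + j)%N ->
  ('C(i + j, i))%:R = 0 :> K.
Proof.
move=> ltik ltjk leij.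
have hpX : p \in [pchar {poly K}] by apply: (rmorph_pchar (@polyC K)).
have E : (1 + 'X : {poly K}) ^+ (i + j) =
    \sum_(l < (i + j).+1) ('C(i + j, l))%:R *: 'X^l.
  rewrite exprDn; apply: eq_bigr => l _.
  by rewrite expr1n mul1r scaler_nat.
have := congr1 (fun q : {poly K} => q`_i) E.
rewrite coef_sum (bigD1 (Ordinal (leq_addr j i : i < (i + j).+1)%N)) //=.
rewrite big1 => [|l neq]; last first.
  rewrite coefZ coefXn; case: eqP => [El|_]; last by rewrite mulr0.
  by case/eqP: neq; apply/val_inj.
rewrite addr0 coefZ coefXn eqxx mulr1 => <-.
rewrite -(subnKC leij) exprD exprDn_pchar ?expr1n; last first.
  by rewrite pnatX (pnatE _ (pcharf_prime hp)) hpX.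
rewrite mulrDl mul1r coefD mulrC coefMXn ltik addr0.
rewrite nth_default // (leq_trans (size_poly_exp_leq _ _)) //.
rewrite addrC -(polyC1 K) size_XaddC mul1n ltn_subLR //.
by rewrite addnC ltn_add2r.
Qed.

Section Subalgebra.
Variables (K : fieldType) (p : nat) (hp : p \in [pchar K]) (n : nat).
Variable k : 'I_n -> nat.
Local Notation P := {mpoly K[n]}.
Local Notation D := (diffop K n).
Implicit Types (a b : 'X_{1..n}).

Definition A_gens : set D := fun f => exists a b : 'X_{1..n},
  (forall i, (b i < p ^ k i)%N) /\ f = divderiv b * mulop 'X_[a].

(* [(x)_i (+)_(j < p^(k i)) d_i^[j] K[x_i]], each tensor
   [(x)_i d_i^[b i] x_i^(a i)] being the operator [d^[b] x^a]. *)
Definition A_span : set D := span A_gens.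

Definition A_pred of p \in [pchar K] : {pred D} := fun f => `[< A_span f >].

Let A_gen a b : (forall i, (b i < p ^ k i)%N) ->
  A_span (divderiv b * mulop 'X_[a]).
Proof. by move=> ltb; apply: span_incl; exists a, b. Qed.

Let A0 : A_span 0.
Proof. by case: (span_closed A_gens) => /asboolP. Qed.

Let AP c f g : A_span f -> A_span g -> A_span (c *: f + g).
Proof.
move=> Af Ag; case: (span_closed A_gens) => _ H; apply/asboolP.
by apply: H; apply/asboolP.
Qed.

Let AZ c f : A_span f -> A_span (c *: f).
Proof. by move=> Af; rewrite -[_ *: f]addr0; apply: AP => //; apply: A0. Qed.

Let AB f g : A_span f -> A_span g -> A_span (f - g).
Proof. by move=> Af Ag; rewrite -scaleN1r addrC; apply: AP. Qed.

Let A_mulX i f : A_span f -> A_span (mulop 'X_i * f).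
Proof.
pose T g := A_span (mulop 'X_i * g).
apply: (@span_ind _ _ _ T) => [|g [a [b [ltb ->]]]].
  split; first by apply/asboolP; rewrite /T mulr0; apply: A0.
  move=> c u v /asboolP Tu /asboolP Tv; apply/asboolP.
  by rewrite /T mulrDr -scalerAr; apply: AP.
rewrite /T mulrA divderiv_comm mulrBl -mulrA -mulopM -mpolyXD.
apply: AB; first exact: A_gen.
case: eqP => _; first by rewrite mul0r; apply: A0.
by apply: A_gen => j; rewrite mnmBE; apply: leq_ltn_trans (ltb j); apply: leq_subr.
Qed.

Let A_muldiv b f : (forall i, (b i < p ^ k i)%N) -> A_span f ->
  A_span (divderiv b * f).
Proof.
move=> ltb; pose T g := A_span (divderiv b * g).
apply: (@span_ind _ _ _ T) => [|g [a [c [ltc ->]]]].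
  split; first by apply/asboolP; rewrite /T mulr0; apply: A0.
  move=> d u v /asboolP Tu /asboolP Tv; apply/asboolP.
  by rewrite /T mulrDr -scalerAr; apply: AP.
rewrite /T mulrA divderivM -scalerAl.
have [/forallP lt|] := boolP [forall i, (b i + c i < p ^ k i)%N].
  by apply: AZ; apply: A_gen => i; rewrite mnmDE.
rewrite negb_forall => /existsP[i]; rewrite -leqNgt => lei.
rewrite /mbin (bigD1 i) //= natrM mnmDE (@bin_pchar K p hp (k i)) //.
by rewrite mul0r scale0r; apply: A0.
Qed.

Let A_mulpoly r f : A_span f -> A_span (mulop r * f).
Proof.
move=> Af; rewrite [r]mpolyE.
have mulop_sum (s : seq 'X_{1..n}) : A_span
    (mulop (\sum_(a <- s) r@_a *: 'X_[a]) * f).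
  elim: s => [|a s IH].
    rewrite big_nil; have -> : mulop 0 * f = 0.
      by apply: diffopP => q; rewrite /= mul0r.
    exact: A0.
  rewrite big_cons; set t := \sum_(_ <- s) _ in IH *.
  have -> : mulop (r@_a *: 'X_[a] + t) * f =
      r@_a *: (mulop 'X_[a] * f) + mulop t * f.
    by apply: diffopP => q; rewrite /= mulrDl -scalerAl.
  apply: AP => //; rewrite mpolyXE_id.
  elim: (index_enum _) => [|i l IHl].
    by rewrite big_nil; have -> : mulop 1 * f = f by rewrite [LHS]mul1r.
  rewrite big_cons mulopM -mulrA; move: IHl; set g := mulop _ * f => Ag.
  elim: (a i) => [|d IHd]; first by rewrite expr0 [mulop 1 * g]mul1r.
  by rewrite exprS mulopM -mulrA; apply: A_mulX.
exact: mulop_sum.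
Qed.

Lemma A_spanM f g : A_span f -> A_span g -> A_span (f * g).
Proof.
move=> Af Ag; move: f Af; pose T f := A_span (f * g).
apply: (@span_ind _ _ _ T) => [|h [a [b [ltb ->]]]].
  split; first by apply/asboolP; rewrite /T mul0r; apply: A0.
  move=> d u v /asboolP Tu /asboolP Tv; apply/asboolP.
  by rewrite /T mulrDl -scalerAl; apply: AP.
by rewrite /T -mulrA; apply: A_muldiv => //; apply: A_mulpoly.
Qed.

Lemma A_span1 : A_span 1.
Proof.
rewrite -[1]mul1r -{1}divderiv0 -[X in _ * X]/(mulop 1) -mpolyX0.
by apply: A_gen => i; rewrite mnm0E expn_gt0 prime_gt0 ?(pcharf_prime hp).
Qed.

Lemma A_span_mulop r : A_span (mulop r).
Proof. by rewrite -[mulop r]mulr1; apply: A_mulpoly; apply: A_span1. Qed.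

Fact A_subalg : GRing.subalg_closed (A_pred hp).
Proof.
split; first by apply/asboolP; apply: A_span1.
  by move=> c f g /asboolP Af /asboolP Ag; apply/asboolP; apply: AP.
by move=> f g /asboolP Af /asboolP Ag; apply/asboolP; apply: A_spanM.
Qed.

Record subA : predArgType := SubA { subA_val :> D; _ : A_pred hp subA_val }.

HB.instance Definition _ := [isSub for subA_val].
HB.instance Definition _ := [Choice of subA by <:].
HB.instance Definition _ :=
  GRing.SubChoice_isSubAlgebra.Build K D (A_pred hp) subA A_subalg.

Definition A_incl : {rmorphism subA -> D} := \val.

Fact A_poly_subproof r : A_pred hp (mulop r).
Proof. by apply/asboolP; apply: A_span_mulop. Qed.
Definition A_poly (r : P) : subA := SubA (A_poly_subproof r).

End Subalgebra.

Section Endomorphisms.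
Variables (K : fieldType) (A : algType K) (M : lmodType A).

Definition resK : lmodType K := restrict (GRing.in_alg A) M.

Definition is_endo (f : M -> resK) : bool := `[< linear (f : M -> M) >].

Record endo : predArgType := Endo { endo_fun :> M -> resK; _ : is_endo endo_fun }.

HB.instance Definition _ := [isSub for endo_fun].
HB.instance Definition _ := [Choice of endo by <:].

Fact is_endo_submod : GRing.submod_closed (is_endo : {pred M -> resK}).
Proof.
split.
  apply/asboolP => a u v.
  by have -> : (0 : M -> resK) = (fun=> 0 : M) by []; rewrite scaler0 addr0.
move=> c f g /asboolP linf /asboolP ling; apply/asboolP => a u v.
have E w : (c *: f + g) w = c%:A *: (f w : M) + (g w : M) :> M by [].
rewrite !E linf ling !scalerDr !scalerA mulr_algl -[c *: a]mulr_algr -!addrA.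
by congr (_ + _); rewrite addrCA.
Qed.

HB.instance Definition _ :=
  GRing.SubChoice_isSubLmodule.Build K (M -> resK) is_endo endo is_endo_submod.

Lemma endoP (f g : endo) : (forall v, f v = g v) -> f = g.
Proof. by move=> fg; apply/val_inj/funext. Qed.

Lemma endo_linear (f : endo) : linear (f : M -> M).
Proof. by case: f => f Hf; exact: asboolW Hf. Qed.

Fact endo_one_subproof : is_endo id.
Proof. by apply/asboolP. Qed.
Definition endo_one : endo := Endo endo_one_subproof.

Fact endo_mul_subproof (f g : endo) : is_endo (fun v => f (g v)).
Proof. by apply/asboolP => a u v; rewrite /= !endo_linear. Qed.
Definition endo_mul (f g : endo) : endo := Endo (endo_mul_subproof f g).

Fact endo_mulA : associative endo_mul.
Proof. by move=> f g h; apply: endoP. Qed.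
Fact endo_mul1 : left_id endo_one endo_mul.
Proof. by move=> f; apply: endoP. Qed.
Fact endo_mulr1 : right_id endo_one endo_mul.
Proof. by move=> f; apply: endoP. Qed.
Fact endo_mulDl : left_distributive endo_mul +%R.
Proof. by move=> f g h; apply: endoP. Qed.
Fact endo_mulDr : right_distributive endo_mul +%R.
Proof.
move=> f g h; apply: endoP => v.
by have := endo_linear f 1 (g v) (h v); rewrite !scale1r.
Qed.

(* The product of [endo] is composition. *)
HB.instance Definition _ := GRing.Zmodule_isPzRing.Build endo
  endo_mulA endo_mul1 endo_mulr1 endo_mulDl endo_mulDr.

End Endomorphisms.

Section Holonomic.
Variables (K : fieldType) (n : nat).
Local Notation P := {mpoly K[n]}.
Local Notation D := (diffop K n).
Variable M : lmodType D.

Definition filtration (M0 : set M) (i : nat) : set (resK M) :=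
  span (fun w : resK M => exists (f : D) (v : M),
    [/\ canonical_filtration i f, M0 v & w = f *: v]).

Definition generating_subspace (M0 : set M) : Prop :=
  (exists d, has_dim (M0 : set (resK M)) d) /\ (forall v, span M0 v).

(* [M] is nonzero, finitely generated, and the function [dim_K (F_i M_0)] of
   every finite dimensional generating subspace [M_0] satisfies [Q]. *)
Definition dim_functions_satisfy (Q : (nat -> nat) -> Prop) : Prop :=
  [/\ exists v : M, v != 0,
      exists M0, generating_subspace M0
    & forall M0, generating_subspace M0 ->
        exists d : nat -> nat,
          (forall i, has_dim (filtration M0 i) (d i)) /\ Q d].

Definition holonomic : Prop :=
  dim_functions_satisfy (fun d => exists q : {poly rat}, size q = n.+1 /\
    exists N : nat, forall i, (N <= i)%N -> (d i)%:R <= q.[i%:R]).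

Definition has_multiplicity (e : rat) : Prop :=
  dim_functions_satisfy (fun d => forall eps : rat, 0 < eps ->
    exists N : nat, forall i, (N <= i)%N ->
      `|(d i)%:R - e / n`!%:R * i%:R ^+ n| <= eps * i%:R ^+ n).

Definition assoc_prime (q : {pred P}) : Prop :=
  [/\ idealr_closed q, prime_idealr_closed q
    & exists v : M, forall r, (r \in q) = (mulop r *: v == 0)].

End Holonomic.

(* An almost polynomial of period [m], whose polynomials have degree [e] and
   leading coefficient [c]. *)
Definition almost_polynomial (m e : nat) (c : rat) (f : nat -> nat) : Prop :=
  (0 < m)%N /\
  exists q : nat -> {poly rat},
    (forall s, (s < m)%N -> size (q s) = e.+1 /\ lead_coef (q s) = c) /\
    exists N : nat, forall i, (N <= i)%N -> (f i)%:R = (q (i %% m)%N).[i%:R].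

(* [sum_i d_i w^i = num / den] as formal power series, i.e.
   [den * sum_i d_i w^i = num] (with [den] of constant term 1). *)
Definition series_eq_frac (d : nat -> nat) (num den : {poly int}) : Prop :=
  den`_0 = 1 /\
  forall N : nat, \sum_(j < N.+1) den`_j * (d (N - j)%N)%:Z = num`_N.

Section MaxSpec.
Variables (K : fieldType) (n : nat).
Local Notation P := {mpoly K[n]}.

Definition maximal_ideal (S : {pred P}) : Prop :=
  idealr_closed S /\
  (forall J : {pred P}, idealr_closed J -> {subset S <= J} -> {subset J <= S}).

Record maxSpec := MaxSpec { max_pred : P -> bool; _ : maximal_ideal max_pred }.

Lemma maxSpecP (m : maxSpec) : maximal_ideal (max_pred m).
Proof. by case: m. Qed.

HB.instance Definition _ (m : maxSpec) :=
  isIdealr.Build P (max_pred m) (maxSpecP m).1.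

Variable m : maxSpec.

Definition in_max (r : P) : bool := max_pred m r.

Definition residue : comNzRingType := Quotient.quot (max_pred m : idealr P).

Definition residue_const (c : K) : residue :=
  \pi_(Quotient.quot (max_pred m : idealr P))%qT c%:MP.

Fact residue_const_additive : zmod_morphism residue_const.
Proof. by move=> a b; rewrite /residue_const mpolyCB [LHS]rmorphB. Qed.
Fact residue_const_multiplicative : monoid_morphism residue_const.
Proof.
split; first by rewrite /residue_const mpolyC1 [LHS]rmorph1.
by move=> a b; rewrite /residue_const mpolyCM [LHS]rmorphM.
Qed.

HB.instance Definition _ :=
  GRing.isZmodMorphism.Build K residue residue_const residue_const_additive.
HB.instance Definition _ :=
  GRing.isMonoidMorphism.Build K residue residue_const residue_const_multiplicative.

Definition residueK : lmodType K := restrict residue_const residue^o.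

(* [(P_n/m)^sep]: the elements that are separable over [K]. *)
Definition residue_sep : set residue := fun y => exists q : {poly K},
  [/\ irreducible_poly q, separable_poly q & root (map_poly residue_const q) y].

End MaxSpec.

Arguments max_pred {K n} m r.
Arguments residue_sep {K n} m y.

Section ModuleU.
Variables (K : fieldType) (p : nat) (hp : p \in [pchar K]) (n : nat).
Variable m : maxSpec K n.
Local Notation P := {mpoly K[n]}.
Local Notation D := (diffop K n).

Definition poly_in (i : 'I_n) (q : {poly K}) : P := horner_alg 'X_i q.

(* [g_i]: the monic irreducible generator of [K[x_i] /\ m]. *)
Definition gen_poly (i : 'I_n) : {poly K} :=
  xget 0 (fun g : {poly K} =>
    [/\ g \is monic, irreducible_poly g
      & forall q, (g %| q) = in_max m (poly_in i q)]).

(* [(f_i, k_i)] with [g_i = f_i(x_i^(p^k_i))]. *)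
Definition sep_part (i : 'I_n) : {poly K} * nat :=
  xget (0, 0%N) (fun fk : {poly K} * nat =>
    [/\ fk.1 \is monic, irreducible_poly fk.1, separable_poly fk.1
      & gen_poly i = fk.1 \Po 'X^(p ^ fk.2)]).

Definition insep_exp (i : 'I_n) : nat := (sep_part i).2.

(* [(x)_i L_i' = (x)_i K[x_i^(p^k_i)]/(g_i)] is the quotient of the ring
   [P_n], whose [i]-th variable stands for [x_i^(p^k_i)], by the ideal
   [(f_1(x_1), ..., f_n(x_n))]. *)
Definition sep_ideal (r : P) : Prop :=
  exists c : 'I_n -> P, r = \sum_i c i * poly_in i (sep_part i).1.

(* [e] is the unit element of one of the fields [Gamma_nu]. *)
Definition field_idempotent (e : P) : Prop :=
  [/\ sep_ideal (e * e - e), ~ sep_ideal e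
    & forall r, ~ sep_ideal (r * e) -> exists s, sep_ideal (s * (r * e) - e)].

(* The canonical map from the ring above to [(x)_i L_i]. *)
Definition frob_subst (r : P) : P :=
  r \mPo [tuple 'X_i ^+ (p ^ insep_exp i) | i < n].

(* [Gamma(m)] is the factor with unit [e]. *)
Definition is_Gamma_unit (e : P) : Prop :=
  field_idempotent e /\ ~~ in_max m (frob_subst e).

Definition algA : algType K := subA hp insep_exp.

(* [V] is annihilated by the central elements [g_i], i.e. it is a module over
   [bar A(m) = (x)_i A(m)_i / A(m)_i g_i]; it is simple; and the factor
   [bar A(m) e = M_(p^k)(Gamma(m))] of [bar A(m)] acts nontrivially on it. *)
Definition is_V (V : lmodType algA) : Prop :=
  [/\ simple_mod V,
      forall (i : 'I_n) (v : V), (A_poly hp insep_exp (poly_in i (gen_poly i)) : algA) *: v = 0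
    & exists e, is_Gamma_unit e /\
        exists (a : algA) (v : V), (a * (A_poly hp insep_exp (frob_subst e) : algA)) *: v != 0].

Definition modV : lmodType algA :=
  match pselect (exists V : lmodType algA, is_V V) with
  | left exV => projT1 (cid exV)
  | right _ => algA^o
  end.

Definition modU : lmodType D := tensor (A_incl hp insep_exp) modV.

Definition one_tensorV : modV -> modU := @one_tensor _ _ (A_incl hp insep_exp) modV.

Definition filtU (i : nat) : set (resK modU) :=
  filtration (range one_tensorV) i.

(* [(d_1)^[a_1 p^k_1] ... (d_n)^[a_n p^k_n]], the basis of [Lambda(m)] *)
Definition Lambda_basis (a : 'X_{1..n}) : D :=
  divderiv [multinom (a i * p ^ insep_exp i)%N | i < n].

(* [W] is the direct sum of the [Lambda_basis a (x) V(m)] with [Q a]. *)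
Definition is_Lambda_sum (Q : pred 'X_{1..n}) (W : set modU) : Prop :=
  let total (s : seq 'X_{1..n}) (v : 'X_{1..n} -> modV) : modU :=
    \sum_(a <- s) Lambda_basis a *: one_tensorV (v a) in
  (forall u, W u <-> exists s v, all Q s /\ u = total s v) /\
  (forall s v, uniq s -> all Q s -> total s v = 0 -> forall a, a \in s -> v a = 0).

End ModuleU.

Arguments is_V {K p} hp {n} m V.
Arguments is_Lambda_sum {K p} hp {n} m Q W.
Arguments filtU {K p} hp {n} m i.
Arguments insep_exp {K} p {n} m i.

(* Main.v *)
From HB Require Import structures.
Require Import Defs.
From mathcomp Require Import all_boot all_order all_algebra all_field.
From mathcomp Require Import ring_quotient ring zify.
From mathcomp Require Import boolp classical_sets functions.
From mathcomp Require monalg finmap.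
From mathcomp Require Import mpoly.

Set Implicit Arguments.
Unset Strict Implicit.
Unset Printing Implicit Defensive.

Import Order.TTheory GRing.Theory Num.Theory.
Local Open Scope ring_scope.

(* Put [y_i = x_i^(p^(k_i))]. The algebra [A(m)] is the commutant of the [y_i]
   in [D(P_n)]. Let [psi] substitute the [y_i] for the variables and let [n0] be
   the maximal ideal of the [q] with [psi q] in [m]; then
   [V(m) = P_n / psi(n0) P_n], which is simple over [A(m)] because some
   [d^[b]], [b_i < p^(k_i)], carries a given nonzero vector to a nonzero one that
   is killed by all of these with [b != 0].

   As [f_i] is separable, [y_i] acts on [V(m)] as a polynomial [h_i] in
   [y_i^(p^e)], for every [e]. The element [y_i - h_i(y_i^(p^e))] kills [V(m)]
   and, since [y_i^(p^e)] commutes with the [Lambda_a], [a_i < p^e], it maps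
   [Lambda_a (x) v] to [Lambda_(a - e_i) (x) v]. These lowering operators show
   that [U(m)] is the direct sum of the [Lambda_a (x) V(m)], that it is simple,
   that its endomorphisms come from those of [V(m)], hence from
   [(P_n/m)^sep], and that [m] is its only associated prime. The dimensions
   count the [a] with [sum_i a_i p^(k_i) <= i], a quasi-polynomial in [i].

   Conversely let [M = D v] be simple and finitely presented. The finitely many
   relations of [v] lie in the commutant of the [x_i^(p^e)] for some [e]. As
   [D(P_n)] projects onto this commutant, the orbit of [v] under it is a simple
   module, so it contains a vector [w] killed by the [d^[b]] with [b_i < p^e],
   [b != 0], and [m = { r | r^(p^e) w = 0 }] is maximal. Every element of [m] is
   locally nilpotent on [M], which yields a nonzero map [U(m) -> M]. *)

(** * Commutators, Frobenius and separability *)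

(** Two facts carry the argument. The commutator with [x^(p^e)] is the [p^e]-th iterate of the
    commutator with [x], so every operator commutes with all high Frobenius powers of the variables:
    [D(P_n)] is a union of commutants of the same shape as [A(m)]. And the algebra
    [P_n/(f_1, ..., f_n)] is étale: modulo the [f_i] every element is a combination of [p]-th
    powers, so Frobenius maps bases to bases. Reducedness, the idempotent [e] of [Gamma(m)] and the
    separability of [psi(P_n)] modulo [m] all come from this, without splitting the algebra into
    fields. The ideal [n0] is then generated by the [f_i] and [1 - e], which makes [U(m)] finitely
    presented.

    That the [g_i] exist at all is Zariski's lemma for [P_n/m]. That [V(m)] embeds in [U(m)] comes
    from a right linear retraction of [D(P_n)] onto [A(m)], given by a Taylor formula in the
    [y_i]. *)

Section Commutator.
Variable R : nzRingType.
Implicit Types x f g : R.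

(** The sign is that of [comm_poly]: as a function, [ad (mulop r) f] unfolds to [comm_poly f r],
    which turns [order_lt] into a statement on iterated [ad]. *)
Definition ad x f : R := f * x - x * f.

Lemma ad_is_additive x : zmod_morphism (ad x).
Proof. by move=> f g; rewrite /ad mulrBl mulrBr !opprD !opprK addrACA. Qed.
HB.instance Definition _ x := GRing.isZmodMorphism.Build R R (ad x) (ad_is_additive x).

Lemma ad0P x f : ad x f = 0 <-> f * x = x * f.
Proof. by rewrite /ad; split=> [/subr0_eq|->]; rewrite ?subrr. Qed.

Lemma adM x f g : ad x (f * g) = ad x f * g + f * ad x g.
Proof. by rewrite /ad mulrBl mulrBr !mulrA [RHS]addrC addrA subrK. Qed.

Lemma iter_adMr x f g c : g * x = x * g -> iter c (ad x) (f * g) = iter c (ad x) f * g.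
Proof.
move/ad0P => gx; elim: c => //= c ->.
by rewrite adM gx mulr0 addr0.
Qed.

Lemma iter_adMl x f g c : f * x = x * f -> iter c (ad x) (f * g) = f * iter c (ad x) g.
Proof.
move/ad0P => gx; elim: c => //= c ->.
by rewrite adM gx mul0r add0r.
Qed.

Lemma iter_ad0 x f c d : (c <= d)%N -> iter c (ad x) f = 0 -> iter d (ad x) f = 0.
Proof.
move=> /subnK <- H; rewrite iterD H; elim: (d - c)%N => //= e ->.
by rewrite raddf0.
Qed.

Lemma iter_adD x c f g : iter c (ad x) (f + g) = iter c (ad x) f + iter c (ad x) g.
Proof. by elim: c => //= c ->; rewrite raddfD. Qed.

(** Right multiplication by [x] is left multiplication by [x] plus [ad x], and these two commute:
    this is the binomial theorem for their sum. *)
Lemma mul_exp_ad x f c :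
  f * x ^+ c = \sum_(j < c.+1) (x ^+ (c - j) * iter j (ad x) f) *+ 'C(c, j).
Proof.
elim: c => [|c IH]; first by rewrite big_ord1 /= expr0 mul1r mulr1.
pose G j := iter j (ad x) f.
have GS j : G j * x = x * G j + G j.+1 by rewrite /G /= /ad addrC subrK.
rewrite exprSr mulrA IH mulr_suml.
under eq_bigr => j _ do rewrite mulrnAl -mulrA -/(G j) GS mulrDr mulrA -exprSr mulrnDl.
rewrite big_split /= [RHS]big_ord_recl.
have -> : \sum_(i < c.+1) (x ^+ (c.+1 - lift ord0 i) * iter (lift ord0 i) (ad x) f)
      *+ 'C(c.+1, lift ord0 i) =
    \sum_(i < c.+1) (x ^+ (c - i) * G i.+1) *+ 'C(c, i)
    + \sum_(i < c.+1) (x ^+ (c - i) * G i.+1) *+ 'C(c, i.+1).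
  by rewrite -big_split; apply: eq_bigr => i _; rewrite /= /bump !leq0n !add1n subSS binS mulrnDr addrC.
rewrite [in RHS]addrCA addrC; congr (_ + _).
rewrite [in LHS]big_ord_recl [in RHS]big_ord_recr /= (bin_small (ltnSn c)) mulr0n addr0 !subn0 !bin0.
by congr (_ + _); apply: eq_bigr => i _; rewrite /= /bump !leq0n !add1n subnSK.
Qed.

(** For the exponent [p] only the first and the last binomial terms survive; the rest is
    iteration. *)
Lemma ad_pchar_pow p (pR : p \in [pchar R]) x e f :
  ad (x ^+ (p ^ e)) f = iter (p ^ e) (ad x) f.
Proof.
have ad_p y g : ad (y ^+ p) g = iter p (ad y) g.
  rewrite {1}/ad mul_exp_ad.
  have p0 := prime_gt0 (pcharf_prime pR).
  case E: p p0 => [//|q] _.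
  rewrite big_ord_recl big_ord_recr /= /bump /= !add1n bin0 binn subn0 subnn mul1r !mulr1n.
  rewrite big1 ?add0r; first by rewrite addrAC subrr add0r.
  move=> i _; rewrite /= /bump /= add1n -E -mulr_natr (bin_lt_pcharf_0 pR) ?mulr0 //.
  by rewrite E; exact: (ltn_ord i).
elim: e f => [|e IH] f; first by rewrite expr1.

have iterM d : iter (d * p ^ e) (ad x) f = iter d (ad (x ^+ (p ^ e))) f.
  by elim: d => // d IHd; rewrite mulSn iterD iterS -IHd -IH.
by rewrite expnSr exprM ad_p mulnC iterM.
Qed.
End Commutator.

(** The monic element of least degree generates. [T] is a bare predicate because the lemma serves
    twice: for the trace of [m] on [K[x_i]], and for the minimal polynomial of an element modulo
    [n0]. *)
Lemma prime_poly_gen (K : fieldType) (T : pred {poly K}) :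
  (forall q r, T q -> T r -> T (q - r)) -> (forall c q, T q -> T (c * q)) ->
  (forall q r, T (q * r) -> T q \/ T r) -> ~~ T 1 -> (exists2 q, q != 0 & T q) ->
  exists g, [/\ g \is monic, irreducible_poly g & forall q, (g %| q) = T q].
Proof.
move=> TB TM Tprime T1 [q1 q10 Tq1].
pose Q d := `[< exists q : {poly K}, [/\ q != 0, T q & size q = d] >].
have Q0 : exists d, Q d by exists (size q1); apply/asboolP; exists q1.
case: (ex_minnP Q0) => d /asboolP[g0 [g00 Tg0 sg0]] dmin.
pose g := (lead_coef g0)^-1 *: g0.
have l0 : (lead_coef g0)^-1 != 0 by rewrite invr_eq0 lead_coef_eq0.
have Tg : T g by rewrite /g -mul_polyC; apply: TM.
have sg : size g = d by rewrite size_scale.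
have g_0 : g != 0 by rewrite scaler_eq0 negb_or l0.
have gdvd (q : {poly K}) : (g %| q) = T q.
  apply/idP/idP => [/dvdpP[c ->]|Tq]; first exact: TM.
  rewrite /dvdp; apply/negPn/negP => nz.
  have : Q (size (q %% g)).
    apply/asboolP; exists (q %% g); split=> //.
    have -> : q %% g = q - (q %/ g) * g by rewrite {2}(divp_eq q g) addrC addKr.
    by apply: TB => //; apply: TM.
  by move=> /dmin; rewrite leqNgt -sg ltn_modpN0.
exists g; split=> //; first by rewrite monicE lead_coefZ mulVf ?lead_coef_eq0.
split=> [|e se eg].
  rewrite ltnNge; apply/negP => /size1_polyC E.
  have c0 : g`_0 != 0 by apply: contraNneq g_0 => E0; rewrite E E0.
  have : g %| 1 by rewrite dvdp1 E size_polyC c0.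
  by rewrite gdvd (negPf T1).
case/dvdpP: (eg) => c Ec.
have : T (c * e) by rewrite -Ec.
case/Tprime; rewrite -gdvd => H; last by rewrite /eqp eg.
have c0 : c != 0 by apply: contraNneq g_0 => c0; rewrite Ec c0 mul0r.
have e0 : e != 0 by apply: contraNneq g_0 => e0; rewrite Ec e0 mulr0.
have := dvdp_leq c0 H; rewrite Ec size_mul // -ltnS prednK; last first.
  by rewrite addn_gt0 size_poly_gt0 c0.
have se2 : (1 < size e)%N by rewrite ltn_neqAle eq_sym se size_poly_gt0.
by rewrite -addn1 leq_add2l leqNgt se2.
Qed.

(** * Inseparable irreducible polynomials *)

Section Inseparable.
Variables (K : fieldType) (p : nat) (hp : p \in [pchar K]).
Let p0 : (0 < p)%N := prime_gt0 (pcharf_prime hp).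
Let p1 : (1 < p)%N := prime_gt1 (pcharf_prime hp).
Implicit Types (f g h q : {poly K}).

(** If [g] is not separable, irreducibility makes it divide its derivative, which is then zero by
    degree; so only exponents divisible by [p] occur in [g]. *)
Lemma irredp_separable_or_frob g : irreducible_poly g ->
  separable_poly g \/ exists h, g = h \Po 'X^p.
Proof.
move=> [g1 irrg]; have [sg|nsg] := boolP (separable_poly g); [by left | right].
have g0 : g != 0 by rewrite -size_poly_gt0 (ltn_trans _ g1).
have dg : g %| g^`().
  have /irrg : gcdp g g^`() %| g := dvdp_gcdl _ _.
  rewrite unlock /coprimep in nsg.
  by move=> /(_ nsg) /eqp_dvdl <-; exact: dvdp_gcdr.
have g'0 : g^`() = 0.
  apply/eqP; apply: contraLR dg => nz; apply: contraL (lt_size_deriv g0) => dg.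
  by rewrite -leqNgt dvdp_leq.
exists (\poly_(i < size g) g`_(i * p)); apply/polyP => i.
rewrite comp_polyE coef_sum.
under eq_bigr => j _ do rewrite -exprM coefZ coefXn coef_poly.
have [/dvdnP[j ->]|nd] := boolP (p %| i)%N.
  have [ltj|gej] := ltnP j (size (\poly_(i < size g) g`_(i * p))).
    rewrite (bigD1 (Ordinal ltj)) //= big1 => [|l neq].
      rewrite mulnC eqxx mulr1 addr0.
      by case: ltnP => // lej; rewrite nth_default // (leq_trans lej) // leq_pmull.
    rewrite [X in X == _]mulnC eqn_pmul2l //; case: eqP => [E|]; last by rewrite mulr0.
    by case/eqP: neq; apply/val_inj.
  rewrite big1 => [|l _].
    have := nth_default 0 gej; rewrite coef_poly; case: ltnP => // lej _.
    by rewrite nth_default // (leq_trans lej) // leq_pmulr.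
  rewrite [X in X == _]mulnC eqn_pmul2l //; case: eqP => [E|]; last by rewrite mulr0.
  by have := ltn_ord l; rewrite -E ltnNge gej.
rewrite big1 => [|l _]; last first.
  by case: eqP => [E|]; [rewrite E dvdn_mulr in nd | rewrite mulr0].
case: i nd => [|i]; first by rewrite dvdn0.
move=> nd; have /eqP := congr1 (fun q : {poly K} => q`_i) g'0.
rewrite coef_deriv coef0 -mulr_natr mulf_eq0 => /orP[/eqP //|].
by rewrite -(dvdn_pcharf hp) (negPf nd).
Qed.

Lemma size_comp_Xn m f : (0 < m)%N -> (size (f \Po 'X^m)).-1 = ((size f).-1 * m)%N.
Proof. by move=> m0; rewrite size_comp_poly size_polyXn. Qed.

Lemma irredp_comp_Xn m h : (0 < m)%N -> irreducible_poly (h \Po 'X^m) -> irreducible_poly h.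
Proof.
move=> m0 [s1 irr].
have h1 : (1 < size h)%N.
  have := size_comp_Xn h m0; case: (size h) => [|[|//]] /=; rewrite mul0n;
  by move: s1; case: (size _) => [|[|]].
split=> // d d1 dh.
have h0 : h != 0 by rewrite -size_poly_gt0 ltnW.
have d0 : d != 0 by apply: contraNneq h0 => d0; rewrite -dvd0p -d0.
have dd : d \Po 'X^m %| h \Po 'X^m.
  by case/dvdpP: dh => c ->; rewrite comp_polyM dvdp_mull.
have ds : (1 < size d)%N.
  by rewrite ltn_neqAle eq_sym d1 size_poly_gt0.
have d1' : size (d \Po 'X^m) != 1%N.
  apply/eqP => E; have := size_comp_Xn d m0; rewrite E /= => /esym/eqP.
  rewrite muln_eq0 (gtn_eqF m0) orbF; case: (size d) ds => [|[|]] //.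
have /eqp_size E := irr _ d1' dd.
rewrite -dvdp_size_eqp // -(prednK (ltnW h1)) -(prednK (ltnW ds)) eqSS.
by rewrite -(eqn_pmul2r m0) -!size_comp_Xn // E.
Qed.

Lemma monic_comp_Xn m h : (0 < m)%N -> ((h \Po 'X^m) \is monic) = (h \is monic).
Proof.
move=> m0; rewrite !monicE lead_coef_comp ?size_polyXn ?ltnS // lead_coefXn.
by rewrite expr1n mulr1.
Qed.

(** Frobenius substitutions are stripped off while the degree falls. This gives the default-valued
    choice in [sep_part] its meaning. *)
Lemma sep_part_exists g : g \is monic -> irreducible_poly g ->
  exists fk : {poly K} * nat, [/\ fk.1 \is monic, irreducible_poly fk.1,
    separable_poly fk.1 & g = fk.1 \Po 'X^(p ^ fk.2)].
Proof.
have [k] := ubnP (size g); elim: k g => // k IH g lt mg irrg.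
have [sg|[h E]] := irredp_separable_or_frob irrg.
  by exists (g, 0%N); split => //=; rewrite expn0 comp_polyXr.
have irrh : irreducible_poly h by apply: (@irredp_comp_Xn p) => //; rewrite -E.
have mh : h \is monic by rewrite -(@monic_comp_Xn p) // -E.
have szh : (size h < k)%N.
  have h1 := irrh.1; have := size_comp_Xn h p0; rewrite -E => S.
  rewrite -ltnS (leq_trans _ lt) // ltnS -(prednK (ltnW irrg.1)) S -(prednK (ltnW h1)) ltnS /=.
  by rewrite ltn_Pmulr //; move: h1; case: (size h) => [|[|]].
have [[f e] [/= mf irrf sf Eh]] := IH h szh mh irrh.
exists (f, e.+1); split => //=.
by rewrite E Eh -comp_polyA comp_Xn_poly -exprM expnS.
Qed.

(** A separable [z] lies in [K(z^(p^M))], hence [z = h(z^(p^M))]. A root [z] of [f] is then also a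
    root of [X - h(X^(p^M))], and [f] is irreducible. *)
Lemma separable_frob_inv f M : irreducible_poly f -> separable_poly f ->
  exists h, f %| 'X - (h \Po 'X^(p ^ M)).
Proof.
move=> irrf sf; have [L _ [z rz zL]] := irredp_FAdjoin irrf.
have hpL : p \in [pchar L] by rewrite (fmorph_pchar (in_alg L)).
have sz : separable_element 1 z.
  apply/separable_elementP; exists (map_poly (in_alg L) f); split => //.
    by apply/polyOver1P; exists f.
  by rewrite separable_map.
case: M => [|M]; first by exists 'X; rewrite expn0 comp_polyXr subrr dvdp0.
have := pcharf_p_separable 1 z M hpL; rewrite sz => /esym zin.
have /polyOver1P[h Eh] := Fadjoin_polyOver 1 (z ^+ (p ^ M.+1)) z.
have Ez := Fadjoin_poly_eq zin.
exists h.
have irr := irrf; have f0 : f != 0 by rewrite -size_poly_gt0 (ltn_trans _ irrf.1).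
have rg : root (map_poly (in_alg L) (gcdp f ('X - (h \Po 'X^(p ^ M.+1))))) z.
  rewrite gcdp_map root_gcd rz /= rmorphB /= map_polyX map_comp_poly map_polyXn.
  by rewrite rootE !hornerE horner_comp hornerXn -Eh Ez subrr.
have g1 : size (gcdp f ('X - (h \Po 'X^(p ^ M.+1)))) != 1%N.
  apply: contraL rg => /size_poly1P[c c0 ->].
  by rewrite map_polyC rootC -[_ == 0](fmorph_eq0 (in_alg L)) in c0 *.
have /eqp_dvdl <- := irrf.2 _ g1 (dvdp_gcdl _ _).
exact: dvdp_gcdr.
Qed.

End Inseparable.

(** * Zariski's lemma, by way of Goldman domains *)

Definition not_jac_local (R : idomainType) := forall a : R, a != 0 ->
  exists2 b : R, b != 0 & forall N c, a ^+ N != b * c.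

(** The property says that no localization [R[1/a]] is a field. Here [b = aX + 1]: if [b] divided
    [a^N] then, as [aX = -1] modulo [b], it would divide 1, against its positive degree. *)
Lemma not_jac_local_poly (R : idomainType) : not_jac_local {poly R}.
Proof.
move=> a a0; pose b : {poly R} := a * 'X + 1.
have sb : (1 < size b)%N.
  rewrite size_polyDl ?size_poly1 size_mulX // ltnS size_poly_gt0 //.
exists b => [|N c]; first by rewrite -size_poly_gt0 ltnW.
apply/eqP => E.
have [u Hu] : exists u, 1 = b * u + (a * 'X) ^+ N * (-1) ^+ N.
  elim: (N) => [|k [u Hu]]; first by exists 0; rewrite mulr0 add0r !expr0 mulr1.
  exists (u + (a * 'X) ^+ k * (-1) ^+ k); rewrite {1}Hu mulrDr -addrA; congr (_ + _).
  by rewrite /b !exprS mulrDl mul1r mulN1r mulrN mulrA addrAC subrr add0r.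
have B1 : b * (u + c * 'X ^+ N * (-1) ^+ N) = 1.
  by rewrite mulrDr [RHS]Hu exprMn E !mulrA.
have b0 : b != 0 by rewrite -size_poly_gt0 ltnW.
have := size_mul b0 (_ : u + c * 'X ^+ N * (-1) ^+ N != 0).
rewrite B1 size_poly1.
have n0 : u + c * 'X ^+ N * (-1) ^+ N != 0.
  by apply: contra_eqN B1 => /eqP ->; rewrite mulr0 eq_sym oner_eq0.
move=> /(_ n0); move: sb n0; rewrite -size_poly_gt0.
by case: (size b) => [|[|k]] // _; case: (size _) => [|l] // _; rewrite addSn addnS.
Qed.

(** Multiplying [q(b) = 0] by the power [deg q - 1] of the leading coefficient [l] yields a monic
    equation for [l b]. *)
Lemma lead_coef_mul_integral (R : idomainType) (F : fieldType)
    (phi : {rmorphism R -> F}) (q : {poly R}) b :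
  injective phi -> q != 0 -> root (map_poly phi q) b ->
  integralOver phi (phi (lead_coef q) * b).
Proof.
move=> inj q0 /rootP rq.
have pl0 : phi (lead_coef q) != 0 by rewrite -(rmorph0 phi) (inj_eq inj) lead_coef_eq0.
case Ed: (size q) => [|[|d]]; first by move/eqP: Ed; rewrite size_poly_eq0 (negPf q0).
  move: rq pl0; rewrite lead_coefE Ed (size1_polyC (eq_leq Ed)) map_polyC hornerC coefC /= => ->.
  by rewrite eqxx.
set l := lead_coef q in pl0 *.
pose Q := 'X^(d.+1) + \poly_(i < d.+1) (q`_i * l ^+ (d - i)).
exists Q; first by rewrite monicE lead_coefDl ?lead_coefXn // size_polyXn ltnS size_poly.
apply/rootP; rewrite rmorphD /= map_polyXn hornerD hornerXn.
rewrite poly_def rmorph_sum horner_sum.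
under eq_bigr => i _ do rewrite /= map_polyZ map_polyXn hornerZ hornerXn.
have -> : \sum_(i < d.+1) phi (q`_i * l ^+ (d - i)) * (phi l * b) ^+ i =
    phi l ^+ d * \sum_(i < d.+1) phi q`_i * b ^+ i.
  rewrite mulr_sumr; apply: eq_bigr => i _.
  have -> : phi l ^+ d = phi l ^+ (d - i) * phi l ^+ i by rewrite -exprD subnK // -ltnS.
  by rewrite rmorphM rmorphXn exprMn /= [phi q`_i * phi l ^+ _]mulrC mulrACA.
move: rq; rewrite horner_coef size_map_poly_id0 // Ed big_ord_recr /= coef_map /=.
have -> : q`_d.+1 = l by rewrite /l lead_coefE Ed.
under eq_bigr => i _ do rewrite coef_map /=.
move=> /eqP; rewrite addr_eq0 => /eqP ->.
by rewrite exprMn exprSr -mulrA mulrN subrr.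
Qed.

(** Zariski's lemma: a field containing such an [R] is not finitely generated as a ring over it. A
    generator transcendental over [R] is moved into the base, which becomes [R[X]]. When all are
    algebraic, every element becomes integral over [R] after multiplication by a power of one [a];
    applied to the inverse of [b], this makes [b] divide a power of [a]. *)
Lemma not_jac_local_field_subring (R : idomainType) (F : fieldType)
    (phi : {rmorphism R -> F}) (s : seq F) :
  not_jac_local R -> injective phi ->
  (forall S : {pred F}, subring_closed S -> (forall r, phi r \in S) ->
     (forall a, a \in s -> a \in S) -> forall x, x \in S) ->
  False.
Proof.
have [k] := ubnP (size s); elim: k => // k IH in R phi s *.
rewrite ltnS => les njl inj gen.
have alg a : a \in s -> exists2 q : {poly R}, q != 0 & root (map_poly phi q) a.
  move=> sa; apply: contrapT => nalg.
  have comm : commr_rmorph phi a by move=> r; apply: mulrC.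
  apply: (IH {poly R} (horner_morph comm) (rem a s)) => //.
  - by rewrite size_rem //; case: (s) sa les => // ? ? _.
  - exact: not_jac_local_poly.
  - move=> q q' /eqP; rewrite -subr_eq0 -rmorphB => E.
    apply/eqP; rewrite -subr_eq0; apply/eqP; apply: contrapT => /eqP nz.
    by apply: nalg; exists (q - q').
  - move=> S cS Sphi Ss x; apply: gen => // [r|b sb].
      by have := Sphi r%:P; rewrite /= horner_morphC.
    have [->|nab] := eqVneq b a.
      by have := Sphi 'X; rewrite /= horner_morphX.
    by apply: Ss; have := perm_to_rem sa => /perm_mem/(_ b); rewrite sb inE (negPf nab).
pose int := integralOver phi.
have [a a0 inta] : exists2 a : R, a != 0 & forall b, b \in s -> int (phi a * b).
  elim: (s) (alg) => [|b t IHt] algt; first by exists 1; rewrite ?oner_eq0.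
  have [|c c0 Hc] := IHt; first by move=> d td; apply: algt; rewrite inE td orbT.
  have [q q0 rq] := algt b (mem_head _ _).
  exists (lead_coef q * c) => [|d]; first by rewrite mulf_neq0 ?lead_coef_eq0.
  rewrite inE rmorphM /= => /orP[/eqP ->|/Hc intd]; last first.
    by rewrite -mulrA; apply: integral_mul => //; apply: integral_id.
  by rewrite mulrAC; apply: integral_mul; [apply: lead_coef_mul_integral|exact: integral_id].
have allint x : exists N, int (phi a ^+ N * x).
  pose S : {pred F} := fun x => `[< exists N, int (phi a ^+ N * x) >].
  suff /asboolP : x \in S by [].
  have intX N : int (phi a ^+ N) by rewrite -rmorphXn; apply: integral_id.
  apply: gen => [|r|b sb]; last 2 first.
  - by apply/asboolP; exists 0%N; rewrite mul1r; apply: integral_id.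
  - by apply/asboolP; exists 1%N; apply: inta.
  split.
  - by apply/asboolP; exists 0%N; rewrite mulr1; apply: integral1.
  - move=> u v /asboolP[N Hu] /asboolP[N' Hv]; apply/asboolP; exists (N + N')%N.
    rewrite mulrBr; apply: integral_sub.
      by rewrite addnC exprD -mulrA; exact: (integral_mul (intX _) Hu).
    by rewrite exprD -mulrA; exact: (integral_mul (intX _) Hv).
  - move=> u v /asboolP[N Hu] /asboolP[N' Hv]; apply/asboolP; exists (N + N')%N.
    by rewrite exprD mulrACA; exact: (integral_mul Hu Hv).
have [b b0 Hb] := njl a a0.
have pb0 : phi b != 0 by rewrite -(rmorph0 phi) (inj_eq inj).
have [N [q mq /rootP rq]] := allint (phi b)^-1.
pose d := (size q).-1.
have sq : size q = d.+1 by rewrite prednK // size_poly_gt0 monic_neq0.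
(* The witness is read off the monic equation of [a^N / b], multiplied by [b^d]. *)
apply: (negP (Hb (N * d)%N (- \sum_(i < d) q`_i * a ^+ (N * i) * b ^+ (d - i.+1)))).
apply/eqP/inj.
move: rq; rewrite horner_coef size_map_poly_id0 ?(monicP mq) ?rmorph1 ?oner_eq0 // sq.
rewrite big_ord_recr /= coef_map /= -[q`_d]/(q`_(d.+1).-1) -sq -lead_coefE (monicP mq) rmorph1 mul1r.
move=> /eqP; rewrite addrC addr_eq0 => /eqP /(congr1 (fun x => x * phi b ^+ d)).
rewrite exprMn -mulrA -exprMn mulVf // expr1n mulr1 -exprM => E; rewrite [phi (a ^+ _)]rmorphXn E.
rewrite mulrN rmorphN mulNr; congr (- _); rewrite mulr_suml mulr_sumr rmorph_sum.
apply: eq_bigr => i _; rewrite coef_map /= !rmorphM !rmorphXn /= exprMn -exprM exprVn.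
have -> : phi b ^+ d = phi b ^+ i * (phi b * phi b ^+ (d - i.+1)).
  by rewrite -exprS subnSK // -exprD subnKC // ltnW.
by rewrite -!mulrA mulKf ?expf_neq0 // [RHS]mulrCA; congr (_ * _); rewrite mulrCA.
Qed.

(** * Dimension modulo a subspace *)

Section Dimension.
Variables (K : fieldType).

Section BasisModulo.
Variables (V : lmodType K) (J : set V).
Hypotheses (J0 : J 0) (JP : forall (a : K) u v, J u -> J v -> J (a *: u + v)).

(** Independence and generation are taken modulo a subspace [J], which avoids quotient spaces; [J]
    will be zero, [sep_ideal], [n0] or [Nid]. *)
Definition free_mod (I : finType) (b : I -> V) :=
  forall c : I -> K, J (\sum_i c i *: b i) -> forall i, c i = 0.
Definition span_mod (W : set V) (I : finType) (b : I -> V) :=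
  forall v, W v -> exists c : I -> K, J (v - \sum_i c i *: b i).

Let JD u v : J u -> J v -> J (u + v).
Proof. by move=> Ju Jv; rewrite -[u]scale1r; apply: JP. Qed.
Let JZ a u : J u -> J (a *: u).
Proof. by move=> Ju; rewrite -[_ *: _]addr0; apply: JP. Qed.
Let JB u v : J u -> J v -> J (u - v).
Proof. by move=> Ju Jv; rewrite -scaleN1r; apply: JD => //; apply: JZ. Qed.
Let Jsum (I : Type) (r : seq I) (P : pred I) (F : I -> V) :
  (forall i, P i -> J (F i)) -> J (\sum_(i <- r | P i) F i).
Proof. by move=> H; elim/big_ind: _. Qed.

Lemma free_mod_le d e (b : 'I_d -> V) (b' : 'I_e -> V) (C : 'I_d -> 'I_e -> K) :
  free_mod b -> (forall j, J (b j - \sum_i C j i *: b' i)) -> (d <= e)%N.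
Proof.
move=> fb HC; pose A : 'M[K]_(d, e) := \matrix_(j, i) C j i.
suff : row_free A by rewrite /row_free => /eqP <-; apply: rank_leq_col.
rewrite -kermx_eq0; apply/eqP/row_matrixP => l; rewrite row0.
have : row l (kermx A) *m A = 0 by rewrite -row_mul mulmx_ker row0.
move: (row l (kermx A)) => u uA; apply/rowP => j; rewrite mxE.
apply: fb => {j}.
have -> : \sum_i u 0 i *: b i = \sum_j u 0 j *: (b j - \sum_i C j i *: b' i).
  under [RHS]eq_bigr => j _ do rewrite scalerBr.
  rewrite sumrB -[LHS]subr0; congr (_ - _).
  under eq_bigr => j _ do rewrite scaler_sumr.
  rewrite exchange_big big1 //= => i _.
  under eq_bigr => j _ do rewrite scalerA.
  rewrite -scaler_suml; have /rowP/(_ i) := uA; rewrite !mxE.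
  under eq_bigr => j _ do rewrite mxE.
  by move=> ->; rewrite scale0r.
by apply: Jsum => j _; apply: JZ.
Qed.

(** A free family of maximal length in [W]; the [b'], which may lie outside [W], bound the
    length. *)
Lemma basis_mod_exists e (W : set V) (b' : 'I_e -> V) :
  W 0 -> (forall (a : K) u v, W u -> W v -> W (a *: u + v)) ->
  span_mod W b' ->
  exists d (b : 'I_d -> V), [/\ forall i, W (b i), free_mod b & span_mod W b].
Proof.
move=> W0 WP sb'.
pose Q d := `[< exists b : 'I_d -> V, (forall i, W (b i)) /\ free_mod b >].
have Q0 : exists d, Q d.
  by exists 0%N; apply/asboolP; exists (fun=> 0); split=> // c _ [].
have Qmax d : Q d -> (d <= e)%N.
  move=> /asboolP[b [Wb fb]]; have /choice[C HC] := fun i => sb' (b i) (Wb i).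
  exact: free_mod_le fb HC.
case: (ex_maxnP Q0 Qmax) => d /asboolP[b [Wb fb]] dmax.
exists d, b; split=> // v Wv.
apply: contrapT => nsp; suff /dmax : Q d.+1 by rewrite ltnn.
apply/asboolP.
pose bv (i : 'I_d.+1) := if unlift ord_max i is Some j then b j else v.
exists bv; split=> [i|c]; first by rewrite /bv; case: unliftP.
have -> : \sum_i c i *: bv i = \sum_j c (lift ord_max j) *: b j + c ord_max *: v.
  rewrite big_ord_recr /= {2}/bv unlift_none; congr (_ + _); apply: eq_bigr => i _.
  have -> : widen_ord (leqnSn d) i = lift ord_max i.
    by apply/val_inj; rewrite /= /bump leqNgt ltn_ord.
  by rewrite /bv liftK.
move=> Jc.
have c0 : c ord_max = 0.
  apply/eqP/negPn/negP => nz; apply: nsp.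
  exists (fun i => - (c ord_max)^-1 * c (lift ord_max i)).
  have := JZ (c ord_max)^-1 Jc; rewrite scalerDr scalerA mulVf // scale1r addrC.
  congr (J (_ + _)); rewrite scaler_sumr -sumrN; apply: eq_bigr => i _.
  by rewrite mulNr scaleNr opprK scalerA.
rewrite c0 scale0r addr0 in Jc.
move=> i; case: (unliftP ord_max i) => [j ->|-> //].
exact: (fb (fun j => c (lift ord_max j))).
Qed.

(** Freeness of [b] makes the product of the two coordinate matrices equal to 1; they are square, so
    the product in the other order is 1 as well. *)
Lemma free_mod_dim d (b b' : 'I_d -> V) :
  free_mod b -> span_mod setT b' -> (forall j, exists c : 'I_d -> K, J (b' j - \sum_i c i *: b i)) ->
  free_mod b'.
Proof.
move=> fb sb' /choice[C' HC'].
have /choice[C HC] := fun i => sb' (b i) I.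
pose A : 'M[K]_d := \matrix_(j, i) C j i; pose A' : 'M[K]_d := \matrix_(j, i) C' j i.
have AA' : A *m A' = 1%:M.
  apply/matrixP => i j; rewrite !mxE; apply/eqP; rewrite -subr_eq0; apply/eqP.
  move: j; apply: fb.
  have -> : \sum_l (\sum_j A i j * A' j l - (i == l)%:R) *: b l =
     - (b i - \sum_j C i j *: b' j) - \sum_j C i j *: (b' j - \sum_l C' j l *: b l).
    under eq_bigr => l _ do rewrite scalerBl.
    have dE : \sum_l (i == l)%:R *: b l = b i.
      rewrite (bigD1 i) //= eqxx scale1r big1 ?addr0 // => l /negPf.
      by rewrite eq_sym => ->; rewrite scale0r.
    rewrite sumrB dE.
    have -> : \sum_j C i j *: (b' j - \sum_l C' j l *: b l) = \sum_j C i j *: b' j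
        - \sum_l (\sum_j A i j * A' j l) *: b l.
      under eq_bigr => j _ do rewrite scalerBr.
      rewrite sumrB; congr (_ - _).
      under [RHS]eq_bigr => l _ do rewrite scaler_suml.
      rewrite [RHS]exchange_big; apply: eq_bigr => j _; rewrite scaler_sumr.
      by apply: eq_bigr => l _; rewrite !mxE scalerA.
    by rewrite !opprB [RHS]addrC addrA subrK.
  apply: JB; first by rewrite -scaleN1r; apply: JZ.
  by apply: Jsum => j _; apply: JZ.
have A'A := mulmx1C AA'.
move=> c Hc i.
pose u : 'rV[K]_d := \row_j c j.
suff uA : u *m A' = 0.
  have : u = 0 by rewrite -[u]mulmx1 -A'A mulmxA uA mul0mx.
  by move/rowP/(_ i); rewrite !mxE.
apply/rowP => j; rewrite [RHS]mxE; move: j; apply: fb.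
have -> : \sum_l (u *m A') 0 l *: b l = \sum_j c j *: b' j
    - \sum_j c j *: (b' j - \sum_l C' j l *: b l).
  under [X in _ = _ - X]eq_bigr => j _ do rewrite scalerBr.
  rewrite sumrB opprB addrC subrK.
  under eq_bigr => l _ do rewrite mxE scaler_suml.
  rewrite exchange_big; apply: eq_bigr => j _; rewrite scaler_sumr.
  by apply: eq_bigr => l _; rewrite !mxE scalerA.
by apply: JB => //; apply: Jsum => j _; apply: JZ.
Qed.

Lemma free_mod_coord d (b : 'I_d -> V) t (v : 'I_t -> V) (C : 'I_t -> 'I_d -> K) :
  free_mod b -> (forall j, J (v j - \sum_i C j i *: b i)) ->
  free_mod v <-> row_free (\matrix_(j, i) C j i).
Proof.
move=> fb HC; set A := \matrix_(j, i) _.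
have E c : \sum_j c j *: v j = \sum_j c j *: (v j - \sum_i C j i *: b i)
    + \sum_i (\row_j c j *m A) 0 i *: b i.
  under [X in _ = X + _]eq_bigr => j _ do rewrite scalerBr.
  rewrite sumrB -[LHS]addr0 -addrA; congr (_ + _); apply/esym/eqP.
  rewrite addrC subr_eq0; apply/eqP.
  under eq_bigr => l _ do rewrite mxE scaler_suml.
  rewrite exchange_big; apply: eq_bigr => j _; rewrite scaler_sumr.
  by apply: eq_bigr => l _; rewrite !mxE scalerA.
have Jc c : J (\sum_j c j *: v j) <-> \row_j c j *m A = 0.
  have JJ : J (\sum_j c j *: (v j - \sum_i C j i *: b i)).
    by apply: Jsum => j _; apply: JZ.
  split=> [Jv|u0]; last first.
    by rewrite E u0 [X in _ + X]big1 ?addr0 // => i _; rewrite mxE scale0r.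
  apply/rowP => i; rewrite [RHS]mxE; move: i; apply: fb.
  by move: (JB Jv JJ); rewrite E addrAC subrr add0r.
split=> [fv|fA].
  rewrite -kermx_eq0; apply/eqP/row_matrixP => l; rewrite row0.
  have : row l (kermx A) *m A = 0 by rewrite -row_mul mulmx_ker row0.
  move: (row l (kermx A)) => u uA; apply/rowP => j; rewrite mxE.
  apply: (fv (u 0)); apply/Jc; rewrite -[RHS]uA; congr (_ *m _).
  by apply/rowP => i; rewrite mxE.
move=> c /Jc /eqP; rewrite mulmx_free_eq0 // => /eqP /rowP H i.
by have := H i; rewrite !mxE.
Qed.

End BasisModulo.

(* For a commutative [K]-algebra spanned by its [p]-th powers, Frobenius maps
   bases to bases. *)
Lemma frob_free_mod p (B : comAlgType K) (hp : p \in [pchar K]) (J : set B)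
    d (b : 'I_d -> B) t (v : 'I_t -> B) :
  J 0 -> (forall (a : B) u v, J u -> J v -> J (a * u + v)) ->
  free_mod J b -> span_mod J setT b ->
  (forall x : B, exists s : seq (K * B), J (x - \sum_(y <- s) y.1 *: y.2 ^+ p)) ->
  free_mod J v -> free_mod J (fun j => v j ^+ p).
Proof.
move=> J0 JM fb sb frobB fv.
have JP (a : K) u w : J u -> J w -> J (a *: u + w).
  by rewrite -mulr_algl; apply: JM.
have hpB : p \in [pchar B].
  by apply: (rmorph_pchar (GRing.in_alg B)).
have JD u w : J u -> J w -> J (u + w) by move=> Ju Jw; rewrite -[u]mul1r; apply: JM.
have JZ (a : K) u : J u -> J (a *: u) by move=> Ju; rewrite -[_ *: _]addr0; apply: JP.
have Jsum (I : Type) (r : seq I) (F : I -> B) :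
  (forall i, J (F i)) -> J (\sum_(i <- r) F i) by move=> H; elim/big_ind: _.
have p0 := prime_gt0 (pcharf_prime hp).
have Jpow u : J u -> J (u ^+ p).
  move=> Ju; rewrite -[_ ^+ p]addr0 -(prednK p0) exprSr; exact: JM.
have frobE (I : finType) (c : I -> K) (u : I -> B) :
    (\sum_i c i *: u i) ^+ p = \sum_i c i ^+ p *: u i ^+ p.
  rewrite -(pFrobenius_autE hpB) rmorph_sum; apply: eq_bigr => i _.
  by rewrite /= pFrobenius_autE exprZn.
have frobJ x (c : 'I_d -> K) : J (x - \sum_i c i *: b i) ->
    J (x ^+ p - \sum_i c i ^+ p *: b i ^+ p).
  move=> /Jpow; rewrite -frobE -!(pFrobenius_autE hpB) -rmorphB.
  by rewrite pFrobenius_autE.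
(* Every element is a combination of [p]-th powers modulo [J], and each of these expands on the
   [b i ^+ p] by additivity of Frobenius. *)
have sbp : span_mod J setT (fun i => b i ^+ p).
  move=> x _; have [s] := frobB x; elim: s x => [|y s IH] x.
    rewrite big_nil subr0 => Jx; exists (fun=> 0).
    by rewrite big1 ?subr0 // => i _; rewrite scale0r.
  rewrite big_cons opprD addrA => /IH[c Hc].
  have [cy Hy] := sb y.2 I.
  exists (fun i => y.1 * cy i ^+ p + c i).
  have := JP y.1 _ _ (frobJ _ _ Hy) Hc; congr J.
  rewrite scalerBr; under [in RHS]eq_bigr => i _ do rewrite scalerDl -scalerA.
  by rewrite big_split /= -scaler_sumr addrACA [_ + (x - _)]addrC subrK opprD.
have fbp : free_mod J (fun i => b i ^+ p).
  by apply: (free_mod_dim J0 JP fb sbp) => j; apply: sb.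
have /choice[C HC] := fun j => sb (v j) I.
have /(free_mod_coord J0 JP fb HC) fC := fv.
apply/(free_mod_coord J0 JP fbp (fun j => frobJ _ _ (HC j))).
(* Frobenius acts entrywise on the coordinates, and a field morphism preserves the rank. *)
have -> : \matrix_(j, i) C j i ^+ p = map_mx (pFrobenius_aut hp) (\matrix_(j, i) C j i).
  by apply/matrixP => i j; rewrite !mxE pFrobenius_autE.
by rewrite row_free_map.
Qed.

Lemma has_dim_image (V V' : lmodType K) (J : set V) (W' : set V') (f : V -> V')
    d (b : 'I_d -> V) : linear f ->
  (forall v, J v <-> f v = 0) -> (forall v', W' v' <-> exists v, f v = v') ->
  free_mod J b -> span_mod J setT b -> has_dim W' d.
Proof.
move=> lf Jf W'f fb sb.
pose g : {linear V -> V'} := HB.pack f (GRing.isLinear.Build K V V' *:%R f lf).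
exists (fun i => f (b i)).
have fE c : \sum_i c i *: f (b i) = f (\sum_i c i *: b i).
  by rewrite -[RHS]/(g _) linear_sum; apply: eq_bigr => i _; rewrite linearZ.
split=> [v'|c].
  split=> [/W'f[v <-]|[c ->]]; last by apply/W'f; exists (\sum_i c i *: b i).
  have [c Hc] := sb v I; exists c; apply/eqP; rewrite fE -subr_eq0.
  by rewrite -[f v]/(g v) -[f (\sum_i _)]/(g _) -linearB; apply/eqP/Jf.
by rewrite fE => /Jf; apply: fb.
Qed.

Lemma has_dim_fin (V : lmodType K) (W : set V) (I : finType) (b : I -> V) :
  (forall v, W v <-> exists c : I -> K, v = \sum_i c i *: b i) ->
  (forall c : I -> K, \sum_i c i *: b i = 0 -> forall i, c i = 0) ->
  has_dim W #|I|.
Proof.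
move=> Wb fb; exists (fun i => b (enum_val i)).
have E (c : 'I_#|I| -> K) : \sum_i c i *: b (enum_val i) = \sum_x c (enum_rank x) *: b x.
  rewrite [RHS](reindex (@enum_val I predT)) /=; last exact: onW_bij (enum_val_bij _).
  by apply: eq_bigr => i _; rewrite enum_valK.
split=> [v|c].
  split=> [/Wb[c ->]|[c ->]]; last by apply/Wb; rewrite E; eexists.
  exists (fun i => c (enum_val i)); rewrite E.
  by apply: eq_bigr => x _; rewrite enum_rankK.
by rewrite E => /fb H i; rewrite -(enum_valK i).
Qed.

Lemma has_dim_le (V : lmodType K) (W W' : set V) d d' :
  has_dim W d -> has_dim W' d' -> (forall v, W v -> W' v) -> (d <= d')%N.
Proof.
move=> [b [Wb fb]] [b' [Wb' _]] WW'.
have /choice[C HC] : forall i, exists c, b i = \sum_j c j *: b' j.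
  move=> i; apply/Wb'/WW'/Wb; exists (fun j => (j == i)%:R).
  rewrite (bigD1 i) //= eqxx scale1r big1 ?addr0 // => j /negPf ->.
  by rewrite scale0r.
apply: (@free_mod_le V (fun v => v = 0) _ _ d d' b b' C) => // [a u v -> ->|j].
  by rewrite scaler0 addr0.
by rewrite -HC subrr.
Qed.

Lemma has_dim_subspace (V : lmodType K) (W W' : set V) d' :
  has_dim W' d' -> (forall v, W v -> W' v) -> W 0 ->
  (forall (a : K) u v, W u -> W v -> W (a *: u + v)) ->
  exists d, has_dim W d.
Proof.
move=> [b' [Wb' _]] WW' W0 WP.
have JP (a : K) (u v : V) : u = 0 -> v = 0 -> a *: u + v = 0.
  by move=> -> ->; rewrite scaler0 addr0.
have sp : span_mod (fun v => v = 0) W b'.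
  by move=> v /WW' /Wb'[c ->]; exists c; rewrite subrr.
have [d [b [Wb fb sb]]] := basis_mod_exists (erefl : (fun v : V => v = 0) 0) JP W0 WP sp.
exists d, b; split=> // v; split=> [/sb[c /eqP]|[c ->]].
  by rewrite subr_eq0 => /eqP ->; exists c.
elim/big_ind: _ => // [x y Wx Wy|i _]; first by rewrite -[x]scale1r; apply: WP.
by rewrite -[_ *: _]addr0; apply: WP.
Qed.

End Dimension.

(** * Quasi-polynomials and power series *)

Section Counting.
Implicit Types (s t : seq nat) (q i : nat).

(* The [t] with [sum_j t_j s_j <= i] *)
Fixpoint solutions s i : seq (seq nat) :=
  if s is q :: s' then [seq l :: t | l <- iota 0 (i %/ q).+1, t <- solutions s' (i - l * q)]
  else [:: [::]].

Lemma mem_solutions s i t : all (ltn 0) s ->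
  (t \in solutions s i) =
    (size t == size s) && (\sum_(j < size s) nth 0 t j * nth 0 s j <= i)%N.
Proof.
elim: s i t => [|q s IH] i t; first by move=> _; rewrite inE big_ord0 andbT size_eq0.
case/andP=> q0 s0; apply/allpairsPdep/idP => [[l [u [+ + ->]]]|].
  rewrite mem_iota /= add0n ltnS => lel; rewrite IH // => /andP[/eqP -> le].
  rewrite eqxx big_ord_recl /= -leq_subRL ?(leq_trans _ (leq_trunc_div i q)) ?leq_mul2r ?lel ?orbT //.
case: t => [|l u] // /andP[/eqP[su]]; rewrite big_ord_recl => le.
have {}le : (l * q + \sum_(j < size s) nth 0 u j * nth 0 s j <= i)%N by exact: le.
have lel := leq_trans (leq_addr _ _) le.
exists l, u; split=> //; first by rewrite mem_iota add0n ltnS leq_divRL.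
by rewrite IH // su eqxx leq_subRL.
Qed.

Lemma solutions_uniq s i : uniq (solutions s i).
Proof.
elim: s i => [|q s IH] i //; apply: allpairs_uniq_dep; [exact: iota_uniq|by move=> l _|].
by move=> [l t] [l' t'] _ _ /= [-> ->].
Qed.

Definition count_solutions s i := size (solutions s i).

(** The first unknown is zero or can be lowered by one; this recursion yields both the Poincaré
    series and the quasi-polynomial. *)
Lemma count_solutions_rec q s i : (0 < q)%N -> count_solutions (q :: s) i =
  (count_solutions s i + if q <= i then count_solutions (q :: s) (i - q) else 0)%N.
Proof.
move=> q0.
have E j : count_solutions (q :: s) j = (\sum_(l < (j %/ q).+1) count_solutions s (j - l * q))%N.
  by rewrite /count_solutions size_allpairs_dep sumnE big_map (_ : iota 0 _ = index_iota 0 (j %/ q).+1) ?big_mkord // /index_iota subn0.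
rewrite !E big_ord_recl mul0n subn0; congr addn; case: leqP => [le|lt]; last first.
  by rewrite divn_small // big_ord0.
have -> : (i %/ q = ((i - q) %/ q).+1)%N by rewrite -{1}(subnK le) divnDr // divnn q0 addn1.
by apply: eq_bigr => l _; rewrite /= /bump add1n mulSn subnDA.
Qed.

End Counting.

Section Series.
Implicit Types (A B : {poly int}) (f : nat -> int).

Definition conv A f N : int := \sum_(j < N.+1) A`_j * f (N - j)%N.

Lemma conv_coef A f N N' : (N <= N')%N -> conv A f N = (A * \poly_(i < N'.+1) f i)`_N.
Proof.
move=> le; rewrite coefM; apply: eq_bigr => j _; rewrite coef_poly ltnS.
by rewrite (leq_trans (leq_subr _ _)).
Qed.

Lemma convM A B f N : conv (A * B) f N = conv A (conv B f) N.
Proof.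
rewrite (conv_coef _ _ (leqnn N)) -mulrA coefM; apply: eq_bigr => j _.
by rewrite -conv_coef // leq_subr.
Qed.

Lemma conv_1subXn q f N : (0 < q)%N ->
  conv (1 - 'X^q) f N = f N - (if (q <= N)%N then f (N - q)%N else 0).
Proof.
move=> q0; rewrite (conv_coef _ _ (leqnn N)) mulrBl mul1r coefB coef_poly leqnn.
rewrite mulrC coefMXn ltnNge; case: leqP => //= le.
by rewrite coef_poly ltnS leq_subr.
Qed.

(** The condition [<= i] gives the empty list the series [1/(1 - X)] instead of 1: hence a
    right-hand side constantly equal to 1, and the factor [1 - X] in the Poincaré series. *)
Lemma conv_solutions s N : all (ltn 0%N) s ->
  conv (\prod_(q <- s) (1 - 'X^q)) (fun i => (count_solutions s i)%:Z) N = 1.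
Proof.
elim: s N => [|q s IH] N /=.
  by move=> _; rewrite big_nil (conv_coef _ _ (leqnn N)) mul1r coef_poly leqnn.
case/andP=> q0 s0; rewrite big_cons mulrC convM -[RHS](IH N s0); apply: eq_bigr => j _.
congr (_ * _); rewrite conv_1subXn // count_solutions_rec // PoszD.
by case: ifP => _; rewrite ?subr0 ?addr0 // addrK.
Qed.

Lemma series_solutions s c : all (ltn 0%N) s ->
  series_eq_frac (fun i => (count_solutions s i * c)%N) (c%:R)%:P
    ((1 - 'X) * \prod_(q <- s) (1 - 'X^q)).
Proof.
move=> s0; split=> [|N].
  have H : (\prod_(q <- s) (1 - 'X^q) : {poly int})`_0 = 1.
    elim: s s0 => [|q s IH] /=; first by rewrite big_nil coef1.
    case/andP=> q0 /IH E; rewrite big_cons coef0M E mulr1 coefB coef1 coefXn.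
    by rewrite (ltn_eqF q0) subr0.
  by rewrite coef0M H coefB coef1 coefX subr0 mulr1.
transitivity (c%:R * conv ((1 - 'X^1) * \prod_(q <- s) (1 - 'X^q)) (fun i => (count_solutions s i)%:Z) N).
  rewrite mulr_sumr; apply: eq_bigr => j _.
  by rewrite expr1 PoszM mulrA [RHS]mulrC natz.
rewrite convM conv_1subXn // coefC conv_solutions //; case: N => [|N] /=.
  by rewrite subr0 mulr1.
by rewrite conv_solutions // subrr mulr0.
Qed.

End Series.

Section QuasiPolynomial.
Implicit Types (G S : {poly rat}).

(** In the inductive step the top term is removed by a multiple of [X^(d+1) - (X - M)^(d+1)], whose
    coefficient of degree [d] is [M (d+1)]. For [d = 0] the coefficient formula reads [0 = 0], as
    division by 0 gives 0. *)
Lemma antidifference (M d : nat) G : (0 < M)%N -> (size G <= d)%N -> exists S,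
  [/\ (size S <= d.+1)%N, S`_d = G`_d.-1 / (M * d)%:R & forall x, S.[x] - S.[x - M%:R] = G.[x]].
Proof.
move=> M0; elim: d G => [|d IH] G sG.
  exists 0; rewrite size_poly0 muln0 invr0 mulr0 coef0; split=> // x.
  by move: sG; rewrite leqn0 size_poly_eq0 => /eqP ->; rewrite !horner0 subrr.
pose c := G`_d / (M * d.+1)%:R; pose T := c *: ('X^(d.+1) - ('X - M%:R%:P) ^+ d.+1).
have nz : ((M * d.+1)%:R : rat) != 0 by rewrite pnatr_eq0 muln_eq0 negb_or -lt0n M0.
have sT : (size (G - T)%R <= d)%N.
  have ET : T = c *: \sum_(l < d.+1) - ('C(d.+1, l.+1)%:R * (- M%:R) ^+ l.+1) *: 'X^(d - l).
    rewrite /T exprDn big_ord_recl bin0 subn0 expr0 mulr1 mulr1n opprD addNKr ?addrA ?subrr ?add0r -sumrN; congr (_ *: _).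
    apply: eq_bigr => l _; rewrite /= /bump add1n subSS -rmorphN -rmorphXn mulrC mul_polyC -scaler_nat scalerA -scaleNr.
    by congr (_ *: _); rewrite mulrC.
  apply/leq_sizeP => j; rewrite leq_eqVlt => /orP[/eqP <-|lt]; rewrite coefB ET coefZ coef_sum.
    rewrite big_ord_recl subn0 coefZ coefXn eqxx mulr1 big1 ?addr0 => [|l _].
      have E1 : - ('C(d.+1, 1)%:R * (- M%:R) ^+ 1) = (M * d.+1)%:R :> rat.
        by rewrite bin1 expr1 mulrN opprK -natrM mulnC.
      by rewrite /= E1 /c divfK // subrr.
    rewrite coefZ coefXn /= /bump add1n.
    case: eqP => [E|_]; last by rewrite mulr0.
    by have := ltn_ord l; lia.
  rewrite big1 => [|l _]; first by rewrite mulr0 subr0 nth_default // (leq_trans sG).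
  rewrite coefZ coefXn; case: eqP => [E|_]; last by rewrite mulr0.
  by move: lt; rewrite E ltnNge leq_subr.
have [S [sS _ HS]] := IH _ sT.
exists (c *: 'X^(d.+1) + S); split.
- rewrite (leq_trans (size_polyD _ _)) // geq_max (leq_trans sS) // andbT.
  by rewrite (leq_trans (size_scale_leq _ _)) // size_polyXn.
- by rewrite coefD coefZ coefXn eqxx mulr1 (nth_default 0 sS) addr0.
- move=> x; rewrite !hornerE opprD addrACA HS hornerD hornerN /T !hornerE.
  by rewrite /= -mulrBr addrC addrA addNr add0r.
Qed.

(** The equality holds for every [i], and [c] is the coefficient of degree [d] rather than the
    leading one, so that inductions carry no condition on degrees; [quasi_poly_almost] returns to
    [almost_polynomial]. *)
Definition quasi_poly (M d : nat) (c : rat) (f : nat -> nat) := exists q : nat -> {poly rat},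
  (forall r, (size (q r) <= d.+1)%N /\ (q r)`_d = c) /\ forall i, (f i)%:R = (q (i %% M)%N).[i%:R].

Lemma poly_shift d G (a : rat) : (size G <= d.+1)%N ->
  (size (G \Po ('X + a%:P)) <= d.+1)%N /\ (G \Po ('X + a%:P))`_d = G`_d.
Proof.
move=> sG; have s2 : size ('X + a%:P) = 2 by rewrite size_XaddC.
have sE : size (G \Po ('X + a%:P)) = size G by rewrite size_comp_poly2.
split; first by rewrite sE.
have [eq|ne] := eqVneq (size G) d.+1; last first.
  have le : (size G <= d)%N by rewrite -ltnS ltn_neqAle ne.
  by rewrite !nth_default ?sE.
have := @lead_coef_comp _ G ('X + a%:P); rewrite s2 => /(_ isT).
by rewrite !lead_coefE sE eq /= -lead_coefE lead_coefXaddC expr1n mulr1.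
Qed.

(** Unrolling the recursion [M/q] times writes [f(i) - f(i - M)] as a polynomial in [i] depending on
    [i mod M], with coefficient [c M/q] in degree [d]; the antidifference divides it by
    [M (d+1)]. *)
Lemma quasi_poly_antidifference M d c q f g : (0 < q)%N -> (q %| M)%N -> (0 < M)%N ->
  quasi_poly M d c g ->
  (forall i, f i = (g i + if q <= i then f (i - q) else 0)%N) ->
  quasi_poly M d.+1 (c / (q * d.+1)%:R) f.
Proof.
move=> q0 /dvdnP[N EM] M0 [G [sG HG]] Hf.
have N0 : (0 < N)%N by move: M0; rewrite EM muln_gt0 => /andP[].
(* [M] is added before [l * q] is subtracted so that the subtraction on naturals is exact. *)
pose H r := \sum_(l < N) (G ((r + M - l * q) %% M)%N \Po ('X + (- (l * q)%:R)%:P)).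
have Hs r : (size (H r) <= d.+1)%N /\ (H r)`_d = N%:R * c.
  split.
    apply: (leq_trans (size_sum _ _ _)); apply/bigmax_leqP => l _.
    by apply: (poly_shift _ _).1; apply: (sG _).1.
  rewrite coef_sum (eq_bigr (fun=> c)) ?sumr_const ?card_ord ?mulr_natl // => l _.
  have [s1 s2] := sG ((r + M - l * q) %% M)%N.
  by have [_ ->] := poly_shift (- (l * q)%:R) s1.
have fM i : (M <= i)%N -> (f i)%:R = (f (i - M)%N)%:R + (H (i %% M)%N).[i%:R].
  move=> leM.
  have step l : (l <= N)%N -> (f i)%:R = (f (i - l * q)%N)%:R +
     \sum_(j < l) (G ((i %% M + M - j * q) %% M)%N \Po ('X + (- (j * q)%:R)%:P)).[i%:R].
    elim: l => [|l IHl] lt; first by rewrite big_ord0 addr0 subn0.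
    rewrite IHl ?(ltnW lt) // big_ord_recr /=.
    have leq1 : (l.+1 * q <= i)%N by rewrite (leq_trans _ leM) // EM leq_mul2r lt orbT.
    have leq2 : (l * q <= i)%N by rewrite (leq_trans _ leq1) // leq_mul2r leqnSn orbT.
    have Ef : f (i - l * q)%N = (g (i - l * q) + f (i - l.+1 * q))%N.
      by rewrite (Hf (i - l * q)%N) leq_subRL // -mulSnr leq1 -subnDA -mulSnr.
    have lM : (l * q <= M)%N by rewrite EM leq_mul2r ltnW ?orbT.
    have Em : ((i - l * q) %% M = (i %% M + M - l * q) %% M)%N.
      have iM : (0 < i %/ M)%N by rewrite divn_gt0.
      have Ei : i = ((i %/ M).-1 * M + (i %% M + M))%N.
        by rewrite {1}(divn_eq i M) -{1}(prednK iM) mulSnr -addnA [(M + _)%N]addnC.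
      by rewrite {1}Ei -addnBA ?modnMDl // (leq_trans lM) // leq_addl.
    have EG : (G ((i - l * q) %% M)%N).[(i - l * q)%N%:R] =
        (G ((i %% M + M - l * q) %% M)%N \Po ('X + (- (l * q)%:R)%:P)).[i%:R].
      by rewrite Em horner_comp !hornerE natrB.
    by rewrite Ef natrD HG EG [X in X + _]addrC -addrA [X in _ + X]addrC.
  rewrite (step N) // -EM; congr (_ + _); rewrite /H horner_sum; exact: eq_bigr.
pose c' := c / (q * d.+1)%:R.
have /choice[S HS] : forall r, exists S, [/\ (size S <= d.+2)%N, S`_d.+1 = c' &
    forall x, S.[x] - S.[x - M%:R] = (H r).[x]].
  move=> r; have [s1 s2] := Hs r; have [S [sS cS ES]] := antidifference M0 s1.
  exists S; split=> //; rewrite cS /= s2 /c' EM -mulnA natrM invfM mulrA.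
  by rewrite [N%:R * c]mulrC mulfK // pnatr_eq0 -lt0n.
(* The constant is fitted to the initial value [f r] in each residue class. *)
exists (fun r => S r + ((f r)%:R - (S r).[r%:R])%:P); split=> [r|i].
  have [s1 s2 _] := HS r; split; last by rewrite coefD coefC addr0.
  by rewrite (leq_trans (size_polyD _ _)) // geq_max s1 (leq_trans (size_polyC_leq1 _)).
rewrite !hornerE /=; elim/ltn_ind: i => i IH.
have [lt|le] := ltnP i M; first by rewrite modn_small // addrAC subrr add0r.
have ltM : (i - M < i)%N by rewrite ltn_subrL M0 (leq_trans M0 le).
have EmodM : ((i - M) %% M = i %% M)%N by rewrite -{2}(subnK le) modnDr.
have [_ _ ES] := HS (i %% M)%N.
by rewrite fM // IH // EmodM -ES natrB //; ring.
Qed.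

Lemma quasi_poly_solutions M s : (0 < M)%N -> all (ltn 0%N) s -> all (dvdn^~ M) s ->
  quasi_poly M (size s) ((\prod_(q <- s) q * (size s)`!)%:R^-1) (count_solutions s).
Proof.
move=> M0; elim: s => [|q s IH] /=.
  move=> _ _; exists (fun=> 1); split=> [r|i]; last by rewrite hornerE.
  by rewrite size_poly1 coef1 big_nil mul1n invr1.
case/andP=> q0 s0 /andP[qM sM].
have := quasi_poly_antidifference q0 qM M0 (IH s0 sM) (fun i => count_solutions_rec s i q0).
by congr quasi_poly; rewrite -invfM -natrM big_cons factS; congr (_%:R^-1); ring.
Qed.

Lemma quasi_polyM M d c f e : quasi_poly M d c f ->
  quasi_poly M d (c * e%:R) (fun i => (f i * e)%N).
Proof.
move=> [q [sq Hq]]; exists (fun r => e%:R *: q r); split=> [r|i].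
  have [s1 s2] := sq r; rewrite coefZ s2 mulrC; split=> //.
  exact: leq_trans (size_scale_leq _ _) s1.
by rewrite natrM Hq hornerZ mulrC.
Qed.

Lemma quasi_poly_almost M d c f : (0 < M)%N -> c != 0 -> quasi_poly M d c f ->
  almost_polynomial M d c f.
Proof.
move=> M0 c0 [q [sq Hq]]; split=> //; exists q; split=> [r _|]; last by exists 0%N => i _.
have [s1 s2] := sq r; have E : size (q r) = d.+1.
  apply/eqP; rewrite eqn_leq s1 ltnNge; apply/negP => le.
  by case/eqP: c0; rewrite -s2 nth_default.
by rewrite lead_coefE E.
Qed.

Lemma poly_asymptotic d G (eps : rat) : (size G <= d.+1)%N -> 0 < eps ->
  exists N : nat, forall i : nat, (N <= i)%N -> `|G.[i%:R] - G`_d * i%:R ^+ d| <= eps * i%:R ^+ d.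
Proof.
move=> sG e0; pose B := \sum_(j < d) `|G`_j|.
have B0 : 0 <= B by apply: sumr_ge0 => j _; apply: normr_ge0.
have /archi_boundP Hb : 0 <= B / eps by rewrite divr_ge0 // ltW.
exists (Num.bound (B / eps)).+1 => i lei.
have -> : G.[i%:R] - G`_d * i%:R ^+ d = \sum_(j < d) G`_j * i%:R ^+ j.
  by rewrite (horner_coef_wide _ sG) big_ord_recr /= addrK.
have i1 : 1 <= i%:R :> rat by rewrite ler1n (leq_trans _ lei).
have Bi : B <= eps * i%:R.
  rewrite mulrC -ler_pdivrMr // ltW // (lt_le_trans Hb) // ler_nat.
  by rewrite (leq_trans _ lei).
apply: (le_trans (ler_norm_sum _ _ _)).
have [d0|d0] := posnP d.
  by rewrite big1 ?mulr_ge0 ?exprn_ge0 ?ler0n ?(ltW e0) // => j _; have := ltn_ord j; rewrite {2}d0.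
rewrite -(prednK d0) exprS mulrA; apply: (@le_trans _ _ (B * i%:R ^+ d.-1)); last first.
  by rewrite ler_wpM2r // exprn_ge0 // ler0n.
rewrite /B mulr_suml prednK //; apply: ler_sum => j _.
rewrite normrM normrX normr_nat ler_wpM2l ?normr_ge0 // ler_weXn2l //.
by rewrite -ltnS prednK.
Qed.

(** The shift [a], of either sign, serves to compare filtrations that contain one another up to a
    shift of the index. *)
Lemma quasi_poly_asymptotic M d c f (a eps : rat) : (0 < M)%N -> quasi_poly M d c f -> 0 < eps ->
  exists N, forall i j, (N <= i)%N -> j%:R = i%:R + a -> `|(f j)%:R - c * i%:R ^+ d| <= eps * i%:R ^+ d.
Proof.
move=> M0 [q [sq Hq]] e0.
have /choice[N HN] : forall r, exists N : nat, forall i, (N <= i)%N ->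
    `|(q r).[i%:R + a] - c * i%:R ^+ d| <= eps * i%:R ^+ d.
  move=> r; have [s1 s2] := sq r; have [s3 s4] := poly_shift a s1.
  have [N HN] := poly_asymptotic s3 e0; exists N => i /HN.
  by rewrite s4 s2 horner_comp !hornerE.
exists (\max_(r < M) N r)%N => i j le Hj; rewrite Hq Hj; apply: HN.
by apply: leq_trans le; apply: (leq_bigmax (Ordinal (ltn_pmod j M0))).
Qed.

End QuasiPolynomial.

(** * Extension of scalars *)

Section ExtensionOfScalarsTheory.
Import monalg finmap.

Lemma quotmod_proj_eq0 (R : pzRingType) (M : lmodType R) (S : set M) v :
  quotmod_proj S v = 0 <-> Defs.span S v.
Proof.
have p0 : quotmod_proj S 0 = 0.
  by apply: (addrI (quotmod_proj S 0)); rewrite -quotmod_projD !addr0.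
split=> [/eqP|Sv]; last apply/eqP; rewrite -p0 /quotmod_proj.
  by rewrite -Quotient.idealrBE subr0 => /asboolP.
by rewrite -Quotient.idealrBE subr0; apply/asboolP.
Qed.

Section MalgLift.
Variables (X : choiceType) (S : nzRingType) (W : zmodType) (T : S -> X -> W).
Hypothesis TD : forall a b v, T (a + b) v = T a v + T b v.
Local Notation malg := (@monalg.malg X S).
Local Notation mcoeff := monalg.mcoeff.
Implicit Types (x y : malg).

Let T0 v : T 0 v = 0.
Proof. by apply: (addrI (T 0 v)); rewrite -TD !addr0. Qed.

(** [T] is additive in the coefficient and [W] is a mere abelian group, because the target will also
    be [V], which is not an [S]-module. *)
Definition malg_lift x : W := \sum_(v <- monalg.msupp x) T (mcoeff v x) v.

Lemma malg_liftEw (d : {fset X}) x : fsubset (monalg.msupp x) d ->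
  malg_lift x = \sum_(v <- d) T (mcoeff v x) v.
Proof.
by move=> sub; apply: big_fset_incl => // v _ /monalg.mcoeff_outdom ->.
Qed.

Lemma malg_liftD x y : malg_lift (x + y) = malg_lift x + malg_lift y.
Proof.
pose d := fsetU (monalg.msupp x) (monalg.msupp y).
rewrite (@malg_liftEw d) ?monalg.msuppD_le // (@malg_liftEw d x) ?fsubsetUl //.
rewrite (@malg_liftEw d y) ?fsubsetUr // -big_split; apply: eq_bigr => v _.
by rewrite monalg.mcoeffD TD.
Qed.

Lemma malg_liftU c v : malg_lift (monalg.mkmalgU v c) = T c v.
Proof.
rewrite (@malg_liftEw [fset v]%fset) ?monalg.msuppU_le // big_seq_fset1.
by rewrite monalg.mcoeffUU.
Qed.

Lemma malg_lift0 : malg_lift 0 = 0.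
Proof. by apply: (addrI (malg_lift 0)); rewrite -malg_liftD !addr0. Qed.

Lemma malg_liftN x : malg_lift (- x) = - malg_lift x.
Proof. by apply: (addrI (malg_lift x)); rewrite -malg_liftD !subrr malg_lift0. Qed.

End MalgLift.

Lemma malg_scaleU (X : choiceType) (S : nzRingType) (c d : S) (v : X) :
  c *: monalg.mkmalgU v d = monalg.mkmalgU v (c * d).
Proof. by apply/monalg.malgP => w; rewrite monalg.mcoeffZ !monalg.mcoeffU mulrnAr. Qed.

Section TensorTheory.
Variables (R : pzRingType) (S : nzRingType) (f : {rmorphism R -> S}) (V : lmodType R).
Local Notation U := (tensor f V).
Local Notation one := (@one_tensor R S f V).
Local Notation gen v := (monalg.mkmalgU v 1 : monalg.malg V S).
Local Notation rel := (@tensor_relations R S f V).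

Let projL : linear (quotmod_proj rel : monalg.malg V S -> U).
Proof. by move=> c x y; rewrite quotmod_projD quotmod_projZ. Qed.

Let projB x y : quotmod_proj rel (x - y) = quotmod_proj rel x - quotmod_proj rel y :> U.
Proof. by rewrite -[- y]scaleN1r addrC projL scaleN1r addrC. Qed.

Lemma one_tensorD u v : one (u + v) = one u + one v.
Proof.
apply/eqP; rewrite -subr_eq0 opprD addrA; apply/eqP.
have : quotmod_proj rel (gen (u + v) - gen u - gen v) = 0.
  by apply/quotmod_proj_eq0/span_incl; left; exists u, v.
by rewrite !projB.
Qed.

Lemma one_tensorZ a v : one (a *: v) = f a *: one v.
Proof.
apply/eqP; rewrite -subr_eq0; apply/eqP.
have : quotmod_proj rel (gen (a *: v) - f a *: gen v) = 0.
  by apply/quotmod_proj_eq0/span_incl; right; exists a, v.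
by rewrite projB quotmod_projZ.
Qed.

Lemma tensor_ind (T : U -> Prop) : T 0 -> (forall x y, T x -> T y -> T (x + y)) ->
  (forall s v, T (s *: one v)) -> forall x, T x.
Proof.
move=> T0 TD Tg x; have [y ->] := quotmod_surj x.
rewrite [y]monalg.monalgE; elim: (monalg.msupp y : seq _) => [|v s IH].
  by rewrite big_nil; have -> : quotmod_proj rel 0 = 0 by apply/quotmod_proj_eq0; case: (span_closed rel) => /asboolP.
rewrite big_cons quotmod_projD; apply: TD => //.
have -> : monalg.mkmalgU v (monalg.mcoeff v y) = monalg.mcoeff v y *: gen v.
  by rewrite malg_scaleU mulr1.
by rewrite quotmod_projZ; apply: Tg.
Qed.

Lemma tensor_lift (M : lmodType S) (h : V -> M) : (forall u v, h (u + v) = h u + h v) ->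
  (forall a v, h (a *: v) = f a *: h v) ->
  exists phi : {linear U -> M}, forall v, phi (one v) = h v.
Proof.
move=> hD hZ; pose T (s : S) v := s *: h v.
have TD a b v : T (a + b) v = T a v + T b v by rewrite /T scalerDl.
pose L := malg_lift T.
have LZ c x : L (c *: x) = c *: L x.
  rewrite [x]monalg.monalgE; elim: (monalg.msupp x : seq _) => [|v s IH].
    by rewrite big_nil scaler0 /L malg_lift0 // scaler0.
  rewrite big_cons scalerDr /L !malg_liftD // !scalerDr malg_scaleU !malg_liftU //.
  by rewrite [X in _ + X]IH; congr (_ + _); rewrite /T scalerA.
have L0 x : Defs.span rel x -> L x = 0.
  apply: (@span_ind _ _ _ (fun x => L x = 0)) => [|y].
    split; first by apply/asboolP; apply: malg_lift0.
    move=> a y z /asboolP Hy /asboolP Hz; apply/asboolP.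
    by rewrite /L malg_liftD // -/L LZ Hy Hz scaler0 addr0.
  case=> [[u [v ->]]|[a [v ->]]].
    by rewrite /L !malg_liftD // !malg_liftN // !malg_liftU // /T !scale1r hD addrAC addrK subrr.
  by rewrite /L malg_liftD // malg_liftN // -/L LZ /L !malg_liftU // /T !scale1r hZ subrr.
pose phi (x : U) : M := L (repr (x : Quotient.quot (span_pred rel))).
have phiE x : phi (quotmod_proj rel x) = L x.
  rewrite /phi; set y := repr _; apply/eqP; rewrite -subr_eq0.
  rewrite -malg_liftN // -malg_liftD // -/L; apply/eqP/L0/quotmod_proj_eq0.
  by rewrite -[- x]scaleN1r addrC projL scaleN1r /quotmod_proj reprK addNr.
have lphi : linear phi.
  move=> c x y; have [x' ->] := quotmod_surj x; have [y' ->] := quotmod_surj y.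
  by rewrite -[_ + _]/(c *: quotmod_proj rel x' + quotmod_proj rel y') -projL !phiE /L malg_liftD // -/L LZ.
pose phi' : {linear U -> M} := HB.pack phi (GRing.isLinear.Build S U M *:%R phi lphi).
by exists phi' => v; rewrite [LHS]phiE /L malg_liftU // /T scale1r.
Qed.

(** A balanced biadditive map factors through the tensor product. The relations generate a left
    [S]-submodule while [T] is not [S]-linear: hence the vanishing is proved for all left multiples
    [c *: x]. *)
Lemma one_tensor_detect (W : zmodType) (T : S -> V -> W) :
  (forall a b v, T (a + b) v = T a v + T b v) ->
  (forall a u v, T a (u + v) = T a u + T a v) ->
  (forall a c v, T (a * f c) v = T a (c *: v)) ->
  forall v, one v = 0 -> T 1 v = 0.
Proof.
move=> TD TDr Tb v /quotmod_proj_eq0 H.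
have T0 w : T 0 w = 0 by apply: (addrI (T 0 w)); rewrite -TD !addr0.
have TN a w : T (- a) w = - T a w.
  by apply: (addrI (T a w)); rewrite -TD !subrr T0.
pose L := malg_lift T.
have Lg c u : L (c *: gen u) = T c u by rewrite malg_scaleU mulr1 /L malg_liftU.
suff L0 x : Defs.span rel x -> forall c, L (c *: x) = 0 by have := L0 _ H 1; rewrite Lg.
apply: (@span_ind _ _ _ (fun x => forall c, L (c *: x) = 0)) => [|y].
  split; first by apply/asboolP => c; rewrite scaler0; apply: malg_lift0.
  move=> a y z /asboolP Hy /asboolP Hz; apply/asboolP => c.
  by rewrite scalerDr scalerA /L malg_liftD // -/L Hy Hz addr0.
case=> [[u [w ->]]|[a [w ->]]] c.
  rewrite !scalerBr /L !malg_liftD // !malg_liftN // -/L !Lg TDr.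
  by rewrite addrAC addrK subrr.
by rewrite scalerBr /L malg_liftD // malg_liftN // -/L scalerA !Lg Tb subrr.
Qed.

End TensorTheory.

End ExtensionOfScalarsTheory.

(** * Differential operators and the commutant of the Frobenius powers *)

Section DiffOpTheory.
Variables (K : fieldType) (n : nat).
Local Notation P := {mpoly K[n]}.
Local Notation D := (diffop K n).
Implicit Types (a b c : 'X_{1..n}) (f g h : D) (q r : P).

Lemma mulop_is_linear : linear (@mulop K n).
Proof. by move=> c r q; apply: diffopP => s; rewrite /= mulrDl -scalerAl. Qed.
HB.instance Definition _ := GRing.isLinear.Build K P D *:%R (@mulop K n) mulop_is_linear.
Lemma mulop_is_monoid_morphism : monoid_morphism (@mulop K n).
Proof. by split=> // r q; rewrite mulopM. Qed.
HB.instance Definition _ :=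
  GRing.isMonoidMorphism.Build P D (@mulop K n) mulop_is_monoid_morphism.

Lemma diffop_mulE f g q : (f * g) q = f (g q). Proof. by []. Qed.
Lemma diffop_sumE (I : Type) (s : seq I) (Q : pred I) (F : I -> D) q :
  (\sum_(i <- s | Q i) F i) q = \sum_(i <- s | Q i) F i q.
Proof. by elim/big_rec2: _ => // i f r _ <-. Qed.

Lemma mulop_comm q r : mulop q * mulop r = mulop r * mulop q.
Proof. by rewrite -!mulopM mulrC. Qed.

Lemma comm_mulop_eval f r q : f * mulop r = mulop r * f -> f (r * q) = r * f q.
Proof. by move/(congr1 (fun g : D => g q)). Qed.

Lemma ad_divderiv (i : 'I_n) b : ad (mulop 'X_i : D) (divderiv b) =
  if b i == 0%N then 0 else divderiv (b - U_(i)).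
Proof. by rewrite /ad divderiv_comm opprB addrC subrK. Qed.

Lemma iter_ad_divderiv (i : 'I_n) b (c : nat) : iter c (ad (mulop 'X_i : D)) (divderiv b) =
  if (b i < c)%N then 0 else divderiv (b - U_(i) *+ c).
Proof.
elim: c => [|c IH] /=; first by congr divderiv; apply/mnmP => j; rewrite mnmBE mulmnE muln0 subn0.
rewrite IH; case: (ltngtP (b i) c) => [lt|gt|eq].
- by rewrite raddf0 ltnS ltnW.
- rewrite ad_divderiv ltnS leqNgt gt /= mnmBE mulmnE mnm1E eqxx mul1n subn_eq0 leqNgt gt /=.
  by congr divderiv; rewrite submDA; congr (_ - _)%MM; rewrite mulmSr.
- by rewrite ad_divderiv -eq leqnn mnmBE mulmnE mnm1E eqxx mul1n subnn.
Qed.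

Lemma mbin_neq0 a b : mbin a b != 0%N -> (b <= a)%MM.
Proof.
move=> H; apply/mnm_lepP => i; rewrite leqNgt; apply: contra H => lt.
by rewrite /mbin (bigD1 i) //= bin_small // mul0n.
Qed.

Lemma mbinn a : mbin a a = 1%N.
Proof. by rewrite /mbin big1 // => i _; rewrite binn. Qed.

(** [d^[b] x^a] vanishes unless [b <= a], and the degrees then force [a = b]: on monomials, the
    divided powers are unitriangular by degree. *)
Lemma divderiv_top a b : (mdeg a <= mdeg b)%N -> divderiv b 'X_[a] = (a == b)%:R :> P.
Proof.
move=> le; rewrite [LHS]divderivX; have [->|ne] := eqVneq a b.
  rewrite mbinn scale1r -mpolyX0; congr 'X_[_]; apply/mnmP => i; by rewrite !mnmE subnn.
have [->|/mbin_neq0 leba] := eqVneq (mbin a b) 0%N; first by rewrite scale0r.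
case/eqP: ne; have := submK leba => E; rewrite -E.
have : mdeg (a - b)%MM = 0%N by apply/eqP; rewrite -leqn0 -(leq_add2r (mdeg b)) -mdegD E add0n.
by move/eqP; rewrite mdeg_eq0 => /eqP ->; rewrite add0m.
Qed.

Lemma divderiv_1 b : divderiv b (1 : P) = (b == 0%MM)%:R.
Proof.
have := @divderiv_top 0%MM b; rewrite mdeg0 => /(_ isT).
by rewrite mpolyX0 eq_sym.
Qed.

Lemma diffop_poly_ind (T : P -> Prop) : T 1 ->
  (forall (c : K) r q, T r -> T q -> T (c *: r + q)) ->
  (forall i q, T q -> T ('X_i * q)) -> forall q, T q.
Proof.
move=> T1 TP TX q; elim/mpolyind: q => [|c a q _ _ Tq].
  by rewrite -[0](addNr 1) -scaleN1r; apply: TP.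
apply: TP => //; rewrite mpolyXE_id; elim/big_rec: _ => // i r _ Tr.
by elim: (a i) => [|d IHd]; rewrite ?mul1r // exprS -mulrA; apply: TX.
Qed.

(** By induction on the order the commutators with the variables vanish, so [f] is [P_n]-linear, and
    [f 1 = 0]. *)
Lemma order_vanish j f : order_lt j f ->
  (forall a, (mdeg a < j)%N -> f 'X_[a] = 0) -> f = 0.
Proof.
elim: j f => [|j IH] f Hf H0; first by apply: diffopP => q; rewrite Hf.
have adf i : ad (mulop 'X_i) f = 0.
  apply: IH => [|a lta]; first exact: Hf.
  have -> : (ad (mulop 'X_i) f) 'X_[a] = f ('X_i * 'X_[a]) - 'X_i * f 'X_[a] by [].
  by rewrite -mpolyXD !H0 ?mulr0 ?subr0 ?mdegD ?mdeg1 // ltnW.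
have fX i q : f ('X_i * q) = 'X_i * f q.
  by apply: comm_mulop_eval; apply/ad0P; apply: adf.
apply: diffopP => q; rewrite -[RHS]/(0 : P).
elim/diffop_poly_ind: q => [|c r q Hr Hq|i q Hq].
- by rewrite -mpolyX0 H0 ?mdeg0.
- by rewrite diffop_linear Hr Hq scaler0 addr0.
- by rewrite fX Hq mulr0.
Qed.

Lemma order_lt_mulop_divderiv r b : order_lt (mdeg b).+1 (mulop r * divderiv b : D).
Proof. exact: order_ltMl (divderiv_order b). Qed.

(* The coefficients of the Taylor expansion [f = \sum_b r_b d^[b]], restricted
   to [b] in [S], are determined degree by degree. *)
Lemma partial_taylor (W : D -> Prop) (S : pred 'X_{1..n}) t f :
  W 0 -> (forall g h, W g -> W h -> W (g + h)) ->
  (forall r b, S b -> (mdeg b < t)%N -> W (mulop r * divderiv b)) ->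
  exists2 g, W g & forall a, S a -> (mdeg a < t)%N -> (f - g) 'X_[a] = 0.
Proof.
move=> W0 WD; elim: t => [|t IH] Wt; first by exists 0.
have [|g Wg Hg] := IH; first by move=> r b Sb lt; apply: Wt => //; apply: ltnW.
pose I := 'X_{1..n < t.+1}.
(* The correction in degree [t]; by [divderiv_top] it vanishes on the monomials of smaller
   degree. *)
pose u : D := \sum_(b : I | S b && (mdeg b == t)) mulop ((f - g) 'X_[b]) * divderiv b.
have Wu : W u.
  rewrite /u; elim/big_ind: _ => // b /andP[Sb /eqP degb].
  by apply: Wt => //; rewrite degb.
exists (g + u) => [|a Sa]; first exact: WD.
rewrite ltnS => lea.
have -> : (f - (g + u)) 'X_[a] = (f - g) 'X_[a] - u 'X_[a].
  by rewrite opprD addrA.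
rewrite /u diffop_sumE.
have uE b : mdeg b == t -> (mulop ((f - g) 'X_[b]) * divderiv b) 'X_[a] =
    (f - g) 'X_[b] * (a == b)%:R.
  by move=> /eqP degb; rewrite diffop_mulE divderiv_top ?degb.
have [dega|ne] := eqVneq (mdeg a) t; last first.
  rewrite Hg // ?ltn_neqAle ?ne // big1 ?subr0 // => b /andP[_ degb].
  rewrite uE //; case: eqP => [E|_]; last by rewrite mulr0.
  by rewrite E degb in ne.
have lta : (mdeg a < t.+1)%N by rewrite dega.
rewrite (bigD1 (BMultinom lta)); last by rewrite /= Sa dega eqxx.
have -> : (mulop ((f - g) 'X_[BMultinom lta]) * divderiv (BMultinom lta)) 'X_[a] = (f - g) 'X_[a].
  by rewrite (uE a) ?dega // eqxx mulr1.
rewrite big1 => [|b /andP[/andP[_ degb] ne]]; first by rewrite /= addr0 subrr.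
rewrite (uE _ degb); case: eqP => [E|_]; last by rewrite mulr0.
by case/eqP: ne; apply/val_inj.
Qed.

Lemma canonical_filtration_lin i : GRing.submod_closed (fun f : D => `[< canonical_filtration i f >]).
Proof. exact: span_closed. Qed.

Lemma canonical_filtration_leq i j f : (i <= j)%N ->
  canonical_filtration i f -> canonical_filtration j f.
Proof.
move=> leij; apply: (@span_ind _ _ _ (canonical_filtration j)).
  exact: canonical_filtration_lin.
move=> g [a [b [le ->]]]; apply: span_incl; exists a, b; split=> //.
exact: leq_trans leij.
Qed.

Lemma canonical_filtration0 i : canonical_filtration i (0 : D).
Proof. by case: (canonical_filtration_lin i) => /asboolP. Qed.

Lemma canonical_filtrationP i (c : K) f g : canonical_filtration i f ->
  canonical_filtration i g -> canonical_filtration i (c *: f + g).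
Proof.
move=> Hf Hg; case: (canonical_filtration_lin i) => _ H; apply/asboolP.
by apply: H; apply/asboolP.
Qed.

Lemma canonical_filtration_gen i a b : (mdeg a + mdeg b <= i)%N ->
  canonical_filtration i (mulop 'X_[a] * divderiv b : D).
Proof. by move=> le; apply: span_incl; exists a, b. Qed.

Lemma canonical_filtrationZ i (c : K) f : canonical_filtration i f ->
  canonical_filtration i (c *: f).
Proof.
move=> Hf; rewrite -[_ *: _]addr0; apply: canonical_filtrationP => //.
exact: canonical_filtration0.
Qed.

Lemma canonical_filtrationD i f g : canonical_filtration i f ->
  canonical_filtration i g -> canonical_filtration i (f + g).
Proof. by move=> Hf Hg; rewrite -[f]scale1r; apply: canonical_filtrationP. Qed.

Lemma canonical_filtration_ind (L : D -> D) i m : linear L ->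
  (forall a b, (mdeg a + mdeg b <= i)%N ->
     canonical_filtration m (L (mulop 'X_[a] * divderiv b))) ->
  forall f, canonical_filtration i f -> canonical_filtration m (L f).
Proof.
move=> linL H; pose T f := canonical_filtration m (L f).
apply: (@span_ind _ _ _ T) => [|f [a [b [le ->]]]]; last exact: H.
split; last first.
  move=> c f g /asboolP Hf /asboolP Hg; apply/asboolP.
  by rewrite /T linL; apply: canonical_filtrationP.
apply/asboolP; rewrite /T -[0](subrr 0) -scaleN1r addrC linL.
by rewrite scaleN1r addNr; apply: canonical_filtration0.
Qed.

Let lin_mul h : linear (fun f => h * f).
Proof. by move=> c f g; rewrite mulrDr scalerAr. Qed.

Lemma canonical_filtration_mulX i c f : canonical_filtration i f ->
  canonical_filtration (mdeg c + i) (mulop 'X_[c] * f).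
Proof.
move: f; apply: (canonical_filtration_ind (lin_mul _)) => a b le.
rewrite mulrA -mulopM -mpolyXD; apply: canonical_filtration_gen.
by rewrite mdegD -addnA leq_add2l.
Qed.

Lemma canonical_filtration_mulop r i : exists j, forall f, canonical_filtration i f ->
  canonical_filtration j (mulop r * f).
Proof.
exists (msize r + i)%N => f Hf.
have -> : mulop r * f = \sum_(c <- msupp r) r@_c *: (mulop 'X_[c] * f).
  rewrite {1}[r]mpolyE [mulop _]linear_sum mulr_suml; apply: eq_bigr => c _.
  by rewrite scalerAl; congr (_ * _); apply: diffopP => q; rewrite [LHS]/= -scalerAl.
rewrite big_seq; elim/big_ind: _ => [|u v Hu Hv|c cr].
- exact: canonical_filtration0.
- exact: canonical_filtrationD.
apply/canonical_filtrationZ/canonical_filtration_leq/canonical_filtration_mulX/Hf.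
by rewrite leq_add2r ltnW // msize_mdeg_lt.
Qed.

(** The Taylor sum below degree [t] obeys the same bound on the order as [f] and has the same values
    on monomials of degree less than [t]; [order_vanish] identifies them. *)
Lemma canonical_filtration_exhaust f : exists i, canonical_filtration i f.
Proof.
have [t Hf] := diffop_order f.
pose W g := order_lt t g /\ exists i, canonical_filtration i g.
have [||r b _ lt|g [Hg Fg] fg] := @partial_taylor W xpredT t f.
- by split; [apply: order_lt0 | exists 0%N; apply: canonical_filtration0].
- move=> g h [og [i Fg]] [oh [j Fh]]; split; first exact: order_ltD.
  exists (maxn i j); rewrite -[g]scale1r; apply: canonical_filtrationP.
    exact: canonical_filtration_leq (leq_maxl _ _) Fg.
  exact: canonical_filtration_leq (leq_maxr _ _) Fh.
- split; first exact: order_lt_leq lt (order_lt_mulop_divderiv _ _).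
  have [j Hj] := canonical_filtration_mulop r (mdeg b).
  exists j; apply: Hj; apply: span_incl; exists 0%MM, b; split; first by rewrite mdeg0.
  by rewrite mpolyX0 mul1r.
suff -> : f = g by [].
apply/eqP; rewrite -subr_eq0; apply/eqP; apply: (@order_vanish t); last by move=> a; apply: fg.
have := order_ltD Hf (order_ltMl (-1) Hg); apply: eq_order_lt => q.
by rewrite mulN1r.
Qed.

Lemma iter_ad_order j r f : order_lt j f -> iter j (ad (mulop r)) f = 0.
Proof.
elim: j f => [|j IH] f Hf; first by apply: diffopP => q; rewrite Hf.
by rewrite iterSr; apply: IH; apply: Hf.
Qed.

(** Moving one variable to the left past [d^[b]] leaves a commutator in which [a] and [b] are both
    lowered, so the total degree does not grow. *)
Lemma canonical_filtration_divderivX a b c :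
  canonical_filtration (mdeg a + mdeg b + mdeg c) (divderiv b * (mulop 'X_[a] * divderiv c) : D).
Proof.
have [k] := ubnP (mdeg a); elim: k a b => // k IH a b; rewrite ltnS => lek.
have [->|a0] := eqVneq a 0%MM.
  rewrite mpolyX0 mul1r divderivM; apply: canonical_filtrationZ.
  rewrite -[divderiv _]mul1r -[1]/(mulop 1) -mpolyX0.
  by apply: canonical_filtration_gen; rewrite mdegD !mdeg0.
have [l al] : exists l, a l != 0%N.
  apply/existsP; apply: contraNT a0; rewrite negb_exists => /forallP H.
  by apply/eqP/mnmP => l; have := H l; rewrite negbK mnm0E => /eqP.
have Ea : a = (U_(l) + (a - U_(l)))%MM.
  by rewrite addmC submK //; apply/mnm_lepP => s; rewrite mnm1E; case: eqP => // <-; rewrite lt0n.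
have da : mdeg a = (mdeg (a - U_(l))).+1 by rewrite {1}Ea mdegD mdeg1.
set a' := (a - U_(l))%MM in Ea da; rewrite da in lek.
have E : divderiv b * mulop 'X_l = mulop 'X_l * divderiv b + ad (mulop 'X_l : D) (divderiv b).
  by rewrite /ad addrC subrK.
rewrite {2}Ea mpolyXD mulopM -!mulrA mulrA E mulrDl; apply: canonical_filtrationD.
  have -> : (mdeg a + mdeg b + mdeg c = mdeg U_(l) + (mdeg a' + mdeg b + mdeg c))%N.
    by rewrite da mdeg1 !addSn.
  by rewrite -mulrA; apply: canonical_filtration_mulX; apply: IH.
rewrite ad_divderiv; case: ifP => bl; first by rewrite !mul0r; apply: canonical_filtration0.
apply: canonical_filtration_leq (IH _ _ lek).
by rewrite leq_add2r leq_add // ?da // mdegB.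
Qed.

Lemma canonical_filtrationM i j f g : canonical_filtration i f ->
  canonical_filtration j g -> canonical_filtration (i + j) (f * g).
Proof.
move=> + Hg; move: f.
apply: canonical_filtration_ind => [c f h|a b le]; first by rewrite mulrDl scalerAl.
rewrite -mulrA; move: g Hg.
apply: canonical_filtration_ind => [c f h|a' b' le']; first by rewrite !mulrDr !scalerAr.
apply: (@canonical_filtration_leq (mdeg a + (mdeg a' + mdeg b + mdeg b'))); last first.
  exact/canonical_filtration_mulX/canonical_filtration_divderivX.
by rewrite (leq_trans _ (leq_add le le')) // [(mdeg a' + mdeg b)%N]addnC -!addnA.
Qed.

End DiffOpTheory.

(** * The commutant of the Frobenius powers of the variables *)

Section FrobeniusCentralizer.
Variables (K : fieldType) (p : nat) (hp : p \in [pchar K]) (n : nat).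
Variable k : 'I_n -> nat.
Local Notation P := {mpoly K[n]}.
Local Notation D := (diffop K n).
Implicit Types (a b c : 'X_{1..n}) (f g h : D) (q r : P).

Let p_gt0 : (0 < p)%N := prime_gt0 (pcharf_prime hp).

Lemma pchar_diffop : p \in [pchar D].
Proof. exact: (rmorph_pchar (GRing.in_alg D)). Qed.

Definition yvar (i : 'I_n) : D := mulop ('X_i ^+ (p ^ k i)).

(** For [k = insep_exp p m] this is [frob_subst p m] by conversion. The exponents are arbitrary in
    this section because constant ones occur in the classification. *)
Definition psi : P -> P := comp_mpoly [tuple 'X_i ^+ (p ^ k i) | i < n].
HB.instance Definition _ := GRing.RMorphism.copy psi (comp_mpoly [tuple 'X_i ^+ (p ^ k i) | i < n]).
HB.instance Definition _ := GRing.Linear.copy psi (comp_mpoly [tuple 'X_i ^+ (p ^ k i) | i < n]).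

Lemma psiX i : psi 'X_i = 'X_i ^+ (p ^ k i).
Proof. by rewrite /psi comp_mpolyXU -tnth_nth tnth_mktuple. Qed.

Definition dilate a : 'X_{1..n} := [multinom (a i * p ^ k i)%N | i < n].
Definition reduced b := [forall i, (b i < p ^ k i)%N].

Lemma psi_monomial a : psi 'X_[a] = 'X_[dilate a].
Proof.
rewrite /psi comp_mpolyX [RHS]mpolyXE_id; apply: eq_bigr => i _.
by rewrite tnth_mktuple -exprM mnmE mulnC.
Qed.

Lemma mnm_divmod a : a = (dilate [multinom a i %/ p ^ k i | i < n] + [multinom a i %% p ^ k i | i < n])%MM.
Proof. by apply/mnmP => i; rewrite mnmDE !mnmE -divn_eq. Qed.

Lemma reduced_mod a : reduced [multinom a i %% p ^ k i | i < n].
Proof. by apply/forallP => i; rewrite mnmE ltn_pmod // expn_gt0 p_gt0. Qed.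

Definition ycentral f := forall i, f * yvar i = yvar i * f.

Lemma yvarE i : yvar i = (mulop 'X_i : D) ^+ (p ^ k i).
Proof. by rewrite /yvar rmorphXn. Qed.

Lemma ad_yvar i f : ad (yvar i) f = iter (p ^ k i) (ad (mulop 'X_i : D)) f.
Proof. by rewrite yvarE (ad_pchar_pow pchar_diffop). Qed.

Lemma ycentral_mulop q : ycentral (mulop q).
Proof. by move=> i; apply: mulop_comm. Qed.

Lemma ycentral_divderiv b : reduced b -> ycentral (divderiv b).
Proof.
move=> /forallP rb i; apply/ad0P; rewrite ad_yvar iter_ad_divderiv.
by rewrite rb.
Qed.

Lemma ycentralD f g : ycentral f -> ycentral g -> ycentral (f + g).
Proof. by move=> Hf Hg i; rewrite mulrDl mulrDr Hf Hg. Qed.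

Lemma ycentralM f g : ycentral f -> ycentral g -> ycentral (f * g).
Proof. by move=> Hf Hg i; rewrite -mulrA Hg mulrA Hf mulrA. Qed.

Lemma ycentral_psi f q : ycentral f -> f * mulop (psi q) = mulop (psi q) * f.
Proof.
move=> Hf; elim/diffop_poly_ind: q => [|c r q Hr Hq|i q Hq].
- by rewrite rmorph1 mulr1 [mulop 1]rmorph1 mul1r.
- by rewrite !linearP /= mulrDr mulrDl -scalerAr -scalerAl Hr Hq.
- by rewrite rmorphM /= psiX mulopM mulrA Hf -mulrA Hq mulrA.
Qed.

Lemma ycentral_eval f q r : ycentral f -> f (psi q * r) = psi q * f r.
Proof. by move=> Hf; apply/comm_mulop_eval/ycentral_psi. Qed.

Lemma poly_psi_ind (T : P -> Prop) : (forall (c : K) q r, T q -> T r -> T (c *: q + r)) ->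
  (forall q r, T r -> T (psi q * r)) -> (forall b, reduced b -> T 'X_[b]) ->
  forall q, T q.
Proof.
move=> TP Tpsi Tred q; elim/mpolyind: q => [|c a q _ _ Tq].
  have T1 : T 1.
    rewrite -mpolyX0; apply: Tred; apply/forallP => i.
    by rewrite mnm0E expn_gt0 p_gt0.
  by rewrite -[0](addNr 1) -scaleN1r; apply: TP.
apply: TP => //; rewrite [a]mnm_divmod mpolyXD -psi_monomial.
exact/Tpsi/Tred/reduced_mod.
Qed.

Lemma ycentral_ext f g : ycentral f -> ycentral g ->
  (forall b, reduced b -> f 'X_[b] = g 'X_[b]) -> f = g.
Proof.
move=> Hf Hg fg; apply: diffopP; elim/poly_psi_ind => [c q r Hq Hr|q r Hr|b /fg //].
  by rewrite !diffop_linear Hq Hr.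
by rewrite !ycentral_eval // Hr.
Qed.

Local Notation A := (A_span p k : set D).

Lemma A_span_lin (c : K) f g : A f -> A g -> A (c *: f + g).
Proof.
move=> Af Ag; have [_ H] := @span_closed K D (A_gens p k); apply/asboolP.
by apply: H; apply/asboolP.
Qed.

Lemma A_span_divderiv b : reduced b -> A (divderiv b).
Proof.
move=> /forallP rb; apply: span_incl; exists 0%MM, b; split=> //.
by rewrite mpolyX0 mulr1.
Qed.

Lemma A_span0 : A 0.
Proof. by rewrite -[0](addNr 1) -scaleN1r; apply: A_span_lin; apply: A_span1. Qed.

Lemma A_spanD f g : A f -> A g -> A (f + g).
Proof. by move=> Af Ag; rewrite -[f]scale1r; apply: A_span_lin. Qed.

Lemma A_span_sub_ycentral f : A f -> ycentral f.
Proof.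
move: f; apply: span_ind => [|f [a [b [rb ->]]]]; last first.
  by apply: ycentralM; [apply/ycentral_divderiv/forallP | apply: ycentral_mulop].
split; first by apply/asboolP => i; rewrite mul0r mulr0.
move=> c f g /asboolP Hf /asboolP Hg; apply/asboolP; apply: ycentralD => //.
by move=> i; rewrite -scalerAl -scalerAr Hf.
Qed.

Lemma A_span_mulop_divderiv r b : reduced b -> A (mulop r * divderiv b).
Proof. by move=> rb; apply: A_spanM => //; [apply: A_span_mulop|apply: A_span_divderiv]. Qed.

(** The partial Taylor sum over the reduced [b] lies in [A] and agrees with [f] on the reduced
    monomials, which generate [P_n] over [psi(P_n)]; both being [psi(P_n)]-linear, they are equal.
    The bound [t] exceeds the degree of every reduced monomial. *)
Lemma ycentral_taylor_ind (W : D -> Prop) : W 0 -> (forall g h, W g -> W h -> W (g + h)) ->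
  (forall r b, reduced b -> W (mulop r * divderiv b)) -> forall f, ycentral f -> W f.
Proof.
move=> W0 WD Wr f Hf; pose t := (\sum_i p ^ k i).+1.
have [|||g [Wg Ag] Hg] := @partial_taylor _ _ (fun g => W g /\ A g) reduced t f.
- by split=> //; apply: A_span0.
- by move=> g h [Wg Ag] [Wh Ah]; split; [apply: WD | apply: A_spanD].
- by move=> r b rb _; split; [apply: Wr | apply: A_span_mulop_divderiv].
suff -> : f = g by [].
apply: ycentral_ext => //; first exact: A_span_sub_ycentral.
move=> b rb; apply/eqP; rewrite -subr_eq0; apply/eqP.
apply: Hg => //; rewrite ltnS mdegE; apply: leq_sum => i _.
by move/forallP/(_ i): rb; apply: ltnW.
Qed.

Lemma A_span_ycentral f : A f <-> ycentral f.
Proof.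
split; first exact: A_span_sub_ycentral.
move: f; apply: ycentral_taylor_ind; [exact: A_span0 | exact: A_spanD | exact: A_span_mulop_divderiv].
Qed.

(** An operator of order less than [j] is killed by [j] commutators with [x_i], and [j <= p^e] for
    [e >= j]. *)
Lemma ycentral_large f : exists e0, forall e, (e0 <= e)%N -> forall i,
  f * mulop ('X_i ^+ (p ^ e)) = mulop ('X_i ^+ (p ^ e)) * f.
Proof.
have [j Hj] := diffop_order f; exists j => e le i; apply/ad0P.
rewrite rmorphXn (ad_pchar_pow pchar_diffop).
apply: (@iter_ad0 _ _ _ j); last exact: iter_ad_order.
by rewrite (leq_trans le) // ltnW // ltn_expl // prime_gt1 // (pcharf_prime hp).
Qed.

(* Lucas *)
Lemma bin_pow_add e s (r : nat) : (r < p ^ e)%N -> ('C(s * p ^ e + r, r))%:R = 1 :> K.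
Proof.
move=> ltr; have hpX : p \in [pchar {poly K}] by apply: (rmorph_pchar (@polyC K)).
have E m : (1 + 'X : {poly K}) ^+ m = \sum_(l < m.+1) ('C(m, l))%:R *: 'X^l.
  by rewrite exprDn; apply: eq_bigr => l _; rewrite expr1n mul1r scaler_nat.
have Ec m l : ((1 + 'X : {poly K}) ^+ m)`_l = ('C(m, l))%:R.
  rewrite E coef_sum; have [lt|ge] := ltnP l m.+1.
    rewrite (bigD1 (Ordinal lt)) //= coefZ coefXn eqxx mulr1 big1 ?addr0 // => j ne.
    rewrite coefZ coefXn; case: eqP => [El|]; rewrite ?mulr0 //.
    by case/eqP: ne; apply/val_inj.
  rewrite bin_small // big1 // => j _; rewrite coefZ coefXn; case: eqP => [El|]; rewrite ?mulr0 //.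
  by have := ltn_ord j; rewrite -El ltnNge ge.
rewrite -Ec exprD mulnC exprM exprDn_pchar ?expr1n; last first.
  by rewrite pnatX (pnatE _ (pcharf_prime hp)) hpX.
have [u ->] : exists u, (1 + 'X^(p ^ e) : {poly K}) ^+ s = 1 + u * 'X^(p ^ e).
  elim: (s) => [|s' [u IHu]]; first by exists 0; rewrite mul0r addr0.
  exists (1 + u + u * 'X^(p ^ e)); rewrite exprS IHu mulrDl mul1r mulrDr mulr1 -addrA; congr (_ + _).
  by rewrite !mulrDl mul1r [LHS]addrCA ['X^_ * (u * _)]mulrC -!addrA.
by rewrite mulrDl mul1r coefD mulrAC coefMXn ltr addr0 Ec binn.
Qed.

Definition ldiv a : D := divderiv (dilate a).

(** No carry occurs between the digits, so the binomial coefficient is 1. *)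
Lemma divderiv_ldiv a b : reduced b -> divderiv (dilate a + b) = ldiv a * divderiv b.
Proof.
move=> /forallP rb; rewrite divderivM (_ : (mbin _ _)%:R = 1) ?scale1r //.
rewrite /mbin natr_prod big1 // => i _; rewrite mnmDE mnmE.
by rewrite -bin_sub ?leq_addr // addKn bin_pow_add.
Qed.

Lemma ldiv0 : ldiv 0 = 1.
Proof. by rewrite -divderiv0; congr divderiv; apply/mnmP => i; rewrite mnmE !mnm0E. Qed.

(** With respect to the [y_i] the [ldiv a] behave as the divided powers do with respect to the
    [x_i]. *)
Lemma ad_yvar_ldiv i a : ad (yvar i) (ldiv a) = if a i == 0%N then 0 else ldiv (a - U_(i)).
Proof.
rewrite ad_yvar iter_ad_divderiv mnmE.
case: (posnP (a i)) => [->|a0]; first by rewrite mul0n expn_gt0 p_gt0.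
rewrite ltnNge leq_pmull //=; congr divderiv; apply/mnmP => j.
rewrite mnmBE mulmnE !mnmE mulnBl; case: eqP => [->|_]; by rewrite ?mul1n ?mul0n ?subn0.
Qed.

(** The spanning half of [D(P_n) = Lambda(m) (x) A(m)]; [Q] keeps track of the indices for the
    filtration. *)
Definition ldiv_sum (Q : pred 'X_{1..n}) f := exists s : seq ('X_{1..n} * D),
  (forall x, x \in s -> Q x.1 /\ A x.2) /\ f = \sum_(x <- s) ldiv x.1 * x.2.

Lemma ldiv_sumD Q f g : ldiv_sum Q f -> ldiv_sum Q g -> ldiv_sum Q (f + g).
Proof.
move=> [s [Hs ->]] [t [Ht ->]]; exists (s ++ t); rewrite big_cat; split=> // x.
by rewrite mem_cat => /orP[/Hs|/Ht].
Qed.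

Lemma ldiv_sum0 Q : ldiv_sum Q 0.
Proof. by exists [::]; rewrite big_nil. Qed.

Lemma ldiv_sum1 (Q : pred 'X_{1..n}) a f : Q a -> A f -> ldiv_sum Q (ldiv a * f).
Proof. by move=> Qa Af; exists [:: (a, f)]; rewrite big_seq1; split=> // x; rewrite inE => /eqP ->. Qed.

Lemma ldiv_sum_lin Q (c : K) f g : ldiv_sum Q f -> ldiv_sum Q g -> ldiv_sum Q (c *: f + g).
Proof.
move=> [s [Hs ->]] Hg; apply: ldiv_sumD => //.
exists [seq (x.1, c *: x.2) | x <- s]; split.
  move=> _ /mapP[x /Hs[Qx Ax] ->]; split=> //=; rewrite -[_ *: _]addr0.
  apply: A_span_lin => //; rewrite -[0](addNr 1) -scaleN1r; apply: A_span_lin; exact: A_span1.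
by rewrite big_map scaler_sumr; apply: eq_bigr => x _ /=; rewrite scalerAr.
Qed.

(** The commutator with [x_i] produces the divided power of exponent [dilate a - U_(i)]. Borrowing a
    digit, this is [ldiv (a - U_(i))] times the reduced divided power of order [p^(k_i) - 1] in
    [x_i]. *)
Lemma ldiv_sum_mulX (Q : pred 'X_{1..n}) i f :
  (forall a, Q a -> Q (a - U_(i))%MM) ->
  ldiv_sum Q f -> ldiv_sum Q (mulop 'X_i * f).
Proof.
move=> Qd [s [Hs ->]]; rewrite mulr_sumr big_seq; elim/big_ind: _ => [|u v|[a g] /Hs /= [Qa Ag]].
- exact: ldiv_sum0.
- exact: ldiv_sumD.
rewrite mulrA divderiv_comm mulrBl -mulrA.
rewrite addrC -scaleN1r; apply: ldiv_sum_lin; last first.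
  by apply: ldiv_sum1 => //; apply: A_spanM => //; apply: A_span_mulop.
rewrite mnmE muln_eq0 [(p ^ _ == 0)%N]gtn_eqF ?expn_gt0 ?p_gt0 // orbF.
case: (posnP (a i)) => [_|a0]; first by rewrite mul0r; apply: ldiv_sum0.
pose b : 'X_{1..n} := (U_(i) *+ (p ^ k i).-1)%MM.
have q0 : (0 < p ^ k i)%N by rewrite expn_gt0 p_gt0.
have rb : reduced b.
  apply/forallP => j; rewrite mulmnE mnm1E; case: eqP => [<-|_].
    by rewrite mul1n prednK.
  by rewrite mul0n expn_gt0 p_gt0.
have -> : (dilate a - U_(i) = dilate (a - U_(i)) + b)%MM.
  apply/mnmP => j; rewrite !(mnmBE, mnmDE, mulmnE, mnm1E, mnmE); case: eqP => [<-|_]; last first.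
    by rewrite mul0n addn0 !subn0.
  rewrite mul1n mulnBl mul1n -subn1 addnBA // subnK //.
  by rewrite leq_pmull.
rewrite divderiv_ldiv // -mulrA; apply: ldiv_sum1; first exact: Qd.
by apply: A_spanM => //; apply: A_span_divderiv.
Qed.

(** The index of [d^[b]] consists of the quotients of the [b_j] by [p^(k_j)], and left
    multiplication by a variable can only lower indices. *)
Lemma canonical_filtration_ldiv_sum i f : canonical_filtration i f ->
  ldiv_sum (fun a => (\sum_j a j * p ^ k j <= i)%N) f.
Proof.
pose Q a := (\sum_j a j * p ^ k j <= i)%N.
move: f; apply: span_ind => [|f [a [b [le ->]]]].
  split; first by apply/asboolP; apply: ldiv_sum0.
  by move=> c f g /asboolP Hf /asboolP Hg; apply/asboolP; apply: ldiv_sum_lin.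
rewrite mpolyXE_id; elim/big_rec: _ => [|j r _].
  rewrite mul1r [b]mnm_divmod divderiv_ldiv ?reduced_mod //.
  apply: ldiv_sum1; last exact/A_span_divderiv/reduced_mod.
  apply: leq_trans (leq_trans (leq_addl _ _) le); rewrite mdegE; apply: leq_sum => j _.
  by rewrite mnmE leq_divM.
elim: (a j) => [|d IHd] Hr; first by rewrite mul1r.
rewrite exprS -mulrA mulopM -mulrA; apply: ldiv_sum_mulX (IHd Hr) => c Qc.
apply: leq_trans Qc; apply: leq_sum => l _; rewrite leq_mul2r mnmBE leq_subr.
by rewrite orbT.
Qed.

Lemma diffop_ldiv_sum f : ldiv_sum predT f.
Proof.
have [i /canonical_filtration_ldiv_sum[s [Hs ->]]] := canonical_filtration_exhaust f.
by exists s; split=> // x /Hs[].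
Qed.


Lemma iter_ad_yvar i (c : nat) f : iter c (ad (yvar i)) f = iter (c * p ^ k i) (ad (mulop 'X_i : D)) f.
Proof. by elim: c => // c IH; rewrite mulSn iterD iterS -IH ad_yvar. Qed.

Lemma iter_ad_yvar_order i j f : order_lt j f -> iter j (ad (yvar i)) f = 0.
Proof.
move=> Hj; rewrite iter_ad_yvar; apply: iter_ad0 (iter_ad_order _ Hj).
by rewrite leq_pmulr // expn_gt0 p_gt0.
Qed.

(** The formula [g(0) = sum_c (-1)^c (x^c/c!) g^(c)(x)], with [ad (yvar i)] as the derivative and
    [ldiv (U_(i) *+ c)] as [x^c/c!]. The sum may stop at the order of [f], where the iterated
    commutators vanish. *)
Definition proj1 i f : D := \sum_(0 <= c < projT1 (cid (diffop_order f)))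
  (-1) ^+ c * (ldiv (U_(i) *+ c) * iter c (ad (yvar i)) f).

Lemma proj1E i f C : iter C (ad (yvar i)) f = 0 -> proj1 i f =
  \sum_(0 <= c < C) (-1) ^+ c * (ldiv (U_(i) *+ c) * iter c (ad (yvar i)) f).
Proof.
have aux C1 C2 : (C1 <= C2)%N -> iter C1 (ad (yvar i)) f = 0 ->
    \sum_(0 <= c < C2) (-1) ^+ c * (ldiv (U_(i) *+ c) * iter c (ad (yvar i)) f) =
    \sum_(0 <= c < C1) (-1) ^+ c * (ldiv (U_(i) *+ c) * iter c (ad (yvar i)) f).
  move=> le H; rewrite (@big_cat_nat _ _ _ C1) //= [X in _ + X]big_nat_cond [X in _ + X]big1 ?addr0 // => c.
  by rewrite andbT => /andP[le1 _]; rewrite (iter_ad0 le1 H) !mulr0.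
move=> HC; rewrite /proj1; case: cid => j Hj /=.
have H := iter_ad_yvar_order i Hj.
by rewrite -(aux _ _ (leq_maxl j C) H) (aux _ _ (leq_maxr j C) HC).
Qed.

Lemma proj1_ad i f : ad (yvar i) (proj1 i f) = 0.
Proof.
have [j Hj] := diffop_order f; have H := iter_ad_yvar_order i Hj.
rewrite (@proj1E _ _ j.+1) ?iterS ?H ?raddf0 //.
(* The derivative of a partial sum telescopes to its last term. *)
have -> C : ad (yvar i) (\sum_(0 <= c < C.+1) (-1) ^+ c * (ldiv (U_(i) *+ c) * iter c (ad (yvar i)) f))
    = (-1) ^+ C * (ldiv (U_(i) *+ C) * iter C.+1 (ad (yvar i)) f); last by rewrite iterS H raddf0 !mulr0.
have adN1 (c : nat) g : ad (yvar i) ((-1) ^+ c * g) = (-1) ^+ c * ad (yvar i) g.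
  rewrite adM (_ : ad (yvar i) ((-1) ^+ c) = 0) ?mul0r ?add0r //.
  by apply/ad0P; rewrite commr_sign.
elim: C => [|C IH]; first by rewrite big_nat1 adN1 mulm0n ldiv0 !mul1r.
rewrite big_nat_recr //= raddfD /= IH adN1 adM ad_yvar_ldiv.
rewrite mulmnE mnm1E eqxx mul1n /=.
have -> : (U_(i) *+ C.+1 - U_(i) = U_(i) *+ C :> 'X_{1..n})%MM by rewrite mulmS addmC addmK.
move: (ad (yvar i) (ad (yvar i) (iter C (ad (yvar i)) f))) => u.
move: (ad (yvar i) (iter C (ad (yvar i)) f)) => v.
by rewrite exprS mulN1r !mulNr mulrDr opprD addrA subrr add0r.
Qed.

Lemma proj1_ad_other i j f : i != j -> ad (yvar j) f = 0 -> ad (yvar j) (proj1 i f) = 0.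
Proof.
move=> ne /ad0P Hf; apply/ad0P.
have H (c : nat) : iter c (ad (yvar i)) f * yvar j = yvar j * iter c (ad (yvar i)) f.
  by rewrite -iter_adMr -?iter_adMl ?Hf //; apply: mulop_comm.
rewrite /proj1 mulr_suml mulr_sumr; apply: eq_bigr => c _.
apply/esym/commrM; first exact: commr_sign.
apply: commrM; last exact/esym/H.
by apply/esym/ad0P; rewrite ad_yvar_ldiv mulmnE mnm1E (negPf ne) mul0n.
Qed.

Lemma proj1Mr i f g : g * yvar i = yvar i * g -> proj1 i (f * g) = proj1 i f * g.
Proof.
move=> Hg; have [j Hj] := diffop_order f; have H := iter_ad_yvar_order i Hj.
rewrite (@proj1E _ f j) // (@proj1E _ _ j); last by rewrite iter_adMr // H mul0r.
by rewrite mulr_suml; apply: eq_bigr => c _; rewrite iter_adMr // !mulrA.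
Qed.

Lemma proj1D i f g : proj1 i (f + g) = proj1 i f + proj1 i g.
Proof.
have [j Hj] := diffop_order f; have [j' Hj'] := diffop_order g.
have H := iter_ad0 (leq_maxl j j') (iter_ad_yvar_order i Hj).
have H' := iter_ad0 (leq_maxr j j') (iter_ad_yvar_order i Hj').
rewrite (@proj1E _ f (maxn j j')) // (@proj1E _ g (maxn j j')) // (@proj1E _ _ (maxn j j')).
  by rewrite -big_split; apply: eq_bigr => c _; rewrite iter_adD !mulrDr.
by rewrite iter_adD H H' addr0.
Qed.

Lemma proj1_id i f : ad (yvar i) f = 0 -> proj1 i f = f.
Proof.
by move=> H; rewrite (@proj1E _ f 1) // big_nat1 mulm0n ldiv0 !mul1r.
Qed.

Definition proj f := foldr proj1 f (enum 'I_n).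

Lemma projD f g : proj (f + g) = proj f + proj g.
Proof. by rewrite /proj; elim: (enum _) => //= i s ->; rewrite proj1D. Qed.

Lemma proj_ycentral f : ycentral (proj f).
Proof.
have H s i : i \in s -> ad (yvar i) (foldr proj1 f s) = 0.
  elim: s => //= j s IH; rewrite inE; have [->|ne] := eqVneq i j.
    by rewrite proj1_ad.
  by move=> /IH; apply: proj1_ad_other; rewrite eq_sym.
by move=> i; apply/ad0P; apply: H; rewrite mem_enum.
Qed.

(** With [proj_id] this makes [proj] a retraction of right modules over the commutant. Both the
    injection of [V(m)] into [U(m)] and the simplicity over a commutant in the classification rest
    on it. *)
Lemma projMr f g : ycentral g -> proj (f * g) = proj f * g.
Proof. by move=> Hg; rewrite /proj; elim: (enum _) => //= i s ->; rewrite proj1Mr. Qed.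

Lemma proj_id f : ycentral f -> proj f = f.
Proof.
move=> Hf; rewrite /proj; elim: (enum _) => //= i s ->; rewrite proj1_id //.
exact/ad0P.
Qed.

Lemma pow_psi M q : (forall i, (k i <= M)%N) -> exists q', q ^+ (p ^ M) = psi q'.
Proof.
move=> leM; have hpP : p \in [pchar P] by apply: (rmorph_pchar (@mpolyC n K)).
elim/diffop_poly_ind: q => [|c r q [r' Hr] [q' Hq]|i q [q' Hq]].
- by exists 1; rewrite expr1n rmorph1.
- exists (c ^+ (p ^ M) *: r' + q'); rewrite exprDn_pchar; last first.
    by rewrite pnatX (pnatE _ (pcharf_prime hp)) hpP.
  by rewrite exprZn Hr Hq linearP.
- exists ('X_i ^+ (p ^ (M - k i)) * q'); rewrite rmorphM rmorphXn /= psiX exprMn Hq.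
  by rewrite -exprM -expnD subnKC.
Qed.

End FrobeniusCentralizer.

(** * Modules over the commutant and their flat vectors *)

Section CentralizerModule.
Variables (K : fieldType) (p : nat) (hp : p \in [pchar K]) (n : nat).
Variable k : 'I_n -> nat.
Local Notation P := {mpoly K[n]}.
Local Notation D := (diffop K n).
Local Notation AA := (subA hp k).
Local Notation A := (A_span p k : set D).
Variable V : lmodType AA.
Implicit Types (a b c : 'X_{1..n}) (f g h : D) (q r : P) (u v w : V).

(* The action of [f], or [0] when [f] is not in [A]. *)
Definition act f v : V := (insubd (0 : AA) f) *: v.

Lemma val_insubdA f : A f -> val (insubd (0 : AA) f) = f.
Proof. by move=> Af; rewrite insubdK //; apply/asboolP. Qed.

Lemma valA (a : AA) : A (val a).
Proof. exact/asboolP/(valP a). Qed.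

Lemma act_val (a : AA) v : a *: v = act (val a) v.
Proof. by rewrite /act valKd. Qed.

Lemma actM f g v : A f -> A g -> act (f * g) v = act f (act g v).
Proof.
move=> Af Ag; rewrite /act scalerA; congr (_ *: _); apply: val_inj.
by rewrite val_insubdA ?rmorphM /= ?val_insubdA //; apply: A_spanM.
Qed.

Lemma actDl f g v : A f -> A g -> act (f + g) v = act f v + act g v.
Proof.
move=> Af Ag; rewrite /act -scalerDl; congr (_ *: _); apply: val_inj.
by rewrite val_insubdA ?rmorphD /= ?val_insubdA //; apply: A_spanD.
Qed.

Lemma act1 v : act 1 v = v.
Proof.
rewrite -[RHS]scale1r /act; congr (_ *: _); apply: val_inj.
by rewrite val_insubdA //; apply: A_span1.
Qed.

Lemma actDr f u v : act f (u + v) = act f u + act f v.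
Proof. exact: scalerDr. Qed.

Lemma act_is_zmod_morphism f : zmod_morphism (act f).
Proof. by move=> u v; apply: scalerBr. Qed.
HB.instance Definition _ f := GRing.isZmodMorphism.Build V V (act f) (act_is_zmod_morphism f).

Lemma act0r f : act f 0 = 0. Proof. exact: scaler0. Qed.

Lemma act0l v : act 0 v = 0.
Proof. by apply: (addrI (act 0 v)); rewrite -actDl ?addr0 //; apply: A_span0. Qed.

Lemma actNl f v : A f -> act (- f) v = - act f v.
Proof.
move=> Af; apply: (addrI (act f v)); rewrite -actDl ?subrr ?act0l //.
by rewrite -scaleN1r -[_ *: f]addr0; apply: A_span_lin => //; apply: A_span0.
Qed.

Definition pmul q v := act (mulop q) v.

Lemma pmulA q r v : pmul (q * r) v = pmul q (pmul r v).
Proof. by rewrite /pmul mulopM actM //; apply: A_span_mulop. Qed.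
Lemma pmulDl q r v : pmul (q + r) v = pmul q v + pmul r v.
Proof. by rewrite /pmul raddfD actDl //; apply: A_span_mulop. Qed.
Lemma pmul1 v : pmul 1 v = v. Proof. exact: act1. Qed.
Lemma pmul0 v : pmul 0 v = 0. Proof. by rewrite /pmul [mulop 0]raddf0 act0l. Qed.
Lemma pmulBl q r v : pmul (q - r) v = pmul q v - pmul r v.
Proof.
rewrite /pmul raddfB actDl ?actNl //; do ?apply: A_span_mulop => //.
by rewrite -raddfN; apply: A_span_mulop.
Qed.
Lemma pmulDr q u v : pmul q (u + v) = pmul q u + pmul q v. Proof. exact: actDr. Qed.
Lemma pmulr0 q : pmul q 0 = 0. Proof. exact: act0r. Qed.

Lemma A_poly_act q v : A_poly hp k q *: v = pmul q v.
Proof. exact: act_val. Qed.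

Lemma act_psi f q v : A f -> act f (pmul (psi p k q) v) = pmul (psi p k q) (act f v).
Proof.
move=> Af; rewrite /pmul -!actM //; do ?apply: A_span_mulop => //.
by rewrite ycentral_psi //; apply/(A_span_ycentral hp).
Qed.

(* [w] generates a quotient of the [A]-module [P_n]. *)
Definition flat w := forall b, reduced p k b -> b != 0%MM -> act (divderiv b) w = 0.

(** A carry in the sum of two reduced exponents makes the binomial coefficient vanish. *)
Lemma divderivM_reduced b c : reduced p k b -> reduced p k c ->
  reduced p k (b + c) \/ divderiv c * divderiv b = 0 :> D.
Proof.
move=> /forallP rb /forallP rc; case: (boolP (reduced p k (b + c))); first by left.
rewrite negb_forall => /existsP[i]; rewrite -leqNgt mnmDE => le; right.
rewrite divderivM /mbin (bigD1 i) //= natrM mnmDE (bin_pchar hp (k := k i)) //.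
  by rewrite mul0r scale0r.
by rewrite addnC.
Qed.

(** Among the reduced [b] with [d^[b] u != 0] take one of maximal degree: a further [d^[c]] yields a
    multiple of [d^[b+c] u], or zero because of a carry. *)
Lemma flat_exists u : u != 0 -> exists b, [/\ reduced p k b, act (divderiv b) u != 0 &
  flat (act (divderiv b) u)].
Proof.
move=> u0; pose Q t := `[< exists b, [/\ reduced p k b, act (divderiv b) u != 0 & mdeg b = t] >].
have Q0 : exists t, Q t.
  exists 0%N; apply/asboolP; exists 0%MM; rewrite divderiv0 act1 mdeg0; split=> //.
  by apply/forallP => i; rewrite mnm0E expn_gt0 prime_gt0 // (pcharf_prime hp).
have Qb t : Q t -> (t <= \sum_i p ^ k i)%N.
  move=> /asboolP[b [/forallP rb _ <-]]; rewrite mdegE; apply: leq_sum => i _.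
  exact: ltnW.
case: (ex_maxnP Q0 Qb) => t /asboolP[b [rb bu degb]] tmax.
exists b; split=> // c rc c0; rewrite -actM; do ?exact: A_span_divderiv.
have [rbc|->] := divderivM_reduced rb rc; last exact: act0l.
rewrite divderivM; apply/eqP/negPn/negP => H.
have H2 : act (divderiv (c + b)) u != 0.
  apply: contraNneq H => E; set z := _%:R.
  have -> : z *: divderiv (c + b) = mulop z%:MP * divderiv (c + b) :> D.
    by apply: diffopP => q; rewrite [RHS]/= mul_mpolyC.
  rewrite actM ?E ?act0r //; first exact: A_span_mulop.
  by apply: A_span_divderiv; rewrite addmC.
have : Q (mdeg (b + c)%MM) by apply/asboolP; exists (b + c)%MM; split; rewrite // addmC.
move=> /tmax; rewrite mdegD degb -{2}[t]addn0 leq_add2l leqn0 mdeg_eq0.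
by rewrite (negPf c0).
Qed.

(** In an expansion [f = sum_b r_b d^[b]] only [b = 0] contributes, to the action on a flat [w] as
    to the value at 1. *)
Lemma flat_act w f : flat w -> A f -> act f w = pmul (f 1) w.
Proof.
move=> fw Af; have /(A_span_ycentral hp) Yf := Af; move: f Yf {Af}.
pose W f := A f /\ act f w = pmul (f 1) w.
suff : forall f, ycentral p k f -> W f by move=> H f /H[].
apply: (ycentral_taylor_ind hp).
- by split; [apply: A_span0 | rewrite act0l pmul0].
- move=> g h [Ag Hg] [Ah Hh]; split; first exact: A_spanD.
  by rewrite actDl // Hg Hh -pmulDl.
- move=> r b rb; split; first exact: A_span_mulop_divderiv.
  rewrite actM; [|exact: A_span_mulop|exact: A_span_divderiv].
  rewrite diffop_mulE divderiv_1; have [->|b0] := eqVneq b 0%MM.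
    by rewrite divderiv0 act1 /= mulr1.
  by rewrite fw // act0r /= mulr0 pmul0.
Qed.

Lemma flat_eval w f q : flat w -> A f -> act f (pmul q w) = pmul (f q) w.
Proof.
move=> fw Af; rewrite /pmul -actM //; last exact: A_span_mulop.
rewrite flat_act //; last by apply: A_spanM => //; apply: A_span_mulop.
by rewrite diffop_mulE /= mulr1.
Qed.

Section Simple.
Hypothesis simV : simple_mod V.

Lemma simple_stable (T : V -> Prop) : T 0 -> (forall u v, T u -> T v -> T (u + v)) ->
  (forall f v, A f -> T v -> T (act f v)) -> (forall v, T v -> v = 0) \/ (forall v, T v).
Proof.
move=> T0 TD TA; have [_ H] := simV.
have [|H0|H1] := H (fun v => `[< T v >]).
- split; first exact/asboolP.
  move=> a u v /asboolP Tu /asboolP Tv; apply/asboolP; apply: TD => //.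
  by rewrite act_val; apply: TA => //; apply: valA.
- by left=> v Tv; apply: H0; apply/asboolP.
- by right=> v; apply/asboolP/H1.
Qed.

Lemma simple_flat_gen w : w != 0 -> flat w -> forall v, exists q, v = pmul q w.
Proof.
move=> w0 fw; have [|||H|//] := @simple_stable (fun v => exists q, v = pmul q w).
- by exists 0; rewrite pmul0.
- by move=> _ _ [q ->] [r ->]; exists (q + r); rewrite pmulDl.
- by move=> f _ Af [q ->]; exists (f q); rewrite flat_eval.
- by case/eqP: w0; apply: H; exists 1; rewrite pmul1.
Qed.

End Simple.

End CentralizerModule.

(** * Maximal ideals *)

Section MaximalIdeal.
Variables (K : fieldType) (p : nat) (hp : p \in [pchar K]) (n : nat).
Variable m : maxSpec K n.
Local Notation P := {mpoly K[n]}.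
Local Notation D := (diffop K n).
Local Notation M := (in_max m).
Implicit Types (q r s : P).

Let idm := (maxSpecP m).1.

Lemma in_max0 : M 0. Proof. by case: idm. Qed.
Lemma in_max1 : ~~ M 1. Proof. by case: idm. Qed.
Lemma in_maxMD a q r : M q -> M r -> M (a * q + r). Proof. by case: idm => _ _; apply. Qed.
Lemma in_maxD q r : M q -> M r -> M (q + r).
Proof. by move=> Hq Hr; rewrite -[q]mul1r; apply: in_maxMD. Qed.
Lemma in_maxM a q : M q -> M (a * q).
Proof. by move=> Hq; rewrite -[_ * _]addr0; apply: in_maxMD => //; apply: in_max0. Qed.
Lemma in_maxMr a q : M q -> M (q * a). Proof. by rewrite mulrC; apply: in_maxM. Qed.
Lemma in_maxN q : M q -> M (- q). Proof. by rewrite -mulN1r; apply: in_maxM. Qed.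
Lemma in_maxB q r : M q -> M r -> M (q - r).
Proof. by move=> Hq Hr; apply: in_maxD => //; apply: in_maxN. Qed.
Lemma in_maxZ (c : K) q : M q -> M (c *: q).
Proof. by rewrite -mul_mpolyC; apply: in_maxM. Qed.
Lemma in_max_sub q r : M (q - r) -> M q = M r.
Proof.
move=> H; apply/idP/idP => [Hq|Hr]; last by rewrite -(subrK r q); apply: in_maxD.
by rewrite -(subKr q r); apply: in_maxB.
Qed.

Lemma max_unit r : ~~ M r -> exists s, M (s * r - 1).
Proof.
move=> nr; apply: contrapT => nex.
pose J : {pred P} := fun x => `[< exists a, M (x - a * r) >].
have idJ : idealr_closed J.
  split.
  - by apply/asboolP; exists 0; rewrite mul0r subrr; apply: in_max0.
  - apply/asboolP => -[a Ha]; apply: nex; exists a.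
    by rewrite -opprB; apply: in_maxN.
  move=> a u v /asboolP[b Hb] /asboolP[c Hc]; apply/asboolP; exists (a * b + c).
  have -> : a * u + v - (a * b + c) * r = a * (u - b * r) + (v - c * r).
    by rewrite mulrBr mulrDl opprD addrACA mulrA.
  exact: in_maxMD.
have mJ : {subset max_pred m <= J}.
  by move=> x xm; apply/asboolP; exists 0; rewrite mul0r subr0.
have := (maxSpecP m).2 J idJ mJ r.
have -> : r \in J by apply/asboolP; exists 1; rewrite mul1r subrr; apply: in_max0.
by move=> /(_ isT); apply/negP.
Qed.

Lemma max_prime q r : M (q * r) -> M q \/ M r.
Proof.
move=> H; have [|nq] := boolP (M q); [by left | right].
have [s Hs] := max_unit nq.
rewrite -(@in_max_sub (s * q * r)); first by rewrite -mulrA; apply: in_maxM.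
by rewrite -[X in _ - X]mul1r -mulrBl; apply: in_maxMr.
Qed.

Definition res q : residue m := \pi_(Quotient.quot (max_pred m : idealr P))%qT q.

Lemma res_is_zmod_morphism : zmod_morphism res.
Proof. by move=> q r; rewrite /res [LHS]rmorphB. Qed.
HB.instance Definition _ := GRing.isZmodMorphism.Build P (residue m) res res_is_zmod_morphism.
Lemma res_is_monoid_morphism : monoid_morphism res.
Proof. by split=> [|q r]; rewrite /res ?[LHS]rmorph1 ?[LHS]rmorphM. Qed.
HB.instance Definition _ := GRing.isMonoidMorphism.Build P (residue m) res res_is_monoid_morphism.

Lemma res_eq0 q : res q = 0 <-> M q.
Proof.
have -> : 0 = res 0 by rewrite rmorph0.
rewrite /res; split=> [/eqP|H]; last apply/eqP.
  by rewrite -Quotient.idealrBE subr0.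
by rewrite -Quotient.idealrBE subr0.
Qed.

Lemma res_surj (x : residue m) : exists q, x = res q.
Proof. by exists (repr x); rewrite /res reprK. Qed.

Lemma res_const c : residue_const m c = res c%:MP. Proof. by []. Qed.

Lemma resZ c q : res (c *: q) = residue_const m c * res q.
Proof. by rewrite res_const -rmorphM mul_mpolyC. Qed.

Lemma poly_in_monomial (i : 'I_n) (q : {poly K}) : poly_in i q = \sum_(j < size q) q`_j *: 'X_i ^+ j.
Proof.
rewrite /poly_in /horner_alg /= /horner_morph horner_coef size_map_poly.
by apply: eq_bigr => j _; rewrite coef_map /= mulr_algl.
Qed.

HB.instance Definition _ i := GRing.RMorphism.copy (@poly_in K n i) (horner_alg ('X_i : P)).
HB.instance Definition _ i := GRing.Linear.copy (@poly_in K n i) (horner_alg ('X_i : P)).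

Lemma poly_inC i c : poly_in i c%:P = c%:MP :> P.
Proof. by rewrite /poly_in horner_algC alg_mpolyC. Qed.

Lemma poly_inX i : poly_in i 'X = 'X_i :> P.
Proof. by rewrite /poly_in [LHS]horner_algX. Qed.

(** If the trace of [m] on [K[x_i]] were zero, this ring would embed in the field [P_n/m], which is
    finitely generated over it: Zariski's lemma excludes that. *)
Lemma poly_in_max_neq0 i : exists2 q : {poly K}, q != 0 & M (poly_in i q).
Proof.
apply: contrapT => nex.
have inv_ex (x : residue m) : exists y, x != 0 -> y * x = 1.
  have [q ->] := res_surj x; have [Hq|nq] := boolP (M q).
    by exists 0; have /res_eq0 -> := Hq; rewrite eqxx.
  have [s Hs] := max_unit nq; exists (res s) => _.
  by apply/eqP; rewrite -subr_eq0 -rmorphM -(rmorph1 res) -rmorphB; apply/eqP/res_eq0.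
have /choice[inv' Hinv] := inv_ex.
pose inv x := if x == 0 then 0 else inv' x.
have mulVx x : x != 0 -> inv x * x = 1 by move=> x0; rewrite /inv (negPf x0) Hinv.
have inv0 : inv 0 = 0 by rewrite /inv eqxx.
pose F : fieldType := HB.pack (residue m)
  (GRing.ComNzRing_isField.Build (residue m) mulVx inv0).
pose phi0 (q : {poly K}) : F := res (poly_in i q).
have zphi : zmod_morphism phi0 by move=> q r; rewrite /phi0 !rmorphB.
have mphi : monoid_morphism phi0.
  by split=> [|q r]; rewrite /phi0 ?rmorph1 ?rmorphM.
pose phi : {rmorphism {poly K} -> F} := HB.pack phi0
  (GRing.isZmodMorphism.Build _ _ phi0 zphi) (GRing.isMonoidMorphism.Build _ _ phi0 mphi).
apply: (@not_jac_local_field_subring {poly K} F phi [seq (res 'X_j : F) | j <- enum 'I_n]).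
- exact: not_jac_local_poly.
- move=> q r E; apply/eqP; rewrite -subr_eq0; apply/eqP; apply: contrapT => /eqP nz.
  apply: nex; exists (q - r) => //; apply/res_eq0; rewrite !rmorphB /=.
  by apply/eqP; rewrite subr_eq0; apply/eqP; exact: E.
move=> S [S1 SB SM] Sphi SX x; have [q ->] := res_surj x.
have S0 : (0 : F) \in S by rewrite -(subrr 1); apply: SB.
have SN (y : F) : y \in S -> - y \in S by move=> yS; rewrite -sub0r; apply: SB.
elim/diffop_poly_ind: q => [|c r q Sr Sq|j q Sq].
- by rewrite rmorph1.
- rewrite rmorphD /= resZ -[X in _ + X]opprK; apply: SB; last exact: SN.
  apply: SM => //; have := Sphi c%:P.
  by rewrite /= /phi0 poly_inC.
- by rewrite rmorphM /=; apply: SM => //; apply: SX; apply: map_f; rewrite mem_enum.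
Qed.

Lemma gen_poly_spec i : [/\ gen_poly m i \is monic, irreducible_poly (gen_poly m i)
  & forall q : {poly K}, (gen_poly m i %| q) = M (poly_in i q)].
Proof.
suff [g Hg] : exists g : {poly K}, [/\ g \is monic, irreducible_poly g
    & forall q : {poly K}, (g %| q) = in_max m (poly_in i q)].
  by rewrite /gen_poly; case: xgetP => [x _ //|/(_ g)].
apply: prime_poly_gen => [q r|c q|q r||]; last exact: poly_in_max_neq0.
- by rewrite rmorphB; apply: in_maxB.
- by rewrite rmorphM; apply: in_maxM.
- by rewrite rmorphM => /max_prime.
- by rewrite rmorph1 in_max1.
Qed.

Lemma sep_part_spec i : [/\ (sep_part p m i).1 \is monic, irreducible_poly (sep_part p m i).1,
  separable_poly (sep_part p m i).1
  & gen_poly m i = (sep_part p m i).1 \Po 'X^(p ^ (sep_part p m i).2)].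
Proof.
have [mg irrg _] := gen_poly_spec i.
have [fk Hfk] := sep_part_exists hp mg irrg.
by rewrite /sep_part; case: xgetP => [x _ //|/(_ fk)].
Qed.

End MaximalIdeal.

(** * The étale algebra defined by the [f_i] and its factor [Gamma(m)] *)

Section PointOfMaxSpec.
Variables (K : fieldType) (p : nat) (hp : p \in [pchar K]) (n : nat).
Variable m : maxSpec K n.
Local Notation P := {mpoly K[n]}.
Local Notation D := (diffop K n).
Local Notation M := (in_max m).
Local Notation k := (insep_exp p m).
Local Notation psi := (psi p k).
Local Notation A := (A_span p k : set D).
Local Notation sepf i := (sep_part p m i).1.
Local Notation J := (sep_ideal p m).
Implicit Types (q r s : P) (f g : D).

Let p_gt0 : (0 < p)%N := prime_gt0 (pcharf_prime hp).

Lemma pchar_mpoly : p \in [pchar P].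
Proof. by apply: (rmorph_pchar (@mpolyC n K)). Qed.

Lemma frobeniusB e q r : (q - r) ^+ (p ^ e) = q ^+ (p ^ e) - r ^+ (p ^ e).
Proof.
elim: e => // e IH; rewrite expnSr !exprM IH.
by rewrite -!(pFrobenius_autE pchar_mpoly) rmorphB.
Qed.

Definition kmax := \max_(i < n) k i.
Lemma leq_kmax i : (k i <= kmax)%N.
Proof. exact: (leq_bigmax i). Qed.

Definition n0 r := M (psi r).

Lemma n00 : n0 0. Proof. by rewrite /n0 rmorph0 in_max0. Qed.
Lemma n01 : ~~ n0 1. Proof. by rewrite /n0 rmorph1 in_max1. Qed.
Lemma n0MD a q r : n0 q -> n0 r -> n0 (a * q + r).
Proof. by rewrite /n0 rmorphD rmorphM; apply: in_maxMD. Qed.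
Lemma n0M a q : n0 q -> n0 (a * q).
Proof. by rewrite /n0 rmorphM; apply: in_maxM. Qed.
Lemma n0B q r : n0 q -> n0 r -> n0 (q - r).
Proof. by rewrite /n0 rmorphB; apply: in_maxB. Qed.
Lemma n0_lin (c : K) q r : n0 q -> n0 r -> n0 (c *: q + r).
Proof. by rewrite -mul_mpolyC; apply: n0MD. Qed.
Lemma n0_sub q r : n0 (q - r) -> n0 q = n0 r.
Proof. by rewrite /n0 rmorphB; apply: in_max_sub. Qed.
Lemma n0_prime q r : n0 (q * r) -> n0 q \/ n0 r.
Proof. by rewrite /n0 rmorphM; apply: max_prime. Qed.
Lemma n0C (c : K) : n0 c%:MP = (c == 0).
Proof.
have [->|c0] := eqVneq c 0; first by rewrite n00.
apply/negbTE/negP => /(n0M c^-1%:MP).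
by rewrite -mpolyCM mulVf // mpolyC1 (negPf n01).
Qed.

Lemma frob_max_psi q : M q -> exists2 q', n0 q' & q ^+ (p ^ kmax) = psi q'.
Proof.
move=> Mq; have [q' Eq] := pow_psi hp q leq_kmax.
exists q' => //; rewrite /n0 -Eq -(prednK (_ : 0 < p ^ kmax)%N) ?expn_gt0 ?p_gt0 //.
by rewrite exprSr in_maxM.
Qed.

(** Modulo [psi(n0)] the ideal [m] is nil, so an element invertible modulo [m] is already invertible
    modulo [psi(n0)]: raise [s q - 1] to the power [p^kmax]. *)
Lemma max_psi_unit q : ~~ M q -> exists s t, n0 t /\ s * q = 1 + psi t.
Proof.
move=> nq; have [s Hs] := max_unit nq; have [t nt Et] := frob_max_psi Hs.
exists (s ^+ (p ^ kmax) * q ^+ (p ^ kmax).-1), t; split=> //.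
rewrite -mulrA -exprSr prednK ?expn_gt0 ?p_gt0 // -exprMn -Et frobeniusB expr1n.
by rewrite addrC subrK.
Qed.

(** An inverse [s] of [psi r] modulo [m] need not be in the image of [psi], but its power [p^kmax]
    is. *)
Lemma n0_unit r : ~~ n0 r -> exists s, n0 (s * r - 1).
Proof.
move=> nr; have [s Hs] := max_unit nr; have [t nt Et] := frob_max_psi Hs.
have [s' Es] := pow_psi hp s leq_kmax.
exists (s' * r ^+ (p ^ kmax).-1); rewrite /n0 rmorphB rmorph1 -mulrA -exprSr prednK ?expn_gt0 ?p_gt0 //.
rewrite rmorphM rmorphXn /= -Es -exprMn -[1](expr1n _ (p ^ kmax)) -frobeniusB Et.
exact: nt.
Qed.

Lemma poly_in_comp_Xn (i : 'I_n) (f : {poly K}) c :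
  poly_in i (f \Po 'X^c) = \sum_(j < size f) f`_j *: ('X_i ^+ c) ^+ j :> P.
Proof.
rewrite comp_polyE rmorph_sum; apply: eq_bigr => j _.
by rewrite -mul_polyC rmorphM /= poly_inC mul_mpolyC !rmorphXn /= poly_inX.
Qed.

Lemma gen_poly_psi i : poly_in i (gen_poly m i) = psi (poly_in i (sepf i)).
Proof.
have [_ _ _ ->] := sep_part_spec hp m i; rewrite poly_in_comp_Xn poly_in_monomial linear_sum.
by apply: eq_bigr => j _; rewrite linearZ rmorphXn /= psiX.
Qed.

Lemma n0_sepf i : n0 (poly_in i (sepf i)).
Proof.
have [_ _ H] := gen_poly_spec m i.
by rewrite /n0 -gen_poly_psi -H dvdpp.
Qed.

Lemma sep_ideal0 : J 0.
Proof. by exists (fun=> 0); rewrite big1 // => i _; rewrite mul0r. Qed.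

Lemma sep_idealMD a q r : J q -> J r -> J (a * q + r).
Proof.
move=> [c ->] [d ->]; exists (fun i => a * c i + d i).
rewrite mulr_sumr -big_split; apply: eq_bigr => i _.
by rewrite mulrDl mulrA.
Qed.

Lemma sep_idealM a q : J q -> J (a * q).
Proof. by move=> Jq; rewrite -[_ * _]addr0; apply: sep_idealMD => //; apply: sep_ideal0. Qed.

Lemma sep_idealMr a q : J q -> J (q * a).
Proof. by rewrite mulrC; apply: sep_idealM. Qed.

Lemma sep_idealD q r : J q -> J r -> J (q + r).
Proof. by move=> Jq Jr; rewrite -[q]mul1r; apply: sep_idealMD. Qed.

Lemma sep_ideal_lin (c : K) q r : J q -> J r -> J (c *: q + r).
Proof. by rewrite -mul_mpolyC; apply: sep_idealMD. Qed.

Lemma sep_ideal_dvd i (u : {poly K}) : sepf i %| u -> J (poly_in i u).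
Proof.
case/dvdpP => c ->; rewrite rmorphM; exists (fun j => if j == i then poly_in i c else 0).
rewrite (bigD1 i) //= eqxx big1 ?addr0 // => j /negPf ->.
by rewrite mul0r.
Qed.

Lemma sep_ideal_n0 q : J q -> n0 q.
Proof.
case=> c ->; elim/big_ind: _ => [|x y|i _]; first exact: n00.
  by rewrite /n0 rmorphD; apply: in_maxD.
exact/n0M/n0_sepf.
Qed.

Lemma frob_inv_ex e i : exists h : {poly K}, J ('X_i - \sum_(j < size h) h`_j *: ('X_i ^+ (p ^ e)) ^+ j).
Proof.
have [_ irr sep _] := sep_part_spec hp m i.
have [h Hh] := separable_frob_inv hp e irr sep.
by exists h; rewrite -poly_in_comp_Xn -poly_inX -rmorphB; apply: sep_ideal_dvd.
Qed.

Lemma sep_span_ex : exists e (b : 'I_e -> P), span_mod J setT b.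
Proof.
pose d := \max_(i < n) size (sepf i).
have leq_d i : (size (sepf i) <= d)%N by apply: (leq_bigmax i).
pose I := {ffun 'I_n -> 'I_d}.
pose b (a : I) : P := \prod_i 'X_i ^+ a i.
suff sb : span_mod J setT b.
  exists #|I|, (fun i => b (enum_val i)) => v _.
  have [c Hc] := sb v Logic.I; exists (fun i => c (enum_val i)).
  have <- // : \sum_x c x *: b x = \sum_(i < #|I|) c (enum_val i) *: b (enum_val i).
  by rewrite (reindex (@enum_val I predT)) //; apply: onW_bij (enum_val_bij _).
have red i e : exists c : 'I_d -> K, J ('X_i ^+ e - \sum_j c j *: 'X_i ^+ j).
  pose u := ('X^e : {poly K}) %% sepf i; exists (fun j => u`_j).
  have f0 : sepf i != 0 by have [/monic_neq0] := sep_part_spec hp m i.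
  have su : (size u <= d)%N by rewrite (leq_trans _ (leq_d i)) // ltnW // ltn_modpN0.
  have -> : \sum_(j < d) u`_j *: 'X_i ^+ j = poly_in i u :> P.
    rewrite poly_in_monomial (big_ord_widen _ (fun j => u`_j *: 'X_i ^+ j : P) su).
    rewrite [RHS]big_mkcond; apply: eq_bigr => j _; case: ltnP => // le.
    by rewrite nth_default // scale0r.
  rewrite -poly_inX -rmorphXn -rmorphB; apply: sep_ideal_dvd.
  by rewrite {1}(divp_eq 'X^e (sepf i)) addrK dvdp_mull.
move=> q _; elim/mpolyind: q => [|c a q _ _ [cq Hq]].
  exists (fun=> 0); rewrite big1 ?subr0; last by move=> i _; rewrite scale0r.
  exact: sep_ideal0.
have /choice[C HC] := fun i => red i (a i).
have Ha : J ('X_[a] - \sum_(x : I) (\prod_i C i (x i)) *: b x).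
  have -> : \sum_(x : I) (\prod_i C i (x i)) *: b x = \prod_i (\sum_j C i j *: 'X_i ^+ j).
    rewrite bigA_distr_bigA; apply: eq_bigr => x _ /=.
    by rewrite /b scaler_prod.
  rewrite mpolyXE_id; elim/big_rec2: _ => [|i v u _ Huv]; first by rewrite subrr; apply: sep_ideal0.
  have -> : 'X_i ^+ a i * v - (\sum_j C i j *: 'X_i ^+ j) * u
     = v * ('X_i ^+ a i - \sum_j C i j *: 'X_i ^+ j) + (\sum_j C i j *: 'X_i ^+ j) * (v - u).
    move: (\sum_j _) => s.
    by rewrite !mulrBr [v * s]mulrC addrA subrK [v * _]mulrC.
  by apply: sep_idealMD => //; apply: sep_idealM.
exists (fun x : I => c * \prod_i C i (x i) + cq x).
have := sep_ideal_lin c Ha Hq; congr J.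
rewrite scalerBr addrACA; congr (_ + _); rewrite -opprD; congr (- _).
by rewrite scaler_sumr -big_split; apply: eq_bigr => x _; rewrite scalerDl scalerA.
Qed.

(** Here separability enters: [x_i] is a polynomial in [x_i^p] modulo [f_i], and combinations of
    [p]-th powers are closed under products. *)
Lemma sep_frob_span x : exists s : seq (K * P), J (x - \sum_(y <- s) y.1 *: y.2 ^+ p).
Proof.
pose T x := exists s : seq (K * P), J (x - \sum_(y <- s) y.1 *: y.2 ^+ p).
have TP (c : K) u v : T u -> T v -> T (c *: u + v).
  move=> [s Hs] [t Ht]; exists ([seq (c * y.1, y.2) | y <- s] ++ t).
  have := sep_ideal_lin c Hs Ht; congr J; rewrite big_cat big_map /= scalerBr scaler_sumr.
  have -> : \sum_(y <- s) c *: (y.1 *: y.2 ^+ p) = \sum_(y <- s) (c * y.1) *: y.2 ^+ p.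
    by apply: eq_bigr => y _; rewrite scalerA.
  by rewrite opprD addrACA.
have T0 : T 0 by exists [::]; rewrite big_nil subr0; apply: sep_ideal0.
have TJ u v : J (u - v) -> T v -> T u.
  by move=> Juv [s Hs]; exists s; rewrite -(subrK v u) -addrA; apply: sep_idealD.
have Tpow u : T (u ^+ p).
  by exists [:: (1, u)]; rewrite big_seq1 scale1r subrr; apply: sep_ideal0.
have Tsum (I : Type) (s : seq I) (c : I -> K) F : (forall i, T (F i)) -> T (\sum_(i <- s) c i *: F i).
  by move=> H; elim: s => [|i s IH]; rewrite ?big_nil // big_cons; apply: TP.
have TM u v : T u -> T v -> T (u * v).
  move=> [s Hs] [t Ht]; apply: (@TJ _ ((\sum_(y <- s) y.1 *: y.2 ^+ p) * \sum_(y <- t) y.1 *: y.2 ^+ p)).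
    set u' := \sum_(y <- s) _ in Hs *; set v' := \sum_(y <- t) _ in Ht *.
    have -> : u * v - u' * v' = v * (u - u') + u' * (v - v').
      by rewrite !mulrBr [v * u]mulrC [v * u']mulrC addrA subrK.
    by apply: sep_idealMD => //; apply: sep_idealM.
  rewrite mulr_suml; under eq_bigr => y _ do rewrite -scalerAl mulr_sumr.
  apply: (Tsum _ s) => y; under eq_bigr => z _ do rewrite -scalerAr -exprMn.
  by apply: Tsum.
elim/diffop_poly_ind: x => [|c r q Tr Tq|i q Tq]; last 2 first.
- exact: TP.
- apply: TM => //; have [h] := frob_inv_ex 1 i; rewrite expn1 => /TJ; apply.
  by under eq_bigr => j _ do rewrite exprAC; apply: Tsum.
by rewrite -(expr1n _ p); apply: Tpow.
Qed.

Section FrobeniusFree.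
(* [J'] will be [J] itself and the maximal ideal [n0] *)
Variable J' : P -> Prop.
Hypotheses (J'J : forall q, J q -> J' q) (J'MD : forall a q r, J' q -> J' r -> J' (a * q + r)).

Let J'0 : J' 0. Proof. exact/J'J/sep_ideal0. Qed.
Let J'lin (c : K) q r : J' q -> J' r -> J' (c *: q + r).
Proof. by rewrite -mul_mpolyC; apply: J'MD. Qed.

Lemma ideal_basis : exists d (b : 'I_d -> P), free_mod J' b /\ span_mod J' setT b.
Proof.
have [e [b sb]] := sep_span_ex.
have sb' : span_mod J' setT b by move=> v _; have [c Hc] := sb v Logic.I; exists c; apply: J'J.
have [//|//|d [b' [_ fb' sb'']]] := @basis_mod_exists K P J' J'0 J'lin e setT b _ _ sb'.
by exists d, b'.
Qed.

Lemma ideal_frob_free t (v : 'I_t -> P) : free_mod J' v -> free_mod J' (fun j => v j ^+ p).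
Proof.
have [d [b [fb sb]]] := ideal_basis.
apply: (frob_free_mod hp J'0 J'MD fb sb) => x.
by have [s Hs] := sep_frob_span x; exists s; apply: J'J.
Qed.

(** If [u] is not in [J'], the family with the single member [u] is free, hence so is that of
    [u^p]. *)
Lemma ideal_reduced r e : J' (r ^+ e) -> J' r.
Proof.
have red u : J' (u ^+ p) -> J' u.
  move=> Hu; apply: contrapT => nu.
  have : free_mod J' (fun _ : 'I_1 => u).
    move=> c; rewrite big_ord1 => H i; rewrite ord1; apply/eqP/negPn/negP => c0.
    apply: nu; have := J'lin (c ord0)^-1 H J'0; rewrite scalerA mulVf //.
    by rewrite scale1r addr0.
  move/ideal_frob_free/(_ (fun=> 1)); rewrite big_ord1 scale1r => /(_ Hu ord0) /eqP.
  by rewrite oner_eq0.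
have redp j : J' (r ^+ (p ^ j)) -> J' r.
  by elim: j => // j IH; rewrite expnSr exprM => /red.
move=> He; apply: (redp e); have le : (e <= p ^ e)%N.
  by rewrite ltnW // ltn_expl // prime_gt1 // (pcharf_prime hp).
by rewrite -(subnK le) exprD -[_ * _]addr0; apply: J'MD.
Qed.

Lemma ideal_algebraic r : exists2 u : {poly K}, u != 0 & J' (\sum_(j < size u) u`_j *: r ^+ j).
Proof.
have [d [b [fb sb]]] := ideal_basis.
have [ex|nex] := pselect (exists2 c : 'I_d.+1 -> K, J' (\sum_j c j *: r ^+ j) & exists j, c j != 0).
  have [c Hc [j cj]] := ex; exists (\poly_(j < d.+1) c (inord j)).
    apply: contraNneq cj => /polyP/(_ j); rewrite coef_poly ltn_ord inord_val coef0.
    by move=> ->.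
  set u := \poly_(_ < _) _; have su : (size u <= d.+1)%N := size_poly _ _.
  have <- // : \sum_(j < d.+1) c j *: r ^+ j = \sum_(j < size u) u`_j *: r ^+ j.
  rewrite (big_ord_widen _ (fun j => u`_j *: r ^+ j) su) [RHS]big_mkcond.
  apply: eq_bigr => i _; rewrite coef_poly ltn_ord inord_val; case: ltnP => // le.
  have := nth_default 0 le; rewrite coef_poly ltn_ord inord_val => ->.
  by rewrite scale0r.
have fr : free_mod J' (fun j : 'I_d.+1 => r ^+ j).
  move=> c Hc i; apply/eqP/negPn/negP => ci; apply: nex; exists c => //.
  by exists i.
have /choice[C HC] := fun j : 'I_d.+1 => sb (r ^+ j) Logic.I.
by have := free_mod_le J'0 J'lin fr HC; rewrite ltnn.
Qed.

End FrobeniusFree.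

(** For one [x] in [n0], write a relation of [x] modulo [J] as [X^j u'] with [u'(0) != 0]: then
    [u'(x)] is outside [n0], and [u'(x) x] is nilpotent modulo [J], hence in [J]. As [n0] is finite
    dimensional modulo [J], a product over a basis kills all of it. *)
Lemma n0_annihilator : exists2 c, ~~ n0 c & forall r, n0 r -> J (c * r).
Proof.
have [e [b sb]] := sep_span_ex.
have sbn : span_mod J n0 b by move=> v _; apply: sb.
have [t [r [nr _ sr]]] := basis_mod_exists sep_ideal0 sep_ideal_lin (n00 : (n0 : P -> Prop) 0) n0_lin sbn.
have one x : n0 x -> exists2 c, ~~ n0 c & J (c * x).
  move=> nx; have [u u0 Hu] := ideal_algebraic (fun q H => H) sep_idealMD x.
  have [j [u' ru' Eu]] := multiplicity_XsubC u 0; rewrite u0 /= polyC0 subr0 in ru' Eu.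
  pose ev (w : {poly K}) : P := horner_alg x w.
  have evE w : ev w = \sum_(j < size w) w`_j *: x ^+ j.
    rewrite /ev /horner_alg /= /horner_morph horner_coef size_map_poly.
    by apply: eq_bigr => l _; rewrite coef_map /= mulr_algl.
  rewrite -evE in Hu.
  exists (ev u').
    have : root (u' - u'.[0]%:P) 0 by rewrite rootE !hornerE subrr.
    case/factor_theorem => w; rewrite polyC0 subr0 => /(canRL (subrK _)) Ew.
    apply: contra ru'; rewrite {1}Ew /ev rmorphD rmorphM /= horner_algC horner_algX alg_mpolyC => H.
    by rewrite rootE -n0C -(@n0_sub (horner_alg x w * x + (u'.[0])%:MP)) // addrK n0M.
  apply: (ideal_reduced (fun q H => H) sep_idealMD (e := j.+1)).
  have -> : (ev u' * x) ^+ j.+1 = ev u' ^+ j * x * ev u.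
    rewrite Eu /ev rmorphM rmorphXn /= horner_algX exprMn !exprSr.
    by rewrite [RHS]mulrAC -!mulrA; congr (_ * _); rewrite mulrCA [RHS]mulrCA mulrA [_ * x]mulrC mulrA.
  exact: sep_idealM.
have /choice[c Hc] : forall i, exists c, ~~ n0 c /\ J (c * r i).
  by move=> i; have [c] := one _ (nr i); exists c.
exists (\prod_i c i).
  elim/big_rec: _ => [|i x _ nx]; first exact: n01.
  by apply/negP => /n0_prime[|]; apply/negP => //; case: (Hc i).
move=> x nx; have [a Ha] := sr x nx.
rewrite -(subrK (\sum_i a i *: r i) x) mulrDr; apply: sep_idealD; first exact: sep_idealM.
rewrite mulr_sumr; apply: (big_ind J) => [|? ?|i _]; [exact: sep_ideal0|exact: sep_idealD|].
rewrite (bigD1 i) //= -scalerAr -[_ *: _]addr0; apply: sep_ideal_lin; last exact: sep_ideal0.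
by rewrite mulrAC; apply: sep_idealMr; case: (Hc i).
Qed.

(** Scaled to be 1 modulo [n0], the element that kills [n0] becomes the unit of a factor, and this
    factor is [P_n/n0]. *)
Lemma Gamma_unit_ex : exists e, [/\ is_Gamma_unit p m e, n0 (1 - e) & forall r, n0 r -> J (r * e)].
Proof.
have [c nc Hc] := n0_annihilator; have [s Hs] := n0_unit nc.
have He r : n0 r -> J (r * (s * c)).
  by move=> /Hc H; rewrite [r * _]mulrC -mulrA; apply: sep_idealM.
have ne : ~~ n0 (s * c) by rewrite (n0_sub Hs) n01.
exists (s * c); split=> //; last by rewrite -opprB /n0 rmorphN; apply: in_maxN.
split=> //; split=> [||r nr].
- rewrite -{3}[s * c]mul1r -mulrBl; exact: He.
- by move=> /sep_ideal_n0; apply/negP.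
- have nr0 : ~~ n0 r by apply/negP => /He.
  have [t Ht] := n0_unit nr0; exists t.
  by rewrite mulrA -{2}[s * c]mul1r -mulrBl; apply: He.
Qed.

End PointOfMaxSpec.

(** * The module V(m) *)

(** A synonym of [P_n] that carries the action of [subA hp k] by evaluation; [hp] and [k] are
    recorded so that the instance can be found. *)
Definition evalP (K : fieldType) p (hp : p \in [pchar K]) n (k : 'I_n -> nat) : Type :=
  {mpoly K[n]}.

Section EvalModule.
Variables (K : fieldType) (p : nat) (hp : p \in [pchar K]) (n : nat) (k : 'I_n -> nat).
Local Notation E := (evalP hp k).
HB.instance Definition _ := GRing.Zmodule.on E.
Definition evalP_scale (a : subA hp k) (q : E) : E := diffop_fun (val a) q.
Fact evalP_scaleA a b q : evalP_scale a (evalP_scale b q) = evalP_scale (a * b) q.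
Proof. by []. Qed.
Fact evalP_scale1 : left_id 1 evalP_scale.
Proof. by move=> q; rewrite /evalP_scale /= mul1r. Qed.
Fact evalP_scaleDr : right_distributive evalP_scale +%R.
Proof. by move=> a q r; rewrite /evalP_scale linearD. Qed.
Fact evalP_scaleDl q : {morph evalP_scale^~ q : a b / a + b}.
Proof. by []. Qed.
HB.instance Definition _ := GRing.Zmodule_isLmodule.Build (subA hp k) E
  evalP_scaleA evalP_scale1 evalP_scaleDr evalP_scaleDl.
End EvalModule.

Section SimpleV.
Variables (K : fieldType) (p : nat) (hp : p \in [pchar K]) (n : nat).
Variable m : maxSpec K n.
Local Notation P := {mpoly K[n]}.
Local Notation D := (diffop K n).
Local Notation M := (in_max m).
Local Notation k := (insep_exp p m).
Local Notation psi := (psi p k).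
Local Notation A := (A_span p k : set D).
Local Notation AA := (algA hp m).
Local Notation n0 := (n0 p m).
Implicit Types (q r s t : P) (f g : D).

(** The largest [A(m)]-submodule of [P_n] inside [m]. It is [psi(n0) P_n] by [Nid_decomp], but this
    form makes its maximality easy to prove. *)
Definition Nid q := forall f, A f -> M (f q).

Lemma Nid0 : Nid 0.
Proof. by move=> f _; rewrite linear0 in_max0. Qed.
Lemma NidD q r : Nid q -> Nid r -> Nid (q + r).
Proof. by move=> Hq Hr f Af; rewrite linearD in_maxD ?Hq ?Hr. Qed.
Lemma NidA f q : A f -> Nid q -> Nid (f q).
Proof. by move=> Af Hq g Ag; apply: (Hq (g * f)); apply: A_spanM. Qed.
Lemma NidM r q : Nid q -> Nid (r * q).
Proof. by move=> Hq; apply: (@NidA (mulop r)) => //; apply: A_span_mulop. Qed.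
Lemma NidN q : Nid q -> Nid (- q).
Proof. by rewrite -mulN1r; apply: NidM. Qed.
Lemma NidB q r : Nid q -> Nid r -> Nid (q - r).
Proof. by move=> Hq Hr; apply: NidD => //; apply: NidN. Qed.
Lemma Nid_lin (c : K) q r : Nid q -> Nid r -> Nid (c *: q + r).
Proof. by move=> Hq Hr; apply: NidD => //; rewrite -mul_mpolyC; apply: NidM. Qed.
Lemma Nid_psi t q : n0 t -> Nid (psi t * q).
Proof.
move=> nt f /(A_span_ycentral hp) Yf; rewrite ycentral_eval //.
exact: in_maxMr.
Qed.
Lemma Nid_max q : Nid q -> M q.
Proof. by move/(_ 1 (A_span1 hp (k:=k))); rewrite /= mul1r. Qed.
Lemma Nid1 : ~ Nid 1.
Proof. by move/Nid_max; apply/negP/in_max1. Qed.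

(** If [f q] is outside [m] for some [f] in [A], a multiple of [f q] is [1 + psi t] with [t] in
    [n0], and [T] contains 1. *)
Lemma Nid_maximal (T : P -> Prop) : (forall q r, T q -> T r -> T (q + r)) ->
  (forall f q, A f -> T q -> T (f q)) -> (forall t, n0 t -> T (psi t)) -> ~ T 1 ->
  forall q, T q -> Nid q.
Proof.
move=> TD TA Tn T1 q Tq f Af; apply: contrapT => /negP nM; apply: T1.
have [s [t [nt E]]] := max_psi_unit hp nM.
have -> : 1 = mulop s (f q) + mulop (-1) (psi t) by rewrite /= E mulN1r addrK.
by apply: TD; apply: (TA); try exact: A_span_mulop; [exact: TA|exact: Tn].
Qed.

Local Notation E := (evalP hp k).
Local Notation V0 := (quotmod (Nid : set E)).
Local Notation pr := (@quotmod_proj _ E (Nid : set E)).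

Lemma V0_eq0 (q : E) : pr q = 0 <-> Nid q.
Proof.
split=> [/quotmod_proj_eq0|Nq]; last exact/quotmod_proj_eq0/span_incl.
move=> H; have : Defs.span (Nid : set E) q by exact: H.
apply: span_ind => //; split; first by apply/asboolP; apply: Nid0.
move=> a u v /asboolP Hu /asboolP Hv; apply/asboolP; apply: NidD => //.
by apply: NidA => //; apply: valA.
Qed.

Lemma is_V_V0 : is_V hp m V0.
Proof.
have [e [Ge ne _]] := Gamma_unit_ex hp m.
have prZ (a : AA) (q : E) : a *: pr q = pr ((val a : D) q) by rewrite quotmod_projZ.
have prP q (r : E) : (A_poly hp k q : AA) *: pr r = pr (q * r) by rewrite prZ.
split.
- split; first by exists (pr (1 : P)); apply/eqP => /V0_eq0; apply: Nid1.
  move=> S [S0 SP].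
  have [[q [Sq nq]]|nex] := pselect (exists q, pr q \in S /\ ~ Nid q); last first.
    left=> v; have [q ->] := quotmod_surj v => Sq; apply/V0_eq0.
    by apply: contrapT => nq; apply: nex; exists q.
  right; have [f Af nM] : exists2 f, A f & ~~ M (f q).
    by apply: contrapT => H; apply: nq => f Af; apply: contrapT => /negP nM; apply: H; exists f.
  have [s [t [nt Et]]] := max_psi_unit hp nM.
  have SZ (a : AA) v : v \in S -> a *: v \in S.
    by move=> Sv; rewrite -[_ *: _]addr0; apply: SP.
  have S1 : pr (1 : P) \in S.
    pose a : AA := SubA (introT (asboolP _) Af : A_pred k hp f).
    have -> : pr (1 : P) = (A_poly hp k s : AA) *: (a *: pr q).
      rewrite !prZ /= Et; apply/eqP; rewrite -subr_eq0.
      rewrite -(opprK (pr (1 : P))) -opprD oppr_eq0 addrC.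
      have -> : pr (1 + psi t : P) = pr (1 : P) + pr (psi t) by rewrite quotmod_projD.
      rewrite addrAC subrr add0r; apply/eqP/V0_eq0.
      by rewrite -[psi t]mulr1; apply: Nid_psi.
    exact/SZ/SZ.
  move=> v; have [r ->] := quotmod_surj v.
  by rewrite -[r : P]mulr1 -(prP r 1); apply: SZ.
- move=> i v; have [r ->] := quotmod_surj v; rewrite prP (gen_poly_psi hp).
  by apply/V0_eq0/Nid_psi/n0_sepf.
- exists e; split=> //; exists 1, (pr (1 : P)); rewrite mul1r prP mulr1.
  by apply/eqP => /V0_eq0/Nid_max; apply/negP; case: Ge.
Qed.

Lemma is_V_modV : is_V hp m (modV hp m).
Proof.
rewrite /modV; case: pselect => [exV|nex]; first exact: projT2 (cid exV).
by case: nex; exists V0; apply: is_V_V0.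
Qed.

Section Generator.
Variables (V : lmodType AA) (VV : is_V hp m V).
Implicit Types (u v w : V).

(** As [psi t] is central, the vectors it kills form a submodule. For [t] in [n0] this contains some
    [psi(e) u], nonzero because the factor with unit [e] acts nontrivially. *)
Lemma is_V_psi t v : n0 t -> pmul (psi t) v = 0.
Proof.
move=> nt; have [simV gV [e [[[_ _ He] Me] [a [u nu]]]]] := VV.
have JV q x : sep_ideal p m q -> pmul (psi q) x = 0 :> V.
  case=> c ->; rewrite rmorph_sum; elim/big_ind: _ => [|y z Hy Hz|i _]; first exact: pmul0.
    by rewrite pmulDl Hy Hz addr0.
  rewrite rmorphM /= pmulA -gen_poly_psi // -[pmul (poly_in i _) x]A_poly_act.
  by rewrite gV pmulr0.
(* Otherwise [e] would be a multiple of [t e] modulo the [f_i], hence in [n0]. *)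
have te : sep_ideal p m (t * e).
  apply: contrapT => /He[s Hs].
  move: Me; rewrite -[frob_subst p m e]/(psi e) => /negP; apply.
  have := sep_ideal_n0 hp Hs; rewrite /n0 rmorphB => /in_max_sub <-.
  by rewrite !rmorphM mulrA; apply: in_maxMr; rewrite mulrC in_maxMr.
have u0 : pmul (psi e) u != 0.
  apply: contra nu => /eqP E0; rewrite -scalerA A_poly_act.
  by rewrite -[frob_subst p m e]/(psi e) E0 scaler0.
have [|x y Hx Hy|f x Af Hx|H|//] := @simple_stable _ _ hp _ _ V simV (fun x => pmul (psi t) x = 0).
- exact: pmulr0.
- by rewrite pmulDr Hx Hy addr0.
- by rewrite -act_psi // Hx act0r.
- by case/eqP: u0; apply: H; rewrite -pmulA -rmorphM JV.
Qed.

Definition V_gen w := [/\ w != 0, flat w, forall q, pmul q w = 0 <-> Nid q &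
  forall v, exists q, v = pmul q w].

Lemma V_gen_exists : exists w, V_gen w.
Proof.
have [simV _ _] := VV; have [[u u0] _] := simV.
have [b [rb w0 fw]] := flat_exists u0; set w := act _ u in w0 fw.
exists w; split=> // [q|]; last exact: simple_flat_gen.
have sub q' : pmul q' w = 0 -> Nid q'.
  apply: (@Nid_maximal (fun q => pmul q w = 0)) => [x y Hx Hy|f x Af Hx|t nt|].
  - by rewrite pmulDl Hx Hy addr0.
  - by rewrite -flat_eval // Hx act0r.
  - exact: is_V_psi.
  - by rewrite pmul1; apply/eqP.
split=> [|Nq]; first exact: sub.
(* If [q w] were nonzero, simplicity would give [f] with [f(q) w = w]; then [f(q)] and [f(q) - 1]
   would both be in [Nid], and 1 too. *)
apply: contrapT => /eqP qw.
have [|x y [f Af ->] [g Ag ->]|f x Af [g Ag ->]|H|H] :=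
  @simple_stable _ _ hp _ _ V simV (fun x => exists2 f, A f & x = act f (pmul q w)).
- by exists 0; rewrite ?act0l //; apply: A_span0.
- by exists (f + g); rewrite ?actDl //; apply: A_spanD.
- by exists (f * g); rewrite ?actM //; apply: A_spanM.
- by case/eqP: qw; apply: H; exists 1; rewrite ?act1 //; apply: A_span1.
have [f Af] := H w; rewrite flat_eval // => Ew.
have /sub : pmul (f q - 1) w = 0 by rewrite pmulBl pmul1 -Ew subrr.
move=> N1; apply: Nid1; rewrite -[1](subKr (f q)).
by apply: NidB => //; apply: NidA.
Qed.

End Generator.

Lemma is_V_unique (V V' : lmodType AA) : is_V hp m V -> is_V hp m V' -> isom_mod V V'.
Proof.
move=> VV VV'; have [w [w0 fw Nw gw]] := V_gen_exists VV.
have [w' [w0' fw' Nw' gw']] := V_gen_exists VV'.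
have /choice[c Hc] := gw; have /choice[c' Hc'] := gw'.
pose h v := pmul (c v) w'; pose h' v := pmul (c' v) w.
have hE q : h (pmul q w) = pmul q w'.
  apply/eqP; rewrite -subr_eq0 -pmulBl; apply/eqP/Nw'/Nw.
  by rewrite pmulBl -Hc subrr.
have hE' q : h' (pmul q w') = pmul q w.
  apply/eqP; rewrite -subr_eq0 -pmulBl; apply/eqP/Nw/Nw'.
  by rewrite pmulBl -Hc' subrr.
have lh : linear h.
  move=> a u v; rewrite (Hc u) (Hc v) act_val flat_eval //; last exact: valA.
  rewrite -pmulDl !hE pmulDl; congr (_ + _).
  by rewrite [RHS]act_val flat_eval //; apply: valA.
pose H : {linear V -> V'} := HB.pack h (GRing.isLinear.Build AA V V' *:%R h lh).
exists H; exists h' => v; rewrite [H _]/(h _) /=.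
  by rewrite hE' -Hc.
by rewrite -[LHS]/(h (pmul (c' v) w)) hE -Hc'.
Qed.

End SimpleV.

(** What is used of [D(P_n) (x)_A V]. The results on [U(m)] are proved for any such [ov], so by
    [induced_comp] they pass to every module isomorphic to [U(m)]. *)
Record induced_module (K : fieldType) (p : nat) (hp : p \in [pchar K]) (n : nat)
    (k : 'I_n -> nat) (V : lmodType (subA hp k)) (U : lmodType (diffop K n))
    (ov : V -> U) : Prop := InducedModule {
  inducedD : forall v v', ov (v + v') = ov v + ov v';
  induced_act : forall f v, A_span p k f -> f *: ov v = ov (act f v);
  induced_inj0 : forall v, ov v = 0 -> v = 0;
  induced_ind : forall T : U -> Prop, T 0 -> (forall x y, T x -> T y -> T (x + y)) ->
    (forall f v, T (f *: ov v)) -> forall x, T x;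
  induced_lift : forall (N : lmodType (diffop K n)) (h : V -> N),
    (forall v v', h (v + v') = h v + h v') ->
    (forall f v, A_span p k f -> h (act f v) = f *: h v) ->
    exists phi : {linear U -> N}, forall v, phi (ov v) = h v
}.

(** Injectivity of [v -> 1 (x) v] comes from the balanced map that takes [f] and [v] to [proj f]
    applied to [v], whose value is [v] for [f = 1]. *)
Lemma induced_modU (K : fieldType) p (hp : p \in [pchar K]) n (m : maxSpec K n) :
  induced_module (@one_tensorV K p hp n m).
Proof.
split=> [v v'|f v Af|v|T T0 TD Tov|N h hD hA].
- exact: one_tensorD.
- by rewrite /one_tensorV one_tensorZ /= val_insubdA.
- have Ap (f : diffop K n) : A_span p (insep_exp p m) (proj p (insep_exp p m) f).
    by apply/(A_span_ycentral hp)/proj_ycentral.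
  move=> /(@one_tensor_detect _ _ _ _ _ (fun f v => act (proj p (insep_exp p m) f) v)).
  rewrite proj_id // ?act1; first apply.
  + by move=> f g x; rewrite projD // actDl.
  + by move=> f x y; rewrite actDr.
  + move=> f a x; rewrite projMr //; last exact/(A_span_ycentral hp)/valA.
    by rewrite actM ?act_val //; apply: valA.
  + by move=> i; rewrite mul1r mulr1.
- exact: tensor_ind.
- apply: tensor_lift => // a v.
  by rewrite act_val hA //; apply: valA.
Qed.

(** * The module U(m) *)

Section InducedModuleTheory.
Variables (K : fieldType) (p : nat) (hp : p \in [pchar K]) (n : nat).
Variable m : maxSpec K n.
Local Notation P := {mpoly K[n]}.
Local Notation D := (diffop K n).
Local Notation M := (in_max m).
Local Notation k := (insep_exp p m).
Local Notation psi := (psi p k).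
Local Notation A := (A_span p k : set D).
Local Notation n0 := (n0 p m).
Local Notation ldiv := (@ldiv K p n k).
Variables (V : lmodType (subA hp k)) (U : lmodType D) (ov : V -> U).
Hypotheses (VV : is_V hp m V) (HU : induced_module ov).
Implicit Types (a b c : 'X_{1..n}) (q r t : P) (f g : D) (u : U) (v : V).

Let p_gt0 : (0 < p)%N := prime_gt0 (pcharf_prime hp).

Let ovD := inducedD HU.
Let ov_act := induced_act HU.
Let ov_inj0 := induced_inj0 HU.

Lemma ov0 : ov 0 = 0.
Proof. by apply: (addrI (ov 0)); rewrite -ovD !addr0. Qed.

Lemma ov_pmul q v : mulop q *: ov v = ov (pmul q v).
Proof. by apply: ov_act; apply: A_span_mulop. Qed.

Lemma ov_psi t v : n0 t -> mulop (psi t) *: ov v = 0.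
Proof. by move=> nt; rewrite ov_pmul (is_V_psi VV) // ov0. Qed.

Definition ltotal (s : seq 'X_{1..n}) (v : 'X_{1..n} -> V) : U := \sum_(a <- s) ldiv a *: ov (v a).
Definition lsum (Q : pred 'X_{1..n}) u := exists (s : seq 'X_{1..n}) (x : 'X_{1..n} -> V),
  [/\ uniq s, all Q s & u = ltotal s x].

Lemma lsum_add (Q : pred 'X_{1..n}) a v u : Q a -> lsum Q u -> lsum Q (ldiv a *: ov v + u).
Proof.
move=> Qa [s [x [us Qs ->]]]; have [sa|nsa] := boolP (a \in s); last first.
  exists (a :: s), (fun b => if b == a then v else x b); split; rewrite /= ?nsa ?Qa //.
  rewrite /ltotal big_cons eqxx; congr (_ + _); apply: eq_big_seq => b sb.
  by have [E|//] := eqVneq b a; rewrite -E sb in nsa.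
exists s, (fun b => if b == a then v + x b else x b); split=> //.
rewrite /ltotal !(bigD1_seq a sa us) /= eqxx ovD scalerDr addrA; congr (_ + _).
by apply: eq_bigr => b /negPf ->.
Qed.

Lemma lsum0 Q : lsum Q 0.
Proof. by exists [::], (fun=> 0); rewrite /ltotal big_nil. Qed.

Lemma lsumD Q u u' : lsum Q u -> lsum Q u' -> lsum Q (u + u').
Proof.
move=> [s [x [_ Qs ->]]] Hu'; rewrite /ltotal.
elim: s Qs => [|a s IH] /=; first by rewrite big_nil add0r.
by move=> /andP[Qa /IH H]; rewrite big_cons -addrA; apply: lsum_add.
Qed.

Lemma lsum_ltotal (Q : pred 'X_{1..n}) s (x : 'X_{1..n} -> V) : all Q s -> lsum Q (ltotal s x).
Proof.
move=> /allP Qs; rewrite /ltotal big_seq; elim/big_ind: _ => [|u u'|a /Qs Qa].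
- exact: lsum0.
- exact: lsumD.
- rewrite -[_ *: _]addr0; apply: lsum_add => //; exact: lsum0.
Qed.

Lemma lsum_ldiv_sum Q f v : ldiv_sum p k Q f -> lsum Q (f *: ov v).
Proof.
move=> [s [Hs ->]]; rewrite scaler_suml big_seq; elim/big_ind: _ => [|x y|x /Hs[Qx Ax]].
- exact: lsum0.
- exact: lsumD.
rewrite -scalerA ov_act // -[_ *: _]addr0; apply: lsum_add => //; exact: lsum0.
Qed.

Lemma lsum_all u : lsum predT u.
Proof.
elim/(induced_ind HU): u => [|x y|f v]; [exact: lsum0|exact: lsumD|].
exact/lsum_ldiv_sum/diffop_ldiv_sum.
Qed.

(* [y_i] agrees on [V] with a polynomial in [y_i^(p^e)], which commutes with
   the [Lambda_a] such that [a_i < p^e]; their difference is an exact lowering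
   operator on the sum of the [Lambda_a (x) V]. *)
Lemma lowering1 e i : exists2 t, n0 t & forall a v, (a i < p ^ e)%N ->
  mulop (psi t) *: (ldiv a *: ov v) = (if a i == 0%N then 0 else ldiv (a - U_(i))) *: ov v.
Proof.
have [h Hh] := frob_inv_ex hp m e i; set H := \sum_(j < _) _ in Hh.
have nt : n0 (H - 'X_i) by rewrite -opprB -mulN1r; apply/n0M/sep_ideal_n0.
exists (H - 'X_i); first exact: nt.
move=> a v lt.
have comH : mulop (psi H) * ldiv a = ldiv a * mulop (psi H).
  have com1 : mulop (psi ('X_i ^+ (p ^ e))) * ldiv a = ldiv a * mulop (psi ('X_i ^+ (p ^ e))).
    apply/esym/ad0P; rewrite rmorphXn /= psiX -exprM -expnD rmorphXn (ad_pchar_pow (pchar_diffop hp n)).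
    by rewrite iter_ad_divderiv mnmE expnD mulnC ltn_pmul2l ?lt // expn_gt0 p_gt0.
  rewrite /H; elim/big_ind: _ => [|q r Hq Hr|j _].
  - by rewrite !raddf0 mul0r mulr0.
  - by rewrite !raddfD mulrDl mulrDr Hq Hr.
  rewrite !linearZ /= -scalerAl -scalerAr; congr (_ *: _).
  rewrite !rmorphXn /= in com1 *; elim: (nat_of_ord j) => [|l IH]; first by rewrite mul1r mulr1.
  by rewrite exprS -mulrA IH !mulrA com1.
have E : mulop (psi (H - 'X_i)) * ldiv a = ldiv a * mulop (psi (H - 'X_i)) + ad (yvar K p k i) (ldiv a).
  rewrite rmorphB raddfB mulrBl mulrBr comH -addrA; congr (_ + _).
  by rewrite /= psiX /ad /yvar addKr.
by rewrite scalerA E scalerDl -scalerA ov_psi // scaler0 add0r ad_yvar_ldiv.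
Qed.

(** A product of one-step lowerings; the bound [a_i < p^e] survives each step because exponents only
    decrease. For [b = 0] the operator is 1, and 1 is outside [n0]. *)
Lemma lowering e b : exists2 t, (b != 0%MM -> n0 t) & forall a v, (forall i, (a i < p ^ e)%N) ->
  mulop (psi t) *: (ldiv a *: ov v) = (if (b <= a)%MM then ldiv (a - b) else 0) *: ov v.
Proof.
have [d] := ubnP (mdeg b); elim: d b => // d IH b; rewrite ltnS => led.
have [->|b0] := eqVneq b 0%MM.
  exists 1; first by [].
  move=> a v _; rewrite rmorph1 scale1r (_ : (0 <= a)%MM) ?subm0 //.
  by apply/mnm_lepP => i; rewrite mnm0E.
have [i bi] : exists i, b i != 0%N.
  apply/existsP; apply: contraNT b0; rewrite negb_exists => /forallP H.
  by apply/eqP/mnmP => l; have := H l; rewrite negbK mnm0E => /eqP.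
have Eb : b = (U_(i) + (b - U_(i)))%MM.
  by rewrite addmC submK //; apply/mnm_lepP => s; rewrite mnm1E; case: eqP => // <-; rewrite lt0n.
have [|t nt Ht] := IH (b - U_(i))%MM.
  by move: led; rewrite {1}Eb mdegD mdeg1.
have [t1 nt1 Ht1] := lowering1 e i.
exists (t1 * t) => [_|a v lta]; first by rewrite mulrC; apply: n0M.
rewrite rmorphM mulopM -scalerA Ht //.
have [le|nle] := boolP (b - U_(i) <= a)%MM; last first.
  rewrite scale0r scaler0; case: ifP => // le; last by rewrite scale0r.
  case/negP: nle; apply/mnm_lepP => j; rewrite mnmBE (leq_trans (leq_subr _ _)) //.
  by move/mnm_lepP: le.
rewrite Ht1; last by rewrite mnmBE (leq_ltn_trans (leq_subr _ _)).
have -> : (b <= a)%MM = ((a - (b - U_(i)))%MM i != 0%N).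
  rewrite !mnmBE mnm1E eqxx -lt0n subn_gt0; apply/mnm_lepP/idP => [/(_ i)|lt j].
    by rewrite -ltnS subn1 prednK // lt0n.
  have [<-|ne] := eqVneq i j.
    by move: lt; rewrite subn1 -ltnS prednK // lt0n.
  by have /mnm_lepP/(_ j) := le; rewrite mnmBE mnm1E (negPf ne) subn0.
have [_|_] := eqVneq _ 0%N; rewrite ?scale0r //=; congr (ldiv _ *: _).
by rewrite submDA addmC -Eb.
Qed.

(** Lowering by an index [b] of maximal degree among those with [x b != 0] kills all other terms.
    For [b = 0] the sum is already in the image of [V], whence the alternative in the conclusion. *)
Lemma ltotal_top s (x : 'X_{1..n} -> V) : uniq s -> (exists2 a, a \in s & x a != 0) ->
  exists t v, [/\ v != 0, mulop (psi t) *: ltotal s x = ov v & n0 t \/ ltotal s x = ov v].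
Proof.
move=> us [a0 sa0 xa0].
pose Q d := has (fun a => (x a != 0) && (mdeg a == d)) s.
have Q0 : exists d, Q d by exists (mdeg a0); apply/hasP; exists a0; rewrite ?xa0 ?eqxx.
have Qb d : Q d -> (d <= \max_(a <- s) mdeg a)%N.
  by move=> /hasP[a sa /andP[_ /eqP <-]]; apply: leq_bigmax_seq.
case: (ex_maxnP Q0 Qb) => d /hasP[b sb /andP[xb /eqP degb]] dmax.
have xa a : a \in s -> x a != 0 -> (mdeg a <= mdeg b)%N.
  by move=> sa nz; rewrite degb; apply: dmax; apply/hasP; exists a; rewrite ?nz ?eqxx.
(* Every exponent [a_i] is at most [e], hence less than [p^e]. *)
pose e := \max_(a <- s) mdeg a.
have [t nt Ht] := lowering e b.
exists t, (x b); split=> //.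
  rewrite /ltotal scaler_sumr (bigD1_seq b sb us) /= Ht; last first.
    move=> i; apply: leq_ltn_trans (ltn_expl _ (prime_gt1 (pcharf_prime hp))).
    apply: (leq_trans _ (leq_bigmax_seq b sb (erefl _))).
    by rewrite mdegE (bigD1 i) //= leq_addr.
  have -> : (b - b = 0)%MM by apply/mnmP => i; rewrite mnmBE subnn mnm0E.
  rewrite (_ : (b <= b)%MM) ?ldiv0; last by apply/mnm_lepP.
  rewrite scale1r big_seq_cond big1 ?addr0 // => a /andP[sa ne].
  have [->|nz] := eqVneq (x a) 0; first by rewrite ov0 !scaler0.
  rewrite Ht; last first.
    move=> i; apply: leq_ltn_trans (ltn_expl _ (prime_gt1 (pcharf_prime hp))).
    apply: (leq_trans _ (leq_bigmax_seq a sa (erefl _))).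
    by rewrite mdegE (bigD1 i) //= leq_addr.
  case: ifP => [leba|_]; last by rewrite scale0r.
  case/eqP: ne; have Ea := submK leba; rewrite -Ea.
  have := xa _ sa nz; rewrite -{1}Ea mdegD -{2}[mdeg b]add0n leq_add2r leqn0 mdeg_eq0.
  by move=> /eqP ->; rewrite add0m.
have [b0|/nt] := eqVneq b 0%MM; [right | by left].
rewrite /ltotal (bigD1_seq b sb us) /= b0 ldiv0 scale1r big_seq_cond big1 ?addr0 // => a /andP[sa ne].
have [->|nz] := eqVneq (x a) 0; first by rewrite ov0 scaler0.
by have := xa _ sa nz; rewrite b0 mdeg0 leqn0 mdeg_eq0 (negPf ne).
Qed.

Lemma ltotal_free s (x : 'X_{1..n} -> V) : uniq s -> ltotal s x = 0 -> forall a, a \in s -> x a = 0.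
Proof.
move=> us E a sa; apply/eqP/negPn/negP => nz.
have [|t [v [v0 Hv _]]] := @ltotal_top s x us; first by exists a.
by case/eqP: v0; apply: ov_inj0; rewrite -Hv E scaler0.
Qed.

Lemma U_top u : u != 0 -> exists t v, [/\ v != 0, mulop (psi t) *: u = ov v & n0 t \/ u = ov v].
Proof.
have [s [x [us _ ->]]] := lsum_all u => nz; apply: ltotal_top => //.
apply: contrapT => nex; case/eqP: nz; rewrite /ltotal big_seq big1 // => a sa.
have [->|xa] := eqVneq (x a) 0; first by rewrite ov0 scaler0.
by case: nex; exists a.
Qed.

Lemma U_simple : simple_mod U.
Proof.
have [[[v0 nv0] _] _ _] := VV; have [simV _ _] := VV.
split; first by exists (ov v0); apply: contra_neq nv0 => /ov_inj0.
move=> S [S0 SP]; have SZ f u : u \in S -> f *: u \in S.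
  by move=> Su; rewrite -[_ *: _]addr0; apply: SP.
have SD u u' : u \in S -> u' \in S -> u + u' \in S.
  by move=> Su Su'; rewrite -[u]scale1r; apply: SP.
have [[u [Su nu]]|nex] := pselect (exists u, u \in S /\ u != 0); last first.
  by left=> u Su; apply/eqP/negPn/negP => nu; apply: nex; exists u.
right; have [t [v [nv Hv _]]] := U_top nu.
have [|x y|f x Af|H|H] := @simple_stable _ _ hp _ _ V simV (fun x => ov x \in S).
- by rewrite ov0.
- by rewrite ovD; apply: SD.
- by rewrite -ov_act //; apply: SZ.
- by case/eqP: nv; apply: H; rewrite -Hv; apply: SZ.
by move=> x; elim/(induced_ind HU): x => [|? ?|f y]; [exact: S0|exact: SD|exact/SZ/H].
Qed.

(** By [U_top], a vector outside the image of [V] is moved to a nonzero one by some [psi t] with [t]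
    in [n0]. So endomorphisms preserve the image of [V]. *)
Lemma U_psi_killed u : (forall t, n0 t -> mulop (psi t) *: u = 0) -> exists v, u = ov v.
Proof.
move=> Hu; have [->|nu] := eqVneq u 0; first by exists 0; rewrite ov0.
have [t [v [nv Hv [/Hu E|->]]]] := U_top nu; last by exists v.
by case/eqP: nv; apply: ov_inj0; rewrite -Hv.
Qed.

Definition redx := {dffun forall i : 'I_n, 'I_(p ^ k i)}.
Definition redm (x : redx) : 'X_{1..n} := [multinom (x i : nat) | i < n].

Lemma reduced_redm x : reduced p k (redm x).
Proof. by apply/forallP => i; rewrite mnmE. Qed.

Lemma redm_inj : injective redm.
Proof.
move=> x y E; apply/ffunP => i; apply/val_inj.
by have /mnmP/(_ i) := E; rewrite !mnmE.
Qed.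

Lemma redm_surj b : reduced p k b -> exists x, b = redm x.
Proof.
move=> /forallP rb; exists (finfun (fun i => Ordinal (rb i)) : redx).
by apply/mnmP => i; rewrite mnmE ffunE.
Qed.

Lemma psi_decomp q : exists c : redx -> P, q = \sum_x psi (c x) * 'X_[redm x].
Proof.
elim/(poly_psi_ind hp (k := k)): q => [c q r [cq ->] [cr ->]|q r [cr ->]|b /redm_surj[x ->]].
- exists (fun x => c *: cq x + cr x); rewrite scaler_sumr -big_split; apply: eq_bigr => x _.
  by rewrite linearP mulrDl -scalerAl.
- by exists (fun x => q * cr x); rewrite mulr_sumr; apply: eq_bigr => x _; rewrite rmorphM mulrA.
- exists (fun y => (y == x)%:R); rewrite (bigD1 x) //= eqxx rmorph1 mul1r big1 ?addr0 // => y /negPf ->.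
  by rewrite rmorph0 mul0r.
Qed.

(** Take [x] in [Q] of maximal degree with [c x] outside [n0]: by [divderiv_top] the divided power
    of exponent [redm x] isolates [psi (c x)] up to terms in [m]. The indices outside [Q], of no
    larger degree, do not interfere. *)
Lemma psi_decomp_top (Q : pred redx) (c : redx -> P) :
  (forall x y, Q x -> ~~ Q y -> (mdeg (redm y) <= mdeg (redm x))%N) ->
  (forall x, Q x -> M (divderiv (redm x) (\sum_x psi (c x) * 'X_[redm x]))) ->
  forall x, Q x -> n0 (c x).
Proof.
move=> Qup HM x0 Qx0; apply/negPn/negP => nx0.
pose T d := [exists x, [&& Q x, ~~ n0 (c x) & mdeg (redm x) == d]].
have T0 : exists d, T d by exists (mdeg (redm x0)); apply/existsP; exists x0; rewrite Qx0 nx0 eqxx.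
have Tb d : T d -> (d <= \max_x mdeg (redm x))%N.
  by move=> /existsP[x /and3P[_ _ /eqP <-]]; apply: (leq_bigmax x).
case: (ex_maxnP T0 Tb) => d /existsP[x /and3P[Qx nx /eqP degx]] dmax.
have Yx : ycentral p k (divderiv (redm x) : D) := ycentral_divderiv hp (reduced_redm x).
have Ex : divderiv (redm x) (\sum_x psi (c x) * 'X_[redm x]) =
    \sum_y psi (c y) * (divderiv (redm x) : D) 'X_[redm y].
  by rewrite linear_sum; apply: eq_bigr => y _; apply: ycentral_eval.
have := HM x Qx; rewrite Ex (bigD1 x) // divderiv_top // eqxx mulr1 => H.
suff : M (psi (c x)) by rewrite -/(n0 (c x)) (negPf nx).
rewrite -(@in_max_sub _ _ _ (psi (c x) + \sum_(y | y != x) psi (c y) * (divderiv (redm x) : D) 'X_[redm y])) // addrAC subrr add0r.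
elim/big_ind: _ => [|? ?|y ne]; [exact: in_max0|exact: in_maxD|].
have [ny|ny] := boolP (n0 (c y)); first exact: in_maxMr.
rewrite divderiv_top; last first.
  have [Qy|/Qup] := boolP (Q y); last by apply.
  by rewrite degx; apply: dmax; apply/existsP; exists y; rewrite Qy ny eqxx.
by rewrite (inj_eq redm_inj) (negPf ne) mulr0 in_max0.
Qed.

Lemma Nid_decomp (c : redx -> P) : Nid p m (\sum_x psi (c x) * 'X_[redm x]) <-> forall x, n0 (c x).
Proof.
split=> [HN x|H].
  apply: (psi_decomp_top (Q := predT)) => // y _; apply: HN.
  exact/A_span_divderiv/reduced_redm.
by elim/big_ind: _ => [|? ?|x _]; [exact: Nid0|exact: NidD|apply: Nid_psi].
Qed.

Lemma Nid_psiE t : Nid p m (psi t) <-> n0 t.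
Proof. by split=> [/(Nid_max hp)|nt] //; rewrite -[psi t]mulr1; apply: Nid_psi. Qed.

(** The flat vectors of [V = P_n/Nid] are the classes of [psi(P_n)]; this determines the
    endomorphisms. *)
Lemma flat_eval_psi q : (forall b, reduced p k b -> b != 0%MM -> Nid p m (divderiv b q)) ->
  exists c : P, Nid p m (q - psi c).
Proof.
move=> Hq; have [c Ec] := psi_decomp q.
have nc : forall x, redm x != 0%MM -> n0 (c x).
  apply: psi_decomp_top => [x y _|x x0]; first by rewrite negbK => /eqP ->; rewrite mdeg0.
  by rewrite -Ec; apply: (Nid_max hp); apply: Hq => //; apply: reduced_redm.
have [|x0 Ex0] := @redm_surj 0%MM; first by apply/forallP => i; rewrite mnm0E expn_gt0 p_gt0.
exists (c x0); rewrite Ec (bigD1 x0) //= -Ex0 mpolyX0 mulr1 addrAC subrr add0r.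
elim/big_ind: _ => [|? ?|x ne]; [exact: Nid0|exact: NidD|apply: Nid_psi => //].
by apply: nc; rewrite Ex0 (inj_eq redm_inj).
Qed.

End InducedModuleTheory.

Lemma has_dim_preimage (K : fieldType) (V V' : lmodType K) (g : V -> V') (W : set V') d :
  linear g -> injective g -> (forall y, W y <-> exists x, g x = y) ->
  has_dim W d -> has_dim (setT : set V) d.
Proof.
move=> lg ig Wg [b [Wb fb]].
pose h : {linear V -> V'} := HB.pack g (GRing.isLinear.Build K V V' *:%R g lg).
have /choice[b' Hb'] : forall i, exists x, g x = b i.
  move=> i; apply/Wg/Wb; exists (fun j => (j == i)%:R).
  by rewrite (bigD1 i) //= eqxx scale1r big1 ?addr0 // => j /negPf ->; rewrite scale0r.
have E c : g (\sum_i c i *: b' i) = \sum_i c i *: b i.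
  by rewrite -[LHS]/(h _) linear_sum; apply: eq_bigr => i _; rewrite linearZ /= Hb'.
exists b'; split=> [v|c].
  split=> // _; have /Wb[c Hc] : W (g v) by apply/Wg; exists v.
  by exists c; apply: ig; rewrite Hc E.
move=> Ec; apply: fb; rewrite -E Ec; exact: (raddf0 h).
Qed.

(** * The separable part of the residue field and the endomorphisms *)

Section ResidueSep.
Variables (K : fieldType) (p : nat) (hp : p \in [pchar K]) (n : nat).
Variable m : maxSpec K n.
Local Notation P := {mpoly K[n]}.
Local Notation M := (in_max m).
Local Notation k := (insep_exp p m).
Local Notation psi := (psi p k).
Local Notation n0 := (n0 p m).
Local Notation res := (res m).
Implicit Types (q r s c : P).

Lemma horner_alg_sum c d (E : nat -> K) :
  horner_alg c (\poly_(j < d) E j) = \sum_(j < d) E j *: c ^+ j.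
Proof.
rewrite poly_def linear_sum; apply: eq_bigr => j _.
by rewrite -mul_polyC rmorphM rmorphXn /= horner_algX horner_algC mulr_algl.
Qed.

Lemma horner_alg_compXn c (h : {poly K}) d :
  horner_alg c (h \Po 'X^d) = \sum_(j < size h) h`_j *: (c ^+ d) ^+ j.
Proof.
rewrite comp_polyE linear_sum; apply: eq_bigr => j _.
by rewrite -mul_polyC rmorphM !rmorphXn /= horner_algX horner_algC mulr_algl.
Qed.

Lemma res_horner (u : {poly K}) q : (map_poly (residue_const m) u).[res q] = res (horner_alg q u).
Proof.
elim/poly_ind: u => [|u c IH]; first by rewrite !rmorph0 horner0.
rewrite !rmorphD !rmorphM /= map_polyX map_polyC !hornerE IH horner_algX horner_algC.
by congr (_ + _); rewrite resZ rmorph1 mulr1.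
Qed.

Lemma psi_horner_alg (u : {poly K}) c : psi (horner_alg c u) = horner_alg (psi c) u.
Proof.
elim/poly_ind: u => [|u a IH]; first by rewrite !rmorph0.
by rewrite !rmorphD !rmorphM /= IH !horner_algX !horner_algC linearZ rmorph1.
Qed.

(** A separable [q] is [h(q^(p^M))] modulo [m], and [q^(p^M)] is in [psi(P_n)] for [M = kmax].
    Conversely let [g] be the minimal polynomial of [c] modulo [n0]. If [g = h(X^p)], the powers
    [c^j] with [j <= deg h] are free, hence so are their [p]-th powers, against [g(c) = 0]. *)
Lemma residue_sep_psi y : residue_sep m y <-> exists c, y = res (psi c).
Proof.
split=> [[u [irr sep]]|[c ->]].
  have [q ->] := res_surj y => /rootP Hu.
  have [h /dvdpP[a Ha]] := separable_frob_inv hp (kmax p m) irr sep.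
  have [q' Eq] := pow_psi hp q (@leq_kmax _ p _ m).
  exists (\sum_(j < size h) h`_j *: q' ^+ j).
  have := congr1 (fun u => (map_poly (residue_const m) u).[res q]) Ha.
  rewrite /= rmorphM hornerM Hu mulr0 res_horner rmorphB /= horner_algX horner_alg_compXn.
  rewrite rmorphB => /eqP; rewrite subr_eq0 => /eqP ->; congr res.
  by rewrite linear_sum; apply: eq_bigr => j _; rewrite linearZ rmorphXn /= Eq.
have n0lin (a : P) q r : n0 q -> n0 r -> n0 (a * q + r) by apply: n0MD.
pose T (u : {poly K}) := n0 (horner_alg c u).
have [|a q|q r|||g [mg irr gT]] := @prime_poly_gen K T.
- by move=> q r Tq Tr; rewrite /T rmorphB; apply: n0B.
- by rewrite /T rmorphM; apply: n0M.
- by rewrite /T rmorphM => /n0_prime.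
- by rewrite /T rmorph1 n01.
- have [u u0 Hu] := ideal_algebraic hp (@sep_ideal_n0 _ _ hp _ m) n0lin c.
  exists u => //; rewrite /T; move: Hu; rewrite -(horner_alg_sum c (size u) (fun j => u`_j)).
  by rewrite coefK.
have Tg : T g by rewrite -gT.
have [sg|[h Eg]] := irredp_separable_or_frob hp irr.
  by exists g; split=> //; apply/rootP; rewrite res_horner -psi_horner_alg; apply/res_eq0.
have p1 : (1 < p)%N := prime_gt1 (pcharf_prime hp).
have [sg1 _] := irr; have g0 : g != 0 by rewrite -size_poly_gt0 (ltn_trans _ sg1).
have ltg : (size h < size g)%N.
  have := size_comp_Xn h (ltnW p1); rewrite -Eg.
  case: (size g) sg1 => [|[|d]] //= _; case: (size h) => [|[|e]] //= Ed.
  by rewrite ltnS Ed ltn_Pmulr.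
have fr : free_mod (n0 : P -> Prop) (fun j : 'I_(size h) => c ^+ j).
  move=> a Ha i; pose E j := oapp a 0 (insub j : option 'I_(size h)).
  have : T (\poly_(j < size h) E j).
    rewrite /T horner_alg_sum; move: Ha; congr n0; apply: eq_bigr => j _.
    by rewrite /E valK.
  rewrite -gT; set u := \poly_(_ < _) _ => gu.
  have Z : u = 0.
    apply/eqP/negPn/negP => nz; have := dvdp_leq nz gu.
    by rewrite leqNgt (leq_ltn_trans (size_poly _ _) ltg).
  by have := congr1 (fun u : {poly K} => u`_i) Z; rewrite coef_poly ltn_ord coef0 /E valK.
have := ideal_frob_free hp (@sep_ideal_n0 _ _ hp _ m) n0lin fr.
move: Tg; rewrite /T Eg horner_alg_compXn.
under eq_bigr => j _ do rewrite exprAC.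
move=> H /(_ (fun j => h`_j) H) h0; case/eqP: g0; rewrite Eg (_ : h = 0) ?comp_poly0 //.
apply/polyP => i; rewrite coef0; have [lt|/(nth_default 0) //] := ltnP i (size h).
exact: (h0 (Ordinal lt)).
Qed.

Lemma residue_sep_dim d (b : 'I_d -> P) : free_mod (n0 : P -> Prop) b -> span_mod (n0 : P -> Prop) setT b ->
  has_dim (residue_sep m : set (residueK m)) d.
Proof.
move=> fb sb; apply: (has_dim_image (f := fun c => res (psi c) : residueK m) _ _ _ fb sb).
- by move=> a u v; rewrite linearP rmorphD /= resZ.
- by move=> v; split=> [nv|/res_eq0]; first exact/res_eq0.
- move=> y; rewrite residue_sep_psi; split=> [[c ->]|[c <-]]; by exists c.
Qed.

Lemma n0_basis : exists d (b : 'I_d -> P), free_mod (n0 : P -> Prop) b /\ span_mod (n0 : P -> Prop) setT b.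
Proof. by apply: (ideal_basis hp (@sep_ideal_n0 _ _ hp _ m)) => a q r; apply: n0MD. Qed.

End ResidueSep.

Section InducedEnd.
Variables (K : fieldType) (p : nat) (hp : p \in [pchar K]) (n : nat).
Variable m : maxSpec K n.
Local Notation P := {mpoly K[n]}.
Local Notation D := (diffop K n).
Local Notation k := (insep_exp p m).
Local Notation psi := (psi p k).
Local Notation A := (A_span p k : set D).
Local Notation n0 := (n0 p m).
Local Notation ldiv := (@ldiv K p n k).
Variables (V : lmodType (subA hp k)) (U : lmodType D) (ov : V -> U).
Hypotheses (VV : is_V hp m V) (HU : induced_module ov).
Implicit Types (a b : 'X_{1..n}) (c q r t : P) (f g : D) (u : U) (v : V) (F G : endo U).

Lemma endo_ex c : exists F, forall v, F (ov v) = ov (pmul (psi c) v).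
Proof.
have [v v'|f v Af|phi Hphi] := induced_lift HU (h := fun v => ov (pmul (psi c) v)).
- by rewrite pmulDr (inducedD HU).
- by rewrite (induced_act HU) // act_psi.
have lphi : is_endo (phi : U -> resK U) by apply/asboolP; exact: linearP.
by exists (Endo lphi).
Qed.

Lemma endoD F u u' : F (u + u') = (F u : U) + F u'.
Proof. by have := endo_linear F 1 u u'; rewrite !scale1r. Qed.

Lemma endo0 F : F 0 = 0.
Proof. by apply: (addrI (F 0 : U)); rewrite -endoD !addr0. Qed.

Lemma endoZ F f u : F (f *: u) = f *: (F u : U).
Proof. by have := endo_linear F f u 0; rewrite endo0 !addr0. Qed.

Variable w : V.
Hypothesis Vw : V_gen w.

Lemma ov_pmul_eq c d : ov (pmul c w) = ov (pmul d w) <-> Nid p m (c - d).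
Proof.
have [_ _ Nw _] := Vw.
rewrite -Nw pmulBl; split=> [E|/eqP]; last by rewrite subr_eq0 => /eqP ->.
apply: (induced_inj0 HU).
by rewrite -pmulBl -(ov_pmul HU) raddfB scalerBl !(ov_pmul HU) E subrr.
Qed.

(** [F] commutes with [psi(n0)], so [F (ov w)] comes from [V]; it is flat like [w], hence [psi c]
    times [w]. *)
Lemma endo_coef_ex F : exists c, F (ov w) = ov (pmul (psi c) w).
Proof.
have [w0 fw Nw gw] := Vw.
have [t nt|v Ev] := U_psi_killed VV HU (u := F (ov w)).
  by rewrite -endoZ (ov_psi VV HU) // endo0.
have [q Eq] := gw v; rewrite {}Eq in Ev.
have [b rb b0|c Hc] := flat_eval_psi hp (m := m) (q := q).
  apply/Nw; have Ab : A (divderiv b) by apply: A_span_divderiv.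
  rewrite -flat_eval //; apply: (induced_inj0 HU); rewrite -(induced_act HU) // -Ev -endoZ.
  by rewrite (induced_act HU) // fw // (ov0 HU) endo0.
by exists c; rewrite Ev; apply/ov_pmul_eq.
Qed.

Definition endo_coef F : P := projT1 (cid (endo_coef_ex F)).
Lemma endo_coefE F : F (ov w) = ov (pmul (psi (endo_coef F)) w).
Proof. by rewrite /endo_coef; case: cid. Qed.

Definition endo_res F : residue m := res m (psi (endo_coef F)).

Lemma endo_resE F c : F (ov w) = ov (pmul (psi c) w) <-> endo_res F = res m (psi c).
Proof.
rewrite endo_coefE ov_pmul_eq -rmorphB (Nid_psiE hp) /endo_res.
split=> [H|/eqP]; first by apply/eqP; rewrite -subr_eq0 -rmorphB -rmorphB; apply/eqP/res_eq0.
by rewrite -subr_eq0 -!rmorphB => /eqP/res_eq0.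
Qed.

Lemma endo_res_inj : injective endo_res.
Proof.
move=> F G /endo_resE E; rewrite -endo_coefE in E; have [_ _ _ gw] := Vw.
apply: endoP; elim/(induced_ind HU) => [|x y Hx Hy|f v].
- by rewrite !endo0.
- by rewrite !endoD Hx Hy.
- by have [q ->] := gw v; rewrite -(ov_pmul HU) !endoZ E.
Qed.

Lemma endo_res_zmod_morphism : zmod_morphism endo_res.
Proof.
move=> F G; rewrite -!rmorphB; apply/endo_resE.
rewrite -[LHS]/((F (ov w) : U) - G (ov w)) !endo_coefE -(ov_pmul HU) -(ov_pmul HU) -(ov_pmul HU).
by rewrite rmorphB raddfB scalerBl.
Qed.

Lemma endo_res_monoid_morphism : monoid_morphism endo_res.
Proof.
split; first by rewrite -(rmorph1 (res m)) -(rmorph1 psi); apply/endo_resE; rewrite rmorph1 pmul1.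
move=> F G; rewrite -!rmorphM; apply/endo_resE.
rewrite [LHS](_ : _ = F (G (ov w))) // endo_coefE -(ov_pmul HU) endoZ endo_coefE.
by rewrite !(ov_pmul HU) -pmulA rmorphM [in RHS]mulrC.
Qed.

Lemma endo_resZ (a : K) F : endo_res (a *: F) = residue_const m a * endo_res F.
Proof.
rewrite -resZ -linearZ; apply/endo_resE.
rewrite [LHS](_ : _ = a%:A *: (F (ov w) : U)) // endo_coefE -!(ov_pmul HU) scalerA.
by rewrite mulr_algl !linearZ.
Qed.

Lemma endo_res_image y : residue_sep m y <-> exists F, endo_res F = y.
Proof.
rewrite (residue_sep_psi hp); split=> [[c ->]|[F <-]]; last by exists (endo_coef F).
by have [F HF] := endo_ex c; exists F; apply/endo_resE.
Qed.

End InducedEnd.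

Section InducedEndDim.
Variables (K : fieldType) (p : nat) (hp : p \in [pchar K]) (n : nat).
Variable m : maxSpec K n.
Variables (V : lmodType (subA hp (insep_exp p m))) (U : lmodType (diffop K n)) (ov : V -> U).
Hypotheses (VV : is_V hp m V) (HU : induced_module ov).

Lemma endo_residue : exists phi : {rmorphism endo U -> residue m},
  [/\ injective phi, (forall c f, phi (c *: f) = residue_const m c * phi f)
    & (forall y, residue_sep m y <-> exists f, phi f = y)].
Proof.
have [w Vw] := V_gen_exists VV.
pose phi : {rmorphism endo U -> residue m} := HB.pack (endo_res VV HU Vw)
  (GRing.isZmodMorphism.Build (endo U) (residue m) _ (endo_res_zmod_morphism VV HU Vw))
  (GRing.isMonoidMorphism.Build (endo U) (residue m) _ (endo_res_monoid_morphism VV HU Vw)).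
exists phi; split; [exact: endo_res_inj | exact: endo_resZ | exact: endo_res_image].
Qed.

Lemma endo_dim e : has_dim (residue_sep m : set (residueK m)) e ->
  has_dim (setT : set (endo U)) e.
Proof.
have [phi [iphi Zphi imphi]] := endo_residue.
apply: (@has_dim_preimage K (endo U) (residueK m) phi) => // a u v.
by rewrite rmorphD Zphi.
Qed.

End InducedEndDim.

Section InducedBasis.
Variables (K : fieldType) (p : nat) (hp : p \in [pchar K]) (n : nat).
Variable m : maxSpec K n.
Local Notation P := {mpoly K[n]}.
Local Notation D := (diffop K n).
Local Notation k := (insep_exp p m).
Local Notation psi := (psi p k).
Local Notation n0 := (n0 p m).
Local Notation ldiv := (@ldiv K p n k).
Local Notation redx := (redx p m).
Variables (V : lmodType (subA hp k)) (U : lmodType D) (ov : V -> U).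
Hypotheses (VV : is_V hp m V) (HU : induced_module ov).
Variables (e : nat) (b : 'I_e -> P).
Hypotheses (fb : free_mod (n0 : P -> Prop) b) (sb : span_mod (n0 : P -> Prop) setT b).

Definition Nbasis (i : redx * 'I_e) : P := psi (b i.2) * 'X_[redm i.1].

Lemma Nbasis_sum (c : redx * 'I_e -> K) : \sum_i c i *: Nbasis i =
  \sum_x psi (\sum_j c (x, j) *: b j) * 'X_[redm x].
Proof.
rewrite (eq_bigr (fun i => c (i.1, i.2) *: Nbasis (i.1, i.2))); last by case.
rewrite -(pair_bigA _ (fun x j => c (x, j) *: Nbasis (x, j))); apply: eq_bigr => x _.
rewrite linear_sum mulr_suml; apply: eq_bigr => j _.
by rewrite linearZ /= -scalerAl.
Qed.

Lemma Nbasis_span : span_mod (Nid p m : set P) setT Nbasis.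
Proof.
move=> q _; have [c ->] := psi_decomp hp m q.
have /choice[C HC] := fun x => @sb (c x) Logic.I.
exists (fun i => C i.1 i.2); rewrite Nbasis_sum -sumrB.
elim/big_ind: _ => [|? ?|x _]; [exact: Nid0|exact: NidD|].
by rewrite -mulrBl -rmorphB; apply: Nid_psi.
Qed.

Lemma Nbasis_free : free_mod (Nid p m : set P) Nbasis.
Proof.
move=> c; rewrite Nbasis_sum => /(Nid_decomp hp) H [x j].
exact: (fb (H x)).
Qed.

Lemma card_redx : #|{: redx}| = (p ^ \sum_i k i)%N.
Proof.
rewrite card_dep_ffun foldrE big_map big_enum expn_sum.
by apply: eq_bigr => i _; rewrite card_ord.
Qed.

Lemma lsum_dim (s : seq 'X_{1..n}) : uniq s ->
  has_dim ((fun u => exists x, u = ltotal ov s x) : set (resK U)) (size s * (p ^ (\sum_i k i) * e)).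
Proof.
move=> us; have [w [w0 fw Nw gw]] := V_gen_exists VV.
pose B (i : 'I_(size s) * (redx * 'I_e)) : resK U :=
  ldiv (nth 0%MM s i.1) *: ov (pmul (Nbasis i.2) w).
have -> : (size s * (p ^ (\sum_i k i) * e))%N = #|{: 'I_(size s) * (redx * 'I_e)}|.
  by rewrite !card_prod !card_ord card_redx.
(* [insub (index a s)] is the position of [a] in [s]; the default 0 is met only outside [s]. *)
have BE (c : 'I_(size s) * (redx * 'I_e) -> K) : \sum_i c i *: B i = ltotal ov s
    (fun a => pmul (\sum_l oapp (fun t => c (t, l)) 0 (insub (index a s)) *: Nbasis l) w).
  rewrite (eq_bigr (fun i => c (i.1, i.2) *: B (i.1, i.2))); last by case.
  rewrite -(pair_bigA _ (fun x j => c (x, j) *: B (x, j))) /= /ltotal (big_nth 0%MM) big_mkord.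
  apply: eq_bigr => t _; rewrite index_uniq // valK /=.
  rewrite -(ov_pmul HU) raddf_sum scaler_suml scaler_sumr; apply: eq_bigr => l _.
  rewrite -[LHS]/((c (t, l))%:A *: (B (t, l) : U)) /B /= -!(ov_pmul HU) !scalerA.
  by rewrite mulr_algl linearZ /= scalerAr.
apply: has_dim_fin (B) _ _ => [u|c].
  split=> [[x ->]|[c ->]]; last by rewrite BE; eexists.
  have /choice[q Hq] := fun a => gw (x a).
  have /choice[C HC] := fun a => @Nbasis_span (q a) Logic.I.
  exists (fun i : 'I_(size s) * (redx * 'I_e) => C (nth 0%MM s i.1) i.2); rewrite BE; apply: eq_big_seq => a sa.
  rewrite Hq; apply: (congr1 (fun u : U => ldiv a *: u)).
  apply/(ov_pmul_eq HU (And4 w0 fw Nw gw)).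
  have lt : (index a s < size s)%N by rewrite index_mem.
  have -> : insub (index a s) = Some (Ordinal lt) :> option 'I_(size s) by exact: insubT.
  by have := HC a; rewrite /= nth_index.
rewrite BE => /(ltotal_free VV HU us) H [t l].
have := H _ (mem_nth 0%MM (ltn_ord t)) => /Nw/Nbasis_free/(_ l).
by rewrite index_uniq // valK.
Qed.

End InducedBasis.

(** * The filtration of U(m) *)

Section Filtration.
Variables (K : fieldType) (n : nat) (M : lmodType (diffop K n)).
Local Notation D := (diffop K n).
Implicit Types (S : set M) (v : M) (f : D).

Lemma resK_scale (c : K) (v : M) : c *: (v : resK M) = (c%:A : D) *: v.
Proof. by []. Qed.

Lemma filtration_lin S i (c : K) v v' : filtration S i v -> filtration S i v' ->
  filtration S i (c *: (v : resK M) + v').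
Proof.
move=> Fv Fv'; have [_ H] := @span_closed K (resK M) (fun w : resK M => exists (f : D) (v : M),
    [/\ canonical_filtration i f, S v & w = f *: v]); apply/asboolP.
by apply: H; apply/asboolP.
Qed.

Lemma filtration0 S i : filtration S i 0.
Proof. by move=> W [W0 _] _. Qed.

Lemma filtrationD S i v v' : filtration S i v -> filtration S i v' -> filtration S i (v + v').
Proof.
by move=> Fv Fv'; have := filtration_lin 1 Fv Fv'; rewrite resK_scale !scale1r.
Qed.

Lemma filtration_gen S i f v : canonical_filtration i f -> S v -> filtration S i (f *: v).
Proof. by move=> Ff Mv; apply: span_incl; exists f, v. Qed.

Lemma filtration_ind S i (T : M -> Prop) : T 0 -> (forall (c : K) v v', T v -> T v' ->
    T ((c%:A : D) *: v + v')) ->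
  (forall f v, canonical_filtration i f -> S v -> T (f *: v)) ->
  forall v, filtration S i v -> T v.
Proof.
move=> T0 TP Tg; apply: (@span_ind K (resK M) _ T) => [|_ [f [v [Ff Mv ->]]]]; last exact: Tg.
split; first exact/asboolP.
by move=> c u v /asboolP Tu /asboolP Tv; apply/asboolP; apply: TP.
Qed.

Lemma filtrationM S i j f v : canonical_filtration i f -> filtration S j v ->
  filtration S (i + j) (f *: v).
Proof.
move=> Ff; move: v; apply: filtration_ind => [|c v v' Fv Fv'|g v Fg Mv].
- by rewrite scaler0; apply: filtration0.
- rewrite scalerDr scalerA mulr_algr -mulr_algl -scalerA.
  exact: filtration_lin.
- by rewrite scalerA; apply: filtration_gen => //; apply: canonical_filtrationM.
Qed.

Lemma filtration_leq S i j v : (i <= j)%N -> filtration S i v -> filtration S j v.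
Proof.
move=> leij; move: v; apply: filtration_ind => [|c v v' Fv Fv'|g v Fg Mv].
- exact: filtration0.
- exact: filtration_lin.
- by apply: filtration_gen => //; apply: canonical_filtration_leq Fg.
Qed.

Lemma filtration_exhaust S v : (forall v, Defs.span S v) -> exists i, filtration S i v.
Proof.
have F1 : canonical_filtration 0 (1 : D).
  have := @canonical_filtration_gen K n 0 0%MM 0%MM; rewrite mdeg0 => /(_ isT).
  by rewrite mpolyX0 [mulop 1]rmorph1 mul1r divderiv0.
move/(_ v); move: v; apply: span_ind => [|v Mv]; last first.
  by exists 0%N; rewrite -[v]scale1r; apply: filtration_gen.
split; first by apply/asboolP; exists 0%N; apply: filtration0.
move=> f u v /asboolP[i Fu] /asboolP[j Fv]; apply/asboolP.
have [l Fl] := canonical_filtration_exhaust f.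
exists (maxn (l + i) j); apply: filtrationD.
  by apply: filtration_leq (filtrationM Fl Fu); apply: leq_maxl.
by apply: filtration_leq Fv; apply: leq_maxr.
Qed.

(** A basis of [S] lies in some level [s] of the filtration of [S'], and [F_i F_s] is contained in
    [F_(i+s)]. *)
Lemma filtration_compare S S' : generating_subspace S -> generating_subspace S' ->
  exists s, forall i v, filtration S i v -> filtration S' (i + s) v.
Proof.
move=> [[d [b [Mb _]]] _] [_ gN].
have /choice[s Hs] := fun i => filtration_exhaust (b i) gN.
exists (\max_i s i) => i; have les j : (s j <= \max_i s i)%N := leq_bigmax j.
move: (\max_i s i) les => t les; apply: filtration_ind => [|c v v' Fv Fv'|g v Fg /Mb[c ->]].
- exact: filtration0.
- exact: filtration_lin.
- apply: filtrationM => //; elim/big_ind: _ => [|x y|j _]; [exact: filtration0|exact: filtrationD|].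
  rewrite -[_ *: _]addr0; apply: filtration_lin; last exact: filtration0.
  by apply: filtration_leq (Hs j); exact: les.
Qed.

Lemma has_multiplicity_holonomic (e : nat) : has_multiplicity M e%:R -> holonomic M.
Proof.
case=> nz gen H; split=> // S /H[d [Hd Ha]]; exists d; split=> //.
have [|N HN] := Ha 1; first by [].
(* The bound for [eps = 1]; the added 1 also keeps the leading coefficient nonzero. *)
pose c : rat := e%:R / n`!%:R + 1.
have c0 : c != 0.
  rewrite gt_eqF // ltr_wpDl // divr_ge0 // ler0n.
exists (c *: 'X^n); split; first by rewrite size_scale // size_polyXn.
exists N => i /HN; rewrite mul1r hornerZ hornerXn ler_distl => /andP[_].
by rewrite /c mulrDl mul1r.
Qed.

(** The sandwich [d (i - t) <= d' i <= d (i + s)], whose two bounds have the same asymptotics. *)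
Lemma multiplicity_quasi_poly (e m : nat) (S' : set M) (d : nat -> nat) : (0 < m)%N ->
  (exists v : M, v != 0) -> generating_subspace S' ->
  (forall i, has_dim (filtration S' i) (d i)) -> quasi_poly m n (e%:R / n`!%:R) d ->
  has_multiplicity M e%:R.
Proof.
move=> m_gt0 nz gN Nd qd; split=> //; first by exists S'.
move=> S gM; have [s Hs] := filtration_compare gM gN; have [t Ht] := filtration_compare gN gM.
have /choice[d' Hd'] : forall i, exists d, has_dim (filtration S i) d.
  move=> i; apply: (has_dim_subspace (Nd (i + s)%N)); [exact: Hs|exact: filtration0|].
  by move=> a u v; apply: filtration_lin.
exists d'; split=> // eps e0.
have le1 i : (d' i <= d (i + s))%N := has_dim_le (Hd' i) (Nd _) (Hs i).
have le2 i : (d i <= d' (i + t))%N := has_dim_le (Nd i) (Hd' _) (Ht i).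
have [N1 H1] := quasi_poly_asymptotic s%:R m_gt0 qd e0.
have [N2 H2] := quasi_poly_asymptotic (- t%:R) m_gt0 qd e0.
exists (maxn (maxn N1 N2) t) => i; rewrite !geq_max => /andP[/andP[l1 l2] l3].
have := H1 i (i + s)%N l1; rewrite natrD => /(_ erefl); rewrite !ler_distl => /andP[_ U1].
have := H2 i (i - t)%N l2; rewrite natrB // => /(_ erefl); rewrite !ler_distl => /andP[U2 _].
rewrite (le_trans U2) /=; last by rewrite ler_nat -{2}(subnK l3).
by apply: le_trans U1; rewrite ler_nat.
Qed.

End Filtration.

Section InducedFiltration.
Variables (K : fieldType) (p : nat) (hp : p \in [pchar K]) (n : nat).
Variable m : maxSpec K n.
Local Notation P := {mpoly K[n]}.
Local Notation D := (diffop K n).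
Local Notation k := (insep_exp p m).
Local Notation psi := (psi p k).
Local Notation n0 := (n0 p m).
Local Notation ldiv := (@ldiv K p n k).
Variables (V : lmodType (subA hp k)) (U : lmodType D) (ov : V -> U).
Hypotheses (VV : is_V hp m V) (HU : induced_module ov).
Implicit Types (a : 'X_{1..n}) (u : U) (v : V).

Let p_gt0 : (0 < p)%N := prime_gt0 (pcharf_prime hp).

Definition level i : pred 'X_{1..n} := fun a => (\sum_j a j * p ^ k j <= i)%N.

Lemma lsumZ Q (c : K) u : lsum ov Q u -> lsum ov Q ((c%:A : D) *: u).
Proof.
move=> [s [x [us Qs ->]]]; exists s, (fun a => pmul c%:MP (x a)); split=> //.
rewrite scaler_sumr; apply: eq_bigr => a _; rewrite -(ov_pmul HU) !scalerA; congr (_ *: _).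
by rewrite mulr_algl -[c%:MP]mulr1 mul_mpolyC linearZ /= rmorph1 mulr_algr.
Qed.

(** Two degree counts: an operator of [F_i] involves only indices of level [i], and [ldiv a] has
    degree [sum_j a_j p^(k_j)]. *)
Lemma filtration_lsum i u : filtration (range ov) i u <-> lsum ov (level i) u.
Proof.
split=> [|[s [x [_ Qs ->]]]].
  move: u; apply: filtration_ind => [|c u u' Hu Hu'|f _ Ff [v _ <-]].
  - exact: lsum0.
  - by apply: (lsumD HU) => //; apply: lsumZ.
  - exact/(lsum_ldiv_sum HU)/(canonical_filtration_ldiv_sum hp).
rewrite /ltotal big_seq; elim/big_ind: _ => [|? ?|a /(allP Qs) Qa]; [exact: filtration0|exact: filtrationD|].
apply: filtration_gen; last by exists (x a).
have := @canonical_filtration_gen K n i 0%MM (dilate p k a).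
rewrite mpolyX0 [mulop 1]rmorph1 mul1r; apply.
by rewrite mdeg0 add0n mdegE; move: Qa; rewrite /level; under eq_bigr => j _ do rewrite -[(_ * _)%N](mnmE (fun i => (a i * p ^ k i)%N)).
Qed.

Definition steps : seq nat := [seq (p ^ k j)%N | j <- enum 'I_n].

Lemma size_steps : size steps = n. Proof. by rewrite size_map size_enum_ord. Qed.

Lemma steps_gt0 : all (ltn 0) steps.
Proof. by apply/allP => _ /mapP[j _ ->]; rewrite /= expn_gt0 p_gt0. Qed.

Lemma nth_steps (j : 'I_n) : nth 0%N steps j = (p ^ k j)%N.
Proof. by rewrite (nth_map j) ?size_enum_ord // nth_ord_enum. Qed.

Definition mnm_of_seq (t : seq nat) : 'X_{1..n} := [multinom nth 0%N t j | j < n].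

Definition level_seq i := [seq mnm_of_seq t | t <- solutions steps i].

Lemma solutions_level i t : (t \in solutions steps i) = (size t == n) && level i (mnm_of_seq t).
Proof.
rewrite (mem_solutions _ _ steps_gt0) size_steps /level; congr (_ && (_ <= _)%N).
by apply: eq_bigr => j _; rewrite nth_steps mnmE.
Qed.

Lemma mem_level_seq i a : (a \in level_seq i) = level i a.
Proof.
apply/mapP/idP => [[t + ->]|La]; first by rewrite solutions_level => /andP[].
have E : a = mnm_of_seq [seq a j | j <- enum 'I_n].
  by apply/mnmP => j; rewrite mnmE (nth_map j) ?size_enum_ord // nth_ord_enum.
exists [seq a j | j <- enum 'I_n]; rewrite // solutions_level -E La.
by rewrite size_map size_enum_ord eqxx.
Qed.

Lemma level_seq_uniq i : uniq (level_seq i).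
Proof.
rewrite map_inj_in_uniq ?solutions_uniq // => t u.
rewrite !solutions_level => /andP[/eqP st _] /andP[/eqP su _] E.
apply: (@eq_from_nth _ 0%N); rewrite ?su // st => j lt.
by have /mnmP/(_ (Ordinal lt)) := E; rewrite !mnmE.
Qed.

Lemma lsum_level i u : lsum ov (level i) u <-> exists x, u = ltotal ov (level_seq i) x.
Proof.
split=> [[s [x [us Qs ->]]]|[x ->]]; last first.
  exists (level_seq i), x; split=> //; first exact: level_seq_uniq.
  by apply/allP => a; rewrite mem_level_seq.
exists (fun a => if a \in s then x a else 0); rewrite /ltotal.
rewrite [RHS](eq_bigr (fun a => if a \in s then ldiv a *: ov (x a) else 0)); last first.
  by move=> a _; case: ifP => // _; rewrite (ov0 HU) scaler0.
rewrite -big_mkcond -big_filter; apply/esym/perm_big/uniq_perm => //.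
  by rewrite filter_uniq // level_seq_uniq.
move=> a; rewrite mem_filter mem_level_seq; apply: andb_idr => /(allP Qs).
by [].
Qed.

Lemma induced_generating : generating_subspace (range ov).
Proof.
split; last first.
  move=> u; move: u; apply: (induced_ind HU) => [W [W0 _] _ //|x y Hx Hy W cW SW|f v W cW SW].
    by have [_ WP] := cW; rewrite -[x]scale1r; apply: WP; [apply: Hx|apply: Hy].
  have [W0 WP] := cW; rewrite -[_ *: _]addr0; apply: WP => //.
  by apply: SW; exists v.
have [e [b [fb sb]]] := n0_basis hp m.
have := lsum_dim VV HU fb sb (s := [:: 0%MM]) isT; set d := (_ * _)%N => Hd; exists d.
congr has_dim: Hd; apply/funext => u; apply/propext; split=> [[x ->]|[v _ <-]].
  by rewrite /ltotal big_seq1 ldiv0 scale1r; exists (x 0%MM).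
by exists (fun=> v); rewrite /ltotal big_seq1 ldiv0 scale1r.
Qed.

Variables (e : nat).
Hypothesis He : has_dim (residue_sep m : set (residueK m)) e.

Lemma n0_basis_dim : exists b : 'I_e -> P, free_mod (n0 : P -> Prop) b /\ span_mod (n0 : P -> Prop) setT b.
Proof.
have [d [b [fb sb]]] := n0_basis hp m.
have Hd := residue_sep_dim hp fb sb.
have -> : e = d by apply/eqP; rewrite eqn_leq (has_dim_le He Hd) // (has_dim_le Hd He).
by exists b.
Qed.

Definition filt_dim i := (count_solutions steps i * (p ^ (\sum_i k i) * e))%N.

Lemma filtration_dim i : has_dim (filtration (range ov) i) (filt_dim i).
Proof.
have [b [fb sb]] := n0_basis_dim.
have := lsum_dim VV HU fb sb (level_seq_uniq i); rewrite size_map.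
by congr has_dim; apply/funext => u; apply/propext; rewrite filtration_lsum lsum_level.
Qed.

Lemma residue_sep_dim_gt0 : (0 < e)%N.
Proof.
have [b [_ sb]] := n0_basis_dim; case: e b sb => // b sb.
have [c] := @sb 1 Logic.I; rewrite big_ord0 subr0 => H; by have := n01 p m; rewrite H.
Qed.

Let period := (p ^ \max_(j < n) k j)%N.
Let period_gt0 : (0 < period)%N. Proof. by rewrite expn_gt0 p_gt0. Qed.

(** The product [p^k] of the steps in the denominator cancels the [p^k] in the dimension of [V(m)],
    which leaves [e/n!]. *)
Lemma filt_dim_quasi_poly : quasi_poly period n (e%:R / n`!%:R) filt_dim.
Proof.
have dv : all (dvdn^~ period) steps.
  by apply/allP => _ /mapP[j _ ->]; apply: dvdn_exp2l; apply: (leq_bigmax j).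
have := quasi_polyM (p ^ (\sum_i k i) * e) (quasi_poly_solutions period_gt0 steps_gt0 dv).
rewrite size_steps big_map big_enum -expn_sum; congr (quasi_poly _ _ _ _).
have nz : ((p ^ \sum_i k i)%:R : rat) != 0 by rewrite pnatr_eq0 -lt0n expn_gt0 p_gt0.
by rewrite !natrM invfM mulrACA [_^-1 * _%:R]mulrC mulfV // mul1r mulrC.
Qed.

Lemma filt_dim_almost_polynomial : almost_polynomial period n (e%:R / n`!%:R) filt_dim.
Proof.
apply: quasi_poly_almost filt_dim_quasi_poly => //.
by rewrite mulf_neq0 ?invr_eq0 ?pnatr_eq0 -?lt0n ?fact_gt0 ?residue_sep_dim_gt0.
Qed.

Lemma induced_multiplicity : has_multiplicity U e%:R.
Proof.
apply: (multiplicity_quasi_poly period_gt0 _ induced_generating filtration_dim filt_dim_quasi_poly).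
by have [] := U_simple VV HU.
Qed.

Lemma filt_dim_series : series_eq_frac filt_dim ((p ^ (\sum_i k i) * e)%:R)%:P
  ((1 - 'X) * \prod_(i < n) (1 - 'X^(p ^ k i))).
Proof.
have := series_solutions (p ^ (\sum_i k i) * e) steps_gt0.
by rewrite big_map big_enum.
Qed.

End InducedFiltration.

(** * Simple finitely presented modules *)

Section LeftIdeals.
Variable R : nzRingType.
Implicit Types (s : seq R) (f g : R).

Definition lspan s : set R^o := @Defs.span R R^o (fun f => f \in s).

Lemma lspan_lin s f g h : lspan s g -> lspan s h -> lspan s (f * g + h).
Proof.
move=> Sg Sh; have [_ H] := @span_closed R R^o (fun f => f \in s); apply/asboolP.
by apply: (H f g h); apply/asboolP.
Qed.

Lemma lspan0 s : lspan s 0. Proof. by move=> W [W0 _] _. Qed.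
Lemma lspanD s g h : lspan s g -> lspan s h -> lspan s (g + h).
Proof. by move=> Sg Sh; rewrite -[g]mul1r; apply: lspan_lin. Qed.
Lemma lspanM s f g : lspan s g -> lspan s (f * g).
Proof. by move=> Sg; rewrite -[_ * _]addr0; apply: lspan_lin => //; apply: lspan0. Qed.
Lemma lspan_gen s g : g \in s -> lspan s g.
Proof. by move=> sg; apply: span_incl. Qed.

Lemma lspan_ind s (T : R -> Prop) : T 0 -> (forall f g h, T g -> T h -> T (f * g + h)) ->
  (forall g, g \in s -> T g) -> forall g, lspan s g -> T g.
Proof.
move=> T0 TP Tg; apply: (@span_ind R R^o _ T) => //; split; first exact/asboolP.
by move=> f g h /asboolP ? /asboolP ?; apply/asboolP; apply: TP.
Qed.

Lemma lspan_sum s g : lspan s g -> exists c : 'I_(size s) -> R, g = \sum_i c i * s`_i.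
Proof.
move: g; apply: lspan_ind => [|f g h [c ->] [d ->]|g sg].
- by exists (fun=> 0); rewrite big1 // => i _; rewrite mul0r.
- exists (fun i => f * c i + d i); rewrite mulr_sumr -big_split; apply: eq_bigr => i _.
  by rewrite mulrDl mulrA.
have lt : (index g s < size s)%N by rewrite index_mem.
exists (fun i => (i == Ordinal lt)%:R); rewrite (bigD1 (Ordinal lt)) //= eqxx mul1r nth_index //.
by rewrite big1 ?addr0 // => i /negPf ->; rewrite mul0r.
Qed.

Lemma simple_generated (M : lmodType R) (v : M) : simple_mod M -> v != 0 ->
  forall x, exists h, x = h *: v.
Proof.
move=> [_ simM] v0; have [|H|H] := simM (fun x => `[< exists h, x = h *: v >]).
- split; first by apply/asboolP; exists 0; rewrite scale0r.
  move=> a u x /asboolP[h ->] /asboolP[g ->]; apply/asboolP.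
  by exists (a * h + g); rewrite scalerDl scalerA.
- by case/eqP: v0; apply: H; apply/asboolP; exists 1; rewrite scale1r.
- by move=> x; apply/asboolP/H.
Qed.

Lemma isom_mod_sym (M N : lmodType R) : isom_mod M N -> isom_mod N M.
Proof.
case=> f [g fK gK].
have lg : linear g.
  by move=> a u v; apply: (can_inj fK); rewrite linearP !gK.
by exists (HB.pack g (GRing.isLinear.Build R N M *:%R g lg) : {linear N -> M}), f.
Qed.

Lemma simple_linear_bij (M N : lmodType R) (phi : {linear M -> N}) (v : M) :
  simple_mod M -> simple_mod N -> phi v != 0 -> bijective phi.
Proof.
move=> simM simN nz.
have inj0 x : phi x = 0 -> x = 0.
  have [_ H] := simM; have [|K0|K1] := H (fun x => phi x == 0); last 2 first.
  - by move=> /eqP; apply: K0.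
  - by case/negP: nz; apply: K1.
  split; first by rewrite unfold_in linear0.
  by move=> a u x' /eqP Eu /eqP Ex; rewrite unfold_in linearP Eu Ex scaler0 addr0.
have inj : injective phi.
  by move=> x y E; apply/eqP; rewrite -subr_eq0; apply/eqP/inj0; rewrite linearB E subrr.
have /choice[g Hg] : forall y, exists x, phi x = y.
  by move=> y; have [h ->] := simple_generated simN nz y; exists (h *: v); rewrite linearZ.
by exists g => // x; apply: inj; rewrite Hg.
Qed.

(* A relation [h v = 0] splits along [h = h (1 - alpha x) + h (alpha x)], where
   [v] is the image of [x] and [f y = (alpha y) v]. *)
Lemma finitely_presented_relations (M : lmodType R) (v : M) : simple_mod M ->
  finitely_presented M -> v != 0 ->
  exists s, (forall g, g \in s -> g *: v = 0) /\ forall h, h *: v = 0 -> lspan s h.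
Proof.
move=> simM [r [t [g [f [fsurj fker]]]]] v0.
have /choice[a Ha] := fun j => simple_generated simM v0 (f (delta_mx 0 j)).
pose alpha (x : 'rV[R]_t) := \sum_j x 0 j * a j.
have fE x : f x = alpha x *: v.
  rewrite {1}[x]row_sum_delta linear_sum scaler_suml; apply: eq_bigr => j _.
  by rewrite linearZ /= Ha scalerA.
have alphaP c x y : alpha (c *: x + y) = c * alpha x + alpha y.
  rewrite mulr_sumr -big_split; apply: eq_bigr => j _.
  by rewrite !mxE mulrDl mulrA.
have [x0 Hx0] := fsurj v.
exists ((1 - alpha x0) :: [seq alpha (g (delta_mx 0 i)) | i <- enum 'I_r]); split.
  move=> h; rewrite inE => /orP[/eqP ->|/mapP[i _ ->]].
    by rewrite scalerBl scale1r -fE Hx0 subrr.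
  by rewrite -fE; apply/fker; exists (delta_mx 0 i).
move=> h hv; have -> : h = h * (1 - alpha x0) + h * alpha x0 by rewrite mulrBr mulr1 subrK.
apply: lspan_lin; first by apply: lspan_gen; rewrite inE eqxx.
have /fker[y Hy] : f (h *: x0) = 0 by rewrite linearZ /= Hx0.
have -> : h * alpha x0 = alpha (g y).
  by rewrite -Hy /alpha mulr_sumr; apply: eq_bigr => j _; rewrite mxE mulrA.
rewrite [y]row_sum_delta linear_sum.
have alpha0 : alpha 0 = 0 by rewrite /alpha big1 // => j _; rewrite mxE mul0r.
elim/big_rec: _ => [|i x _ IH]; first by rewrite alpha0; apply: lspan0.
rewrite linearZ alphaP; apply: lspan_lin => //.
apply: lspan_gen; rewrite inE; apply/orP; right.
by apply: (map_f (fun i => alpha (g (delta_mx 0 i)))); rewrite mem_enum.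
Qed.

Lemma cyclic_finitely_presented (M : lmodType R) (v : M) s :
  (forall x, exists h, x = h *: v) -> (forall h, h *: v = 0 <-> lspan s h) ->
  finitely_presented M.
Proof.
move=> gen ker; pose f (x : 'rV[R]_1) := x 0 0 *: v.
have lf : linear f by move=> a x y; rewrite /f !mxE scalerDl scalerA.
pose g (y : 'rV[R]_(size s)) : 'rV[R]_1 := \row_(_ < 1) \sum_i y 0 i * s`_i.
have lg : linear g.
  move=> a x y; apply/rowP => j; rewrite !mxE mulr_sumr -big_split; apply: eq_bigr => i _.
  by rewrite !mxE mulrDl mulrA.
pose g' : {linear _ -> _} := HB.pack g (GRing.isLinear.Build R _ _ *:%R g lg).
pose f' : {linear _ -> _} := HB.pack f (GRing.isLinear.Build R _ _ *:%R f lf).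
exists (size s), 1%N, g', f'; split=> [x|x] /=.
  by have [h ->] := gen x; exists (\row__ h); rewrite /f mxE.
rewrite /f ker; split=> [/lspan_sum[c Hc]|[y ->]].
  exists (\row_i c i); apply/rowP => j; rewrite ord1 !mxE Hc.
  by apply: eq_bigr => i _; rewrite mxE.
rewrite mxE; elim/big_ind: _ => [|? ?|i _]; [exact: lspan0|exact: lspanD|].
exact/lspanM/lspan_gen/mem_nth.
Qed.

End LeftIdeals.

(** * Nilpotent action of the maximal ideal, associated primes *)

Section Nilpotent.
Variables (K : fieldType) (p : nat) (hp : p \in [pchar K]) (n : nat).
Local Notation P := {mpoly K[n]}.
Local Notation D := (diffop K n).
Variable M : lmodType D.
Implicit Types (q r s : P) (f : D) (u v w : M).

Lemma mulop_scale0 a r u : mulop r *: u = 0 -> mulop (a * r) *: u = 0.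
Proof. by move=> Hr; rewrite mulopM -scalerA Hr scaler0. Qed.

Lemma mulop_expr_le r i j u : (i <= j)%N -> mulop (r ^+ i) *: u = 0 -> mulop (r ^+ j) *: u = 0.
Proof.
by move=> le Hi; rewrite -(subnK le) exprD; apply: mulop_scale0.
Qed.

(** For large [j] the operator [f] commutes with [r^(p^j)], which is a polynomial in the
    [x_i^(p^j)]. *)
Lemma nilpotent_scale r e f w : mulop (r ^+ (p ^ e)) *: w = 0 ->
  exists j, mulop (r ^+ (p ^ j)) *: (f *: w) = 0.
Proof.
move=> Hw; have [e0 He0] := ycentral_large hp f; pose j := maxn e e0.
have [q' Eq] := pow_psi (k := fun _ : 'I_n => j) hp r (fun=> leqnn j).
have Yf : ycentral p (fun=> j) f by move=> i; apply: He0; apply: leq_maxr.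
exists j; rewrite scalerA Eq -(ycentral_psi q' Yf) -Eq -scalerA.
rewrite (@mulop_expr_le r (p ^ e)) ?scaler0 //.
by rewrite leq_exp2l ?leq_maxl // prime_gt1 // (pcharf_prime hp).
Qed.

(** One [r] after the other, multiply by its last power that does not kill the vector. *)
Lemma kill_list (s : seq P) u : u != 0 -> (forall r, r \in s -> exists j, mulop (r ^+ j) *: u = 0) ->
  exists q, mulop q *: u != 0 /\ forall r, r \in s -> mulop (r * q) *: u = 0.
Proof.
move=> u0; elim: s => [|r s IH] Hs; first by exists 1; rewrite [mulop 1]rmorph1 scale1r.
have [r' sr'|q [qu Hq]] := IH; first by apply: Hs; rewrite inE sr' orbT.
have exj : exists j, mulop (r ^+ j * q) *: u == 0.
  have [j Hj] := Hs r (mem_head _ _); exists j.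
  by rewrite mulrC mulopM -scalerA Hj scaler0.
case: (ex_minnP exj) => -[|j] Hj jmin; first by rewrite expr0 mul1r (negPf qu) in Hj.
exists (r ^+ j * q); split.
  by apply/negP => /jmin; rewrite ltnn.
move=> r'; rewrite inE => /orP[/eqP ->|sr']; first by rewrite mulrA -exprS; apply/eqP.
by rewrite mulrCA mulopM -scalerA Hq // scaler0.
Qed.

End Nilpotent.

Section InducedPrimes.
Variables (K : fieldType) (p : nat) (hp : p \in [pchar K]) (n : nat).
Variable m : maxSpec K n.
Local Notation P := {mpoly K[n]}.
Local Notation D := (diffop K n).
Local Notation k := (insep_exp p m).
Local Notation psi := (psi p k).
Local Notation A := (A_span p k : set D).
Local Notation n0 := (n0 p m).
Local Notation kmax := (kmax p m).
Variables (V : lmodType (subA hp k)) (U : lmodType D) (ov : V -> U).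
Hypotheses (VV : is_V hp m V) (HU : induced_module ov).
Implicit Types (q r t : P) (f g h : D) (u : U) (v : V).

Lemma max_nilpotent r u : in_max m r -> exists j, mulop (r ^+ (p ^ j)) *: u = 0.
Proof.
move=> Mr; have p1 : (1 < p)%N := prime_gt1 (pcharf_prime hp).
move: u; apply: (induced_ind HU) => [|x y [i Hi] [j Hj]|f v].
- by exists 0%N; rewrite scaler0.
- exists (maxn i j); rewrite scalerDr (mulop_expr_le _ Hi) ?(mulop_expr_le _ Hj) ?addr0 //.
    by rewrite leq_exp2l // leq_maxr.
  by rewrite leq_exp2l // leq_maxl.
apply: (nilpotent_scale hp (e := kmax)); have [t nt ->] := frob_max_psi hp Mr.
exact: (ov_psi VV HU).
Qed.

(** [Nid] kills [ov w], and [m] is finite dimensional modulo [Nid]. The elements of a basis act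
    nilpotently, so some nonzero multiple of [ov w] is killed by all of [m], and its annihilator is
    no larger by maximality. *)
Lemma max_pred_assoc_prime : assoc_prime U (max_pred m).
Proof.
have [w Vw] := V_gen_exists VV; have [w0 fw Nw gw] := Vw.
have ow0 : ov w != 0 by apply: contra_neq w0; apply: (induced_inj0 HU).
have [e [b [fb sb]]] := n0_basis hp m.
have sN : span_mod (Nid p m : set P) (in_max m : P -> Prop) (fun i : 'I_#|{: redx p m * 'I_e}| => Nbasis (m := m) (p := p) b (enum_val i)).
  move=> q _; have [c Hc] := @Nbasis_span K p hp n m e b sb q Logic.I.
  exists (fun i : 'I_#|{: redx p m * 'I_e}| => c (enum_val i)); rewrite -[X in _ - X](_ : \sum_i c i *: Nbasis (m := m) (p := p) b i = _) //.
  rewrite (reindex (@enum_val _ predT)) /=; last exact: onW_bij (enum_val_bij _).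
  exact: eq_bigr.
have Mlin (a : K) q r : in_max m q -> in_max m r -> in_max m (a *: q + r).
  by move=> Hq Hr; apply/in_maxD/Hr/in_maxZ.
have [d [g [Mg _ sg]]] := @basis_mod_exists K P _ (@Nid0 _ p _ m) (@Nid_lin _ p hp _ m)
  _ (in_max m : P -> Prop) _ (in_max0 m) Mlin sN.
have [|q [qw Hq]] := @kill_list K n U (codom g) (ov w) ow0.
  by move=> _ /codomP[i ->]; have [j Hj] := max_nilpotent (ov w) (Mg i); exists (p ^ j)%N.
split; first exact: (maxSpecP m).1.
- by move=> r s /max_prime[H|H]; apply/orP; [left|right].
set u := mulop q *: ov w in qw Hq *.
have Mu r : in_max m r -> mulop r *: u = 0.
  move=> Mr; have [c Hc] := sg r Mr.
  have : mulop ((r - \sum_i c i *: g i) * q) *: ov w = 0.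
    by rewrite mulrC (ov_pmul HU) (Nw _).2 ?(ov0 HU) //; apply: NidM.
  rewrite mulopM -scalerA -/u raddfB scalerBl => /eqP; rewrite subr_eq0 => /eqP ->.
  have gu i : mulop (c i *: g i) *: u = 0.
    have g0 : mulop (g i) *: u = 0 by rewrite /u scalerA -mulopM Hq // codom_f.
    by rewrite -mul_mpolyC mulopM -scalerA g0 scaler0.
  by rewrite raddf_sum scaler_suml big1 // => i _; apply: gu.
exists u => r; rewrite unfold_in; apply/idP/eqP => [|Hr]; first exact: Mu.
apply/negPn/negP => nM; case/eqP: qw; have [s /Mu] := max_unit nM.
rewrite raddfB /= mulopM scalerBl -scalerA Hr scaler0 sub0r [mulop 1]rmorph1 scale1r.
by move=> /eqP; rewrite oppr_eq0 => /eqP.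
Qed.

(** A prime annihilator contains [m], whose elements act nilpotently on each vector, and equals it
    by maximality. *)
Lemma assoc_primeP (S : {pred P}) : assoc_prime U S <-> S =i max_pred m.
Proof.
split=> [[idS prS [u Hu]]|E]; last first.
  have -> : S = max_pred m by apply/funext => r; have := E r; rewrite !unfold_in.
  exact: max_pred_assoc_prime.
have sub : {subset max_pred m <= S}.
  move=> r Mr; have [j Hj] := max_nilpotent u Mr.
  have : r ^+ (p ^ j) \in S by rewrite Hu Hj eqxx.
  elim: (p ^ j)%N => [|l IH]; first by have [_ /negPf] := idS => ->.
  by rewrite exprS => /prS/orP[].
move=> r; apply/idP/idP; last exact: sub.
exact: (maxSpecP m).2.
Qed.

(** The relations of [ov w] are the reduced [d^[b]] with [b != 0], the [psi(f_i)] and [psi(1 - e)].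
    The last one is there because [n0] is generated by the [f_i] together with [1 - e]. *)
Lemma induced_finitely_presented : finitely_presented U.
Proof.
have [w Vw] := V_gen_exists VV; have [w0 fw Nw gw] := Vw.
have [e [_ ne He]] := Gamma_unit_ex hp m.
pose s : seq D := [seq divderiv (redm x) | x <- enum (redx p m) & redm x != 0%MM] ++
  [seq mulop (psi (poly_in i (sep_part p m i).1)) | i <- enum 'I_n] ++ [:: mulop (psi (1 - e))].
have sw h : lspan s h -> h *: ov w = 0.
  move: h; apply: lspan_ind => [|f g h Hg Hh|g]; first exact: scale0r.
    by rewrite scalerDl -scalerA Hg Hh scaler0 addr0.
  rewrite !mem_cat => /or3P[/mapP[x]|/mapP[i _ ->]|].
  - rewrite mem_filter => /andP[x0 _] ->; rewrite (induced_act HU); last exact/A_span_divderiv/reduced_redm.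
    by rewrite fw ?(ov0 HU) //; apply: reduced_redm.
  - exact/(ov_psi VV HU)/(n0_sepf hp).
  - by rewrite inE => /eqP ->; apply: (ov_psi VV HU).
have J1 b : reduced p k b -> b != 0%MM -> lspan s (divderiv b).
  move=> /(@redm_surj _ _ _ m)[x ->] x0; apply: lspan_gen; rewrite mem_cat; apply/orP; left.
  by apply: map_f; rewrite mem_filter x0 mem_enum.
have Jmul q r : lspan s (mulop r) -> lspan s (mulop (q * r)).
  by rewrite mulopM; apply: lspanM.
have JM q r : lspan s (mulop (psi r)) -> lspan s (mulop (psi (q * r))).
  by rewrite rmorphM; apply: Jmul.
have J2 t : n0 t -> lspan s (mulop (psi t)).
  move=> nt; have -> : t = t * e + t * (1 - e) by rewrite -mulrDr addrC subrK mulr1.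
  rewrite rmorphD raddfD; apply: lspanD; last first.
    apply/JM/lspan_gen; by rewrite !mem_cat inE eqxx !orbT.
  have [c ->] := He _ nt; rewrite rmorph_sum raddf_sum.
  elim/big_ind: _ => [|? ?|i _]; [exact: lspan0|exact: lspanD|].
  apply/JM/lspan_gen; rewrite !mem_cat.
  by apply/orP; right; apply/orP; left; apply: map_f; rewrite mem_enum.
have J3 q : Nid p m q -> lspan s (mulop q).
  have [c ->] := psi_decomp hp m q => /(Nid_decomp hp) nc; rewrite raddf_sum.
  elim/big_ind: _ => [|? ?|x _]; [exact: lspan0|exact: lspanD|].
  by rewrite mulrC; apply/Jmul/J2.
have J4 f : A f -> lspan s (f - mulop (f 1)).
  move=> /(A_span_ycentral hp); move: f; apply: (ycentral_taylor_ind hp) => [|g h Hg Hh|r b rb].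
  - by rewrite [X in mulop X](_ : _ = 0) // raddf0 subr0; apply: lspan0.
  - rewrite [X in mulop X](_ : _ = g 1 + h 1) // raddfD opprD addrACA; exact: lspanD.
  - have -> : (mulop r * divderiv b : D) 1 = r * (b == 0%MM)%:R by rewrite -divderiv_1.
    have [->|b0] := eqVneq b 0%MM; first by rewrite divderiv0 !mulr1 subrr; apply: lspan0.
    by rewrite mulr0 raddf0 subr0; apply/lspanM/J1.
(* Modulo the left ideal of [s], the class of 1 satisfies the relations of [w] in [V], so the
   universal property sends [ov w] to it; every relation of [ov w] is therefore in the ideal. *)
pose pr := quotmod_proj (fun f : D^o => f \in s).
have pr0 h : pr h = 0 <-> lspan s h by apply: quotmod_proj_eq0.
have prD g h : pr (g + h) = pr g + pr h by apply: quotmod_projD.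
have prB g h : lspan s (g - h) -> pr g = pr h.
  by move=> /pr0 E; rewrite -[g](subrK h) prD E add0r.
have prZ (f : D) (h : D^o) : f *: pr h = pr (f * h).
  exact/esym/(quotmod_projZ (fun f : D^o => f \in s) f h).
have /choice[q Hq] := gw.
have hE r v : v = pmul r w -> pr (mulop (q v)) = pr (mulop r).
  move=> Ev; apply: prB; rewrite -raddfB; apply: J3; apply/Nw.
  by rewrite pmulBl -Hq -Ev subrr.
have [v v'|f v Af|phi Hphi] := induced_lift HU (h := fun v => pr (mulop (q v))).
- rewrite (hE (q v + q v')); last by rewrite pmulDl -!Hq.
  by rewrite raddfD prD.
- rewrite (hE (f (q v))); last by rewrite {1}(Hq v) flat_eval.
  rewrite prZ; apply/esym/prB.
  have E : (f * mulop (q v) : D) 1 = f (q v) by rewrite diffop_mulE /= mulr1.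
  have := J4 (f * mulop (q v)); rewrite E; apply.
  by apply: A_spanM => //; apply: A_span_mulop.
apply: (@cyclic_finitely_presented D U (ov w) s) => [x|h].
  by apply: simple_generated; [exact: U_simple VV HU|apply: contra_neq w0; apply: (induced_inj0 HU)].
split=> [Hh|]; last exact: sw.
apply/pr0; rewrite -[h]mulr1 -prZ -(rmorph1 (@mulop K n)) -(hE 1 w) ?pmul1 //.
by rewrite -Hphi -linearZ /= Hh linear0.
Qed.

End InducedPrimes.

Lemma induced_comp (K : fieldType) p (hp : p \in [pchar K]) n (k : 'I_n -> nat)
    (V : lmodType (subA hp k)) (U N : lmodType (diffop K n)) (ov : V -> U) (phi : {linear U -> N}) :
  bijective phi -> induced_module ov -> induced_module (phi \o ov).
Proof.
move=> bphi HU; have [g gK Kg] := bphi.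
split=> [v v'|f v Af|v|T T0 TD Tov x|N' h hD hA] /=.
- by rewrite (inducedD HU) linearD.
- by rewrite -(induced_act HU) // linearZ.
- by rewrite -(linear0 phi) => /(can_inj gK)/(induced_inj0 HU).
- rewrite -(Kg x); apply: (induced_ind HU (T := fun u => T (phi u))) => [|u u' Hu Hu'|f v].
  + by rewrite linear0.
  + by rewrite linearD; apply: TD.
  + by rewrite linearZ; apply: Tov.
have [psi Hpsi] := induced_lift HU hD hA.
have lg : linear g by move=> a u v; apply: (can_inj gK); rewrite linearP !Kg.
exists (psi \o (HB.pack g (GRing.isLinear.Build _ N U *:%R g lg) : {linear N -> U})) => v /=.
by rewrite gK Hpsi.
Qed.

Section RestrictToA.
Variables (K : fieldType) (p : nat) (hp : p \in [pchar K]) (n : nat) (k : 'I_n -> nat).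
Variable M : lmodType (diffop K n).
Local Notation D := (diffop K n).
Local Notation N := (Defs.restrict (A_incl hp k) M : lmodType (subA hp k)).
Implicit Types (u w : M) (f : D).

Lemma restrict_act f u : A_span p k f -> act f (u : N) = f *: u.
Proof. by move=> Af; rewrite -[LHS]/(val (insubd (0 : subA hp k) f) *: u) val_insubdA. Qed.

Lemma restrict_flat w : (forall b, reduced p k b -> b != 0%MM -> divderiv b *: w = 0) ->
  flat (w : N).
Proof.
by move=> Hw b rb b0; rewrite restrict_act ?Hw //; apply: A_span_divderiv.
Qed.

Lemma exists_flat u : u != 0 -> exists b, [/\ reduced p k b, divderiv b *: u != 0 &
  forall c, reduced p k c -> c != 0%MM -> divderiv c *: (divderiv b *: u) = 0].
Proof.
move=> u0; have [b [rb nz fl]] := @flat_exists _ _ hp _ _ N u u0.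
have Ab := @A_span_divderiv K p n k.
exists b; rewrite restrict_act in nz; last exact: Ab.
split=> // c rc c0; have := fl c rc c0; rewrite restrict_act; last exact: Ab.
by rewrite restrict_act; last exact: Ab.
Qed.

Lemma flat_scale w f q : (forall b, reduced p k b -> b != 0%MM -> divderiv b *: w = 0) ->
  A_span p k f -> f *: (mulop q *: w) = mulop (f q) *: w.
Proof.
move=> /restrict_flat fw Af; have := flat_eval q fw Af.
by rewrite /pmul !restrict_act //; apply: A_span_mulop.
Qed.

End RestrictToA.

(** * From a simple module to its maximal ideal *)

Section Classification.
Variables (K : fieldType) (p : nat) (hp : p \in [pchar K]) (n : nat).
Local Notation P := {mpoly K[n]}.
Local Notation D := (diffop K n).
Variable M : lmodType D.
Hypothesis simM : simple_mod M.
Implicit Types (q r : P) (f g h : D) (u v w : M).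

Let p_gt0 : (0 < p)%N := prime_gt0 (pcharf_prime hp).

Lemma common_level (s : seq D) : exists e, forall f, f \in s -> ycentral p (fun _ : 'I_n => e) f.
Proof.
suff [e He] : exists e, forall e', (e <= e')%N -> forall f, f \in s -> ycentral p (fun _ : 'I_n => e') f.
  by exists e; apply: He.
elim: s => [|f s [e He]]; first by exists 0%N.
have [e0 He0] := ycentral_large hp f; exists (maxn e e0) => e'; rewrite geq_max => /andP[le le0] g.
by rewrite inE => /orP[/eqP ->|]; [move=> i; apply: He0 | apply: He].
Qed.

(* The relations of [v] lie in the commutant of the [x_i^(p^e)], onto which
   [proj] projects: so the commutant acts simply on the orbit of [v]. *)
Lemma commutant_inverse v (s : seq D) e f : v != 0 ->
  (forall g, g \in s -> g *: v = 0) -> (forall h, h *: v = 0 -> lspan s h) ->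
  (forall g, g \in s -> ycentral p (fun _ : 'I_n => e) g) ->
  ycentral p (fun=> e) f -> f *: v != 0 -> exists2 g, ycentral p (fun=> e) g & g *: (f *: v) = v.
Proof.
move=> v0 sv Iv cs cf fv; have [d Hd] := simple_generated simM fv v.
exists (proj p (fun=> e) d); first exact: proj_ycentral.
have H1 : (d * f - 1) *: v = 0 by rewrite scalerBl -scalerA -Hd scale1r subrr.
have [c Hc] := lspan_sum (Iv _ H1).
have c1 : ycentral p (fun _ : 'I_n => e) (- 1 : D) by move=> i; rewrite mulNr mul1r mulrN mulr1.
(* [proj] is right linear over the commutant, which contains [f] and the relations: it carries
   [d f - 1 = sum_i c_i s_i] into the commutant. *)
have Hp : proj p (fun=> e) d * f - 1 = \sum_i proj p (fun=> e) (c i) * s`_i.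
  have -> : proj p (fun=> e) d * f - 1 = proj p (fun=> e) (d * f - 1).
    by rewrite projD // projMr // [proj _ _ (- 1)]proj_id.
  rewrite Hc.
  have p0 : proj p (fun _ : 'I_n => e) (0 : D) = 0.
    by rewrite proj_id // => i; rewrite mul0r mulr0.
  rewrite (big_morph _ (@projD K p hp n (fun=> e)) p0).
  by apply: eq_bigr => i _; rewrite projMr //; apply/cs/mem_nth.
rewrite scalerA; apply/eqP; rewrite -subr_eq0 -[X in _ - X]scale1r -scalerBl Hp.
by rewrite scaler_suml big1 // => i _; rewrite -scalerA sv ?scaler0 ?mem_nth.
Qed.

Lemma frobeniusD e q r : (q + r) ^+ (p ^ e) = q ^+ (p ^ e) + r ^+ (p ^ e).
Proof.
by rewrite -[r in LHS]opprK (frobeniusB hp) -[in LHS](sub0r r) (frobeniusB hp) expr0n eqn0Ngt expn_gt0 p_gt0 sub0r opprK.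
Qed.

Lemma simple_fp_point : finitely_presented M -> exists (m : maxSpec K n) w,
  w != 0 /\ forall r, in_max m r -> exists j, mulop (r ^+ (p ^ j)) *: w = 0.
Proof.
move=> fpM; have [[v v0] _] := simM.
have [s [sv Iv]] := finitely_presented_relations simM fpM v0.
have [e cs] := common_level s.
have inv f := @commutant_inverse v s e f v0 sv Iv cs.
have [b [rb w0 fw]] := exists_flat hp (fun=> e) v0; set w := divderiv b *: v in w0 fw.
have cb : ycentral p (fun=> e) (divderiv b : D) := ycentral_divderiv hp rb.
(* The exponent [p^e] makes [S] additive, and [r^(p^e)] commutes with the commutant, which the
   inversion below uses. *)
pose S (r : P) : bool := mulop (r ^+ (p ^ e)) *: w == 0.
have pe0 : (0 < p ^ e)%N by rewrite expn_gt0 p_gt0.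
have idS : idealr_closed (S : {pred P}).
  split; first by rewrite unfold_in /S expr0n eqn0Ngt pe0 raddf0 scale0r.
    by rewrite unfold_in /S expr1n [mulop 1]rmorph1 scale1r.
  move=> a q r; rewrite !unfold_in /S => /eqP Hq /eqP Hr.
  by rewrite frobeniusD raddfD scalerDl Hr addr0 exprMn mulop_scale0.
(* Some [g] of the commutant brings [r^(p^e) w] back to [v], so [d^[b] g] brings it to [w]. On the
   flat [w] this operator acts through its value [a] at 1, whence [a r^(p^e) w = w]. *)
have unitS r : ~~ S r -> exists t, S (t * r ^+ (p ^ e) - 1).
  move=> nr; have [r' Er] := pow_psi (k := fun _ : 'I_n => e) hp r (fun=> leqnn e).
  have cf : ycentral p (fun=> e) (mulop (r ^+ (p ^ e)) * divderiv b : D).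
    by apply: ycentralM => //; apply: ycentral_mulop.
  have [|g cg Hg] := inv _ cf; first by rewrite -scalerA.
  have cbg := ycentralM cb cg.
  have [a Ea] : exists a, a = (divderiv b * g : D) 1 by eexists.
  exists a; rewrite /S; set y := _ - 1.
  have yw : mulop y *: w = 0.
    rewrite /y raddfB /= scalerBl [mulop 1]rmorph1 scale1r [_ * r ^+ _]mulrC mulopM -scalerA.
    have Abg : A_span p (fun=> e) (divderiv b * g : D) by apply/(A_span_ycentral hp).
    have := flat_scale hp 1 fw Abg; rewrite -Ea [mulop 1]rmorph1 scale1r => <-.
    rewrite scalerA Er -(ycentral_psi r' cbg) -Er -!scalerA.
    by rewrite -scalerA -/w in Hg; rewrite Hg subrr.
  by rewrite -(prednK pe0) exprSr mulopM -scalerA yw scaler0.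
have maxS : maximal_ideal (S : {pred P}).
  split=> // J [J0 J1 JP] SJ r Jr; rewrite unfold_in; apply/negPn/negP => nr.
  have [t St] := unitS r nr; case/negP: J1.
  have -> : 1 = - 1 * (t * r ^+ (p ^ e) - 1) + t * r ^+ (p ^ e) by rewrite mulN1r opprB subrK.
  apply: (JP); first by apply: SJ.
  rewrite -[_ * _]addr0 -(prednK pe0) exprSr mulrA; exact: JP.
by exists (MaxSpec maxS), w; split=> // r /eqP Hr; exists e.
Qed.

(** [psi(f_i)] and [psi(1 - e)] lie in [m], so they act nilpotently on [w] and kill some nonzero
    multiple [u] of it; then so does [psi(n0)]. A flat vector [x] obtained from [u] is still killed
    by [psi(n0)], hence by [Nid], and so receives a map from [V(m)]. *)
Lemma simple_fp_induced : finitely_presented M ->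
  exists (m : maxSpec K n) (ov : modV hp m -> M), isom_mod (modU hp m) M /\ induced_module ov.
Proof.
move=> fpM; have [m [w [w0 nil]]] := simple_fp_point fpM; exists m.
pose k := insep_exp p m.
have [e [_ ne He]] := Gamma_unit_ex hp m.
pose s := [seq psi p k (poly_in i (sep_part p m i).1) | i <- enum 'I_n] ++ [:: psi p k (1 - e)].
have [|q [u0 Hu]] := kill_list (s := s) w0.
  move=> r sr; have [|j Hj] := nil r; last by exists (p ^ j)%N.
  move: sr; rewrite mem_cat => /orP[/mapP[i _ ->]|]; first exact: (n0_sepf hp).
  by rewrite inE => /eqP ->.
set u := mulop q *: w in u0 Hu.
have su r : r \in s -> mulop r *: u = 0 by move=> /Hu; rewrite mulopM -scalerA.
have nu t : n0 p m t -> mulop (psi p k t) *: u = 0.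
  move=> nt; have -> : t = t * e + t * (1 - e) by rewrite -mulrDr addrC subrK mulr1.
  have e0 : mulop (psi p k (t * (1 - e))) *: u = 0.
    by rewrite rmorphM; apply/mulop_scale0/su; rewrite mem_cat inE eqxx orbT.
  rewrite rmorphD raddfD scalerDl e0 addr0.
  have [c ->] := He _ nt; rewrite rmorph_sum raddf_sum scaler_suml big1 // => i _.
  rewrite rmorphM; apply/mulop_scale0/su; rewrite mem_cat; apply/orP; left.
  by apply: (map_f (fun i => psi p k (poly_in i (sep_part p m i).1))); rewrite mem_enum.
have [b [rb x0 fx]] := exists_flat hp k u0; set x := divderiv b *: u in x0 fx.
have nx t : n0 p m t -> mulop (psi p k t) *: x = 0.
  move=> nt; rewrite /x scalerA -(ycentral_psi t (ycentral_divderiv hp rb)) -scalerA.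
  by rewrite nu // scaler0.
have Nx r : Nid p m r -> mulop r *: x = 0.
  have [c ->] := psi_decomp hp m r => /(Nid_decomp hp) nc.
  rewrite raddf_sum scaler_suml big1 // => y _.
  by rewrite mulrC; apply/mulop_scale0/nx.
have VV := is_V_modV hp m; have HU := induced_modU hp m.
have [y [y0 fy Ny gy]] := V_gen_exists VV; have /choice[c Hc] := gy.
have hE r (v : modV hp m) : v = pmul r y -> mulop (c v) *: x = mulop r *: x.
  move=> Ev; apply/eqP; rewrite -subr_eq0 -scalerBl -raddfB; apply/eqP/Nx/Ny.
  by rewrite pmulBl -Hc -Ev subrr.
have [v v'|f v Af|phi Hphi] := induced_lift HU (h := fun v : modV hp m => mulop (c v) *: x).
- rewrite (hE (c v + c v')); last by rewrite pmulDl -!Hc.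
  by rewrite raddfD scalerDl.
- rewrite (hE (f (c v))); last by rewrite {1}(Hc v) flat_eval.
  by rewrite (flat_scale hp (c v) fx Af).
have bphi : bijective phi.
  apply: (simple_linear_bij (v := one_tensorV y) (U_simple VV HU) simM).
  by rewrite Hphi (hE 1) ?pmul1 // [mulop 1]rmorph1 scale1r.
exists (phi \o @one_tensorV _ _ hp _ m); split; first by exists phi.
exact: induced_comp.
Qed.

End Classification.

Lemma induced_Lambda_sum (K : fieldType) (p : nat) (hp : p \in [pchar K]) (n : nat)
    (m : maxSpec K n) (Q : pred 'X_{1..n}) (W : set (modU hp m)) :
  (forall u, W u <-> lsum (@one_tensorV K p hp n m) Q u) -> is_Lambda_sum hp m Q W.
Proof.
move=> HW; have HU := induced_modU hp m; have VV := is_V_modV hp m.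
split=> [u|s v us _]; last exact: (ltotal_free VV HU us).
rewrite HW; split=> [[s [x [_ Qs E]]]|[s [x [Qs ->]]]]; first by exists s, x.
exact: (lsum_ltotal HU x Qs).
Qed.

Lemma maxSpec_ext (K : fieldType) n (m m' : maxSpec K n) : max_pred m =i max_pred m' -> m = m'.
Proof.
case: m m' => [S HS] [S' HS'] E.
have ES : S = S' by apply/funext => r; have := E r; rewrite !unfold_in.
by move: HS' {E}; rewrite -ES => HS'; congr MaxSpec; apply: Prop_irrelevance.
Qed.

Theorem theorem6p7 (K : fieldType) (p : nat) (hp : p \in [pchar K])
    (n : nat) (hn : (0 < n)%N) :
  (* 1. [m |-> U(m)] is a well defined bijection with inverse [ass] *)
  [/\ (forall m : maxSpec K n,
         is_V hp m (modV hp m) /\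
         forall V, is_V hp m V -> isom_mod V (modV hp m)),
      (forall m : maxSpec K n,
         simple_mod (modU hp m) /\ finitely_presented (modU hp m)),
      (forall m m' : maxSpec K n,
         isom_mod (modU hp m) (modU hp m') -> m = m'),
      (forall (m : maxSpec K n) (q : {pred {mpoly K[n]}}),
         assoc_prime (modU hp m) q <-> q =i max_pred m)
    & (forall M : lmodType (diffop K n),
         simple_mod M -> finitely_presented M ->
         exists m : maxSpec K n,
           isom_mod M (modU hp m) /\
           forall q, assoc_prime M q <-> q =i max_pred m)] /\
  (* 2. holonomicity *)
  (forall M : lmodType (diffop K n),
     simple_mod M -> finitely_presented M -> holonomic M) /\
  (* 3. endomorphism rings *)
  (forall m : maxSpec K n,
     exists phi : {rmorphism endo (modU hp m) -> residue m},
       [/\ injective phi,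
           (forall c f, phi (c *: f) = residue_const m c * phi f)
         & (forall y, residue_sep m y <-> exists f, phi f = y)]) /\
  (* 4. [U(m) = Lambda(m) (x) V(m)] and its filtration *)
  (forall m : maxSpec K n,
     let k (i : 'I_n) := insep_exp p m i in
     is_Lambda_sum hp m predT setT /\
     (forall i : nat,
        is_Lambda_sum hp m
          (fun a => (\sum_j a j * p ^ k j <= i)%N) (filtU hp m i)) /\
     exists (e : nat) (d : nat -> nat),
       has_dim (residue_sep m : set (residueK m)) e /\
       (forall i, has_dim (filtU hp m i) (d i)) /\
       (* 4(a) *)
       series_eq_frac d ((p ^ (\sum_i k i) * e)%:R)%:P
         ((1 - 'X) * \prod_(i < n) (1 - 'X^(p ^ k i))) /\
       (* 4(b) *)
       (has_multiplicity (modU hp m) e%:R /\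
        has_dim (setT : set (endo (modU hp m))) e) /\
       (* 4(c) *)
       almost_polynomial (p ^ (\max_(i < n) k i)) n (e%:R / n`!%:R) d).
Proof.
have VV (m : maxSpec K n) := is_V_modV hp m.
have HU (m : maxSpec K n) := induced_modU hp m.
have cls M : simple_mod M -> finitely_presented M -> exists m (ov : modV hp m -> M),
    isom_mod (modU hp m) M /\ induced_module ov := @simple_fp_induced K p hp n M.
have mult m (M : lmodType (diffop K n)) (ov : modV hp m -> M) : induced_module ov ->
    exists e : nat, has_multiplicity M e%:R.
  move=> Hov; have [e [b [fb sb]]] := n0_basis hp m.
  by exists e; apply: (induced_multiplicity (VV m) Hov (residue_sep_dim hp fb sb)).
split; [split|split; [|split]].
- move=> m; split=> [|V HV]; [exact: VV | exact: (is_V_unique HV (VV m))].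
- move=> m; split; first exact: (U_simple (VV m) (HU m)).
  exact: (induced_finitely_presented (VV m) (HU m)).
- move=> m m' [f bf]; apply: maxSpec_ext => r.
  (* Through the isomorphism [U(m')] is also induced from [V(m)], so [m] is an associated prime of
     it. *)
  have Hf := induced_comp bf (HU m).
  have /(assoc_primeP (VV m') (HU m')) := (assoc_primeP (VV m) Hf (max_pred m)).2 (fun=> erefl).
  exact.
- move=> m q; exact: (assoc_primeP (VV m) (HU m) q).
- move=> M simM fpM; have [m [ov [iso Hov]]] := cls M simM fpM.
  exists m; split; first exact: isom_mod_sym.
  exact: (assoc_primeP (VV m) Hov).
- move=> M simM fpM; have [m [ov [_ Hov]]] := cls M simM fpM.
  by have [e He] := mult m M ov Hov; apply: has_multiplicity_holonomic He.
- move=> m; exact: (endo_residue (VV m) (HU m)).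
move=> m k; split.
  apply: induced_Lambda_sum => u; split=> // _; exact: lsum_all.
split=> [i|].
  apply: induced_Lambda_sum => u; exact: (filtration_lsum (HU m)).
have [e [b [fb sb]]] := n0_basis hp m; have He := residue_sep_dim hp fb sb.
exists e, (filt_dim p m e); split=> //; split.
  exact: (filtration_dim (VV m) (HU m) He).
split; first exact: filt_dim_series.
split; last exact: (filt_dim_almost_polynomial hp He).
split; last exact: (endo_dim (VV m) (HU m) He).
exact (induced_multiplicity (VV m) (HU m) He).
Qed.
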